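(* Let $d\in\mathbb N$, $a\in\mathbb R$, $b\in[a,\infty)$, a measure $\mu\colon\mathcal B([a,b]^d)\to[0,\infty]$, and a bounded measurable $f\colon[a,b]^d\to\mathbb R$ be given, let $\sigma\colon\mathbb R\to\mathbb R$ satisfy $\sigma(x)=\max\{x,0\}$ for all $x\in\mathbb R$, let $D_h$, $\mathcal N_h^\theta$, $\mathcal L_h$ (assumed real-valued) be the associated shallow-network objects and let $(\Omega,\mathcal F,\mathbb P)$, $X_n^m$, $Y_n^m$, $M_n^h$, $\mathfrak L_n^h$, $\mathfrak G_n^h$, $\Phi_n^h$, $\Theta_n^h$ ($m,n,h\in\mathbb N_0$) form a generalized stochastic gradient method, all as defined in the context. For every $h\in\mathbb N$ let $\mathbb L^h\colon\mathbb R^{D_h}\to\mathbb R$ satisfy $\mathbb L^h(\theta)=\mathbb E[|\mathcal N_h^\theta(X_0^0)-Y_0^0|^2]$ for all $\theta\in\mathbb R^{D_h}$. Assume that $f$ is continuous, assume $\mathbb P$-a.s. that $\mathbb E[Y_0^0\mid X_0^0]=f(X_0^0)$, let $p\colon\mathbb R^d\to[0,\infty)$ be continuous, assume $p^{-1}((0,\infty))=(a,b)^d$, assume $\mathbb P(X_0^0\in B)=\mu(B)=\int_Bp(x)\,dx$ for all $B\in\mathcal B([a,b]^d)$, assume for all $h\in\mathbb N$ that $\Theta_0^{h,i}$, $i\in\{1,\dots,hd+h\}$, are independent, let $q\colon\mathbb R\to[0,\infty)$ be measurable, let $\eta\in(0,\infty)$ satisfy $(-\eta,\eta)\subseteq q^{-1}((0,\infty))$,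 let $\kappa\in\mathbb R$ satisfy for all $h\in\mathbb N$, $i\in\{1,\dots,hd+h\}$, $x\in\mathbb R$ that $\mathbb P(h^\kappa\Theta_0^{h,i}<x)=\int_{-\infty}^xq(y)\,dy$, and assume for all $h\in\mathbb N$ that $\mathbb E[|f(X_0^0)-Y_0^0|^2]\notin\mathbb L^h(\mathbb R^{D_h})$ (the range of $\mathbb L^h$). Then there exists $\delta\in(0,\infty)$ such that for all $h\in\mathbb N$ $$\mathbb P\Bigl(\liminf_{n\to\infty}\mathbb L^h(\Theta_n^h)=\inf_{\theta\in\mathbb R^{D_h}}\mathbb L^h(\theta)\Bigr)\le\delta^{-1}e^{-\delta h}.$$
   Context: Shallow networks. For $h\in\mathbb N_0$ let $D_h=dh+2h+1$, and for $\theta\in\mathbb R^{D_h}$ let $\mathcal N_h^\theta\colon\mathbb R^d\to\mathbb R$, $$\mathcal N_h^\theta(x)=\theta_{dh+2h+1}+\sum_{i=1}^h\theta_{dh+h+i}\,\sigma\Bigl(\theta_{dh+i}+\sum_{j=1}^d\theta_{(i-1)d+j}x_j\Bigr),$$ and $\mathcal L_h(\theta)=\int_{[a,b]^d}(\mathcal N_h^\theta(x)-f(x))^2\,\mu(dx)$, where $\mathcal L_h\colon\mathbb R^{D_h}\to\mathbb R$ is assumed real-valued for every $h\in\mathbb N_0$. Generalized stochastic gradient method. $(\Omega,\mathcal F,\mathbb P)$ is a probability space; for $m,n\in\mathbb N_0$, $X_n^m\colon\Omega\to[a,b]^d$ and $Y_n^m\colon\Omega\to\mathbb R$ are random variables.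 For every $h,n\in\mathbb N_0$: $M_n^h\in\mathbb N$; $\mathfrak L_n^h\colon\mathbb R^{D_h}\times\Omega\to\mathbb R$ is $\mathfrak L_n^h(\theta)=\frac1{M_n^h}\sum_{m=1}^{M_n^h}|\mathcal N_h^\theta(X_n^m)-Y_n^m|^2$; $\mathfrak G_n^h=(\mathfrak G_n^{h,1},\dots,\mathfrak G_n^{h,D_h})\colon\mathbb R^{D_h}\times\Omega\to\mathbb R^{D_h}$ is a function such that for all $i\in\{1,\dots,h\}$, $j\in\{(i-1)d+1,\dots,(i-1)d+d\}\cup\{hd+i\}$, $\theta\in\mathbb R^{D_h}$ and all $\omega\in\Omega$ for which $\mathbb R^{d+1}\ni(\psi_1,\dots,\psi_{d+1})\mapsto\mathfrak L_n^h(\theta_1,\dots,\theta_{(i-1)d},\psi_1,\dots,\psi_d,\theta_{id+1},\dots,\theta_{dh+i-1},\psi_{d+1},\theta_{dh+i+1},\dots,\theta_{D_h},\omega)$ is differentiable at $(\theta_{(i-1)d+1},\dots,\theta_{id},\theta_{hd+i})$ one has $\mathfrak G_n^{h,j}(\theta,\omega)=(\frac{\partial}{\partial\theta_j}\mathfrak L_n^h)(\theta,\omega)$; $\Theta_n^h=(\Theta_n^{h,1},\dots,\Theta_n^{h,D_h})\colon\Omega\to\mathbb R^{D_h}$ is a random variable; $\Phi_n^h=(\Phi_n^{h,1},\dots,\Phi_n^{h,D_h})\colon(\mathbb R^{D_h})^{n+1}\to\mathbb R^{D_h}$ is a function such that for all $g=((g_{i,j})_{j\in\{1,\dots,D_h\}})_{i\in\{0,\dots,n\}}\in(\mathbb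 R^{D_h})^{n+1}$ and $j\in\{1,\dots,D_h\}$ with $\sum_{i=0}^n|g_{i,j}|=0$ one has $\Phi_n^{h,j}(g)=0$; and $\Theta_{n+1}^h=\Theta_n^h-\Phi_n^h(\mathfrak G_0^h(\Theta_0^h),\mathfrak G_1^h(\Theta_1^h),\dots,\mathfrak G_n^h(\Theta_n^h))$, where $\mathfrak G_n^h(\Theta_n^h)$ means $\omega\mapsto\mathfrak G_n^h(\Theta_n^h(\omega),\omega)$. *)

(* Defs.v *)
From HB Require Import structures.
From mathcomp Require Import all_boot all_order all_algebra.
From mathcomp Require Import all_classical all_reals all_analysis measurable_realfun.
Set Implicit Arguments.
Unset Strict Implicit.
Unset Printing Implicit Defensive.
Import Order.TTheory GRing.Theory Num.Theory.
Import numFieldNormedType.Exports.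
Local Open Scope classical_set_scope.
Local Open Scope ring_scope.

(* Matrices, in particular the row vectors 'rV[R]_n modelling R^n, carry the
   Borel sigma-algebra of their topology. *)
HB.instance Definition _ (R : realType) (m n : nat) :=
  Measurable.copy 'M[R]_(m, n) (g_sigma_algebraType (@open 'M[R]_(m, n))).

Lemma measurable_coord (R : realType) m n (i : 'I_m) (j : 'I_n) :
  measurable_fun setT (fun A : 'M[R]_(m, n) => A i j).
Proof.
apply: (measurability _ (RGenOpens.measurableE R)).
move=> _ [_ [a [b ->] <-]]; rewrite setTI; apply: sub_sigma_algebra.
apply: open_comp; last exact: interval_open.
by move=> A _; exact: coord_continuous.
Qed.

Lemma measurable_matrix d (T : measurableType d) (R : realType) m n
    (f : T -> 'M[R]_(m, n)) :
  (forall i j, measurable_fun setT (fun t => f t i j)) ->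
  measurable_fun setT f.
Proof.
move=> mf; apply: (@measurability _ _ _ _ _ _ (@open 'M[R]_(m, n))) => //.
move=> _ [U oU <-]; rewrite setTI.
pose e (k : nat) : R := k.+1%:R^-1.
pose B (p : 'M[rat]_(m, n) * nat) : set 'M[R]_(m, n) :=
  [set A | forall i j, `|ratr (p.1 i j) - A i j| < e p.2].
have -> : U = \bigcup_p (if `[< B p `<=` U >] then B p else set0).
  rewrite eqEsubset; split => [A UA|A [p _]]; last first.
    by case: asboolP => // BU /BU.
  have /nbhs_ballP[r /= r0 rU] : nbhs A U by exact: open_nbhs_nbhs.
  have [k kr] : exists k, e k < r / 2.
    have [k _ /(_ k (leqnn k))] := near_infty_natSinv_lt (PosNum (divr_gt0 r0 (ltr0n _ 2))).
    by exists k.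
  have e0 : 0 < e k by rewrite invr_gt0 ltr0Sn.
  have q_ex i j : exists q : rat, `|ratr q - A i j| < e k.
    have /rat_in_itvoo[q] : A i j - e k < A i j + e k.
      by rewrite ltrBlDr -addrA ltrDl addr_gt0.
    by rewrite in_itv /= => qA; exists q; rewrite ltr_distl.
  have [q qA] := choice (fun ij => q_ex ij.1 ij.2).
  pose p : 'M[rat]_(m, n) * nat := (\matrix_(i, j) q (i, j), k).
  have BA : B p A by move=> i j; rewrite /p /= mxE; exact: (qA (i, j)).
  exists p => //; case: asboolP => // -[] C BC; apply: rU.
  split => // i j; rewrite /ball /=.
  rewrite (splitr r) (le_lt_trans (ler_distD (ratr (p.1 i j)) _ _))// ltrD//.
    by rewrite distrC (lt_trans (BA i j)).
  exact: lt_trans (BC i j) kr.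
rewrite preimage_bigcup; apply: countable_bigcupT_measurable => [|p].
  exact: countableP.
case: asboolP => _; last by rewrite preimage_set0.
rewrite (_ : f @^-1` B p = \bigcap_(ij in [set: 'I_m * 'I_n])
  [set t | `|ratr (p.1 ij.1 ij.2) - f t ij.1 ij.2| < e p.2]); last first.
  by rewrite eqEsubset; split => t Bt => [ij _|i j]; [exact: Bt|exact: (Bt (i, j))].
apply: fin_bigcap_measurable => [|[i j] _]; first exact: finite_finset.
rewrite -[X in measurable X]setTI /=.
have mg : measurable_fun setT (fun t => `|ratr (p.1 i j) - f t i j|).
  apply: measurableT_comp => //; exact: measurable_funB.
rewrite (_ : [set _ | _] = (fun t => `|ratr (p.1 i j) - f t i j|) @^-1` `]-oo, e p.2[%classic).
  exact: mg.
by apply/funext => t; rewrite /= in_itv.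
Qed.

Section lebesgue_rV.
Variable R : realType.
Local Open Scope ereal_scope.

Definition consrV n (z : R * 'rV[R]_n) : 'rV[R]_n.+1 :=
  \row_j if unlift ord0 j is Some k then z.2 ord0 k else z.1.

Lemma measurable_consrV n : measurable_fun setT (@consrV n).
Proof.
apply: measurable_matrix => i j; rewrite /consrV.
under eq_fun do rewrite mxE.
case: unlift => [k|]; last exact: measurable_fst.
exact: measurableT_comp (@measurable_coord _ _ _ ord0 k) measurable_snd.
Qed.

Section step.
Variables (n : nat) (mu : {sigma_finite_measure set 'rV[R]_n -> \bar R}).

Definition lebesgue_rV_step : set 'rV[R]_n.+1 -> \bar R :=
  pushforward (lebesgue_measure \x mu) (@consrV n).

Let step0 : lebesgue_rV_step set0 = 0.
Proof. by rewrite /lebesgue_rV_step /pushforward preimage_set0 measure0. Qed.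

Let step_ge0 A : 0 <= lebesgue_rV_step A.
Proof. exact: (@measure_ge0 _ _ _ (lebesgue_measure \x mu)). Qed.

Let step_sigma_additive : semi_sigma_additive lebesgue_rV_step.
Proof.
have mpre A : measurable A -> measurable (@consrV n @^-1` A).
  by move=> mA; rewrite -[X in measurable X]setTI; exact: measurable_consrV.
move=> F mF tF mUF; rewrite /lebesgue_rV_step /pushforward preimage_bigcup.
apply: measure_semi_sigma_additive.
- by move=> k; exact: mpre.
- apply/trivIsetP => /= i j _ _ ij; rewrite -preimage_setI.
  by move/trivIsetP : tF => /(_ _ _ _ _ ij) ->//; rewrite preimage_set0.
- by rewrite -preimage_bigcup; exact: mpre.
Qed.

HB.instance Definition _ := isMeasure.Build _ _ _ lebesgue_rV_step
  step0 step_ge0 step_sigma_additive.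

Let step_sigma_finite : sigma_finite setT lebesgue_rV_step.
Proof.
have /sigma_finiteP[F [TF ndF Foo]] := sigma_finiteT
  (lebesgue_measure : {sigma_finite_measure set (measurableTypeR R) -> \bar R}).
have /sigma_finiteP[G [TG ndG Goo]] := sigma_finiteT mu.
pose g (v : 'rV[R]_n.+1) : measurableTypeR R * 'rV[R]_n :=
  (v ord0 ord0, \row_k v ord0 (lift ord0 k)).
have mg : measurable_fun setT g.
  apply/measurable_fun_pairP; split; first exact: measurable_coord.
  apply: measurable_matrix => i j; under eq_fun do rewrite mxE.
  exact: measurable_coord.
have consK z : g (consrV z) = z.
  case: z => a v; rewrite /g /consrV mxE unlift_none; congr pair.
  by apply/rowP => k; rewrite !mxE liftK.
exists (fun k => g @^-1` (F k `*` G k)).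
  rewrite -preimage_bigcup; apply/esym/seteqP; split => // v _.
  have [k _ Fk] : (\bigcup_k F k) (g v).1 by rewrite -TF.
  have [l _ Gl] : (\bigcup_k G k) (g v).2 by rewrite -TG.
  exists (maxn k l) => //; split.
    by move: Fk; exact/subsetPset/ndF/leq_maxl.
  by move: Gl; exact/subsetPset/ndG/leq_maxr.
move=> k; have [mF Fk] := Foo k; have [mG Gk] := Goo k; split.
  by rewrite -[X in measurable X]setTI; apply: mg => //; exact: measurableX.
rewrite /lebesgue_rV_step /pushforward.
rewrite (_ : _ @^-1` _ = F k `*` G k); last first.
  by apply/funext => z; rewrite -[in RHS](consK z).
by rewrite product_measure1E// lte_mul_pinfty// ge0_fin_numE.
Qed.

HB.instance Definition _ := Measure_isSigmaFinite.Build _ _ _ lebesgue_rV_step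
  step_sigma_finite.

End step.

Let sigma_finite_dirac : sigma_finite setT (dirac (0%R : 'rV[R]_0) (R := R)).
Proof.
by apply: fin_num_fun_sigma_finite => [|A _]; rewrite ?dirac0// diracE.
Qed.

HB.instance Definition _ := Measure_isSigmaFinite.Build _ _ _
  (dirac (0%R : 'rV[R]_0) (R := R)) sigma_finite_dirac.

(* Lebesgue measure on R^n: the n-fold product of the Lebesgue measure on R. *)
Fixpoint lebesgue_rV n : {sigma_finite_measure set 'rV[R]_n -> \bar R} :=
  if n is n'.+1 then lebesgue_rV_step (lebesgue_rV n') else dirac (0%R : 'rV[R]_0).

Lemma lebesgue_rV_box n (u v : 'rV[R]_n) :
  (forall i, (u ord0 i <= v ord0 i)%R) ->
  lebesgue_rV n [set x | forall i, x ord0 i \in `[u ord0 i, v ord0 i]] =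
  (\prod_i (v ord0 i - u ord0 i))%R%:E.
Proof.
elim: n u v => [|n IHn] u v uv.
  by rewrite big_ord0 /= diracE mem_set// => -[].
pose tl (w : 'rV[R]_n.+1) : 'rV[R]_n := \row_k w ord0 (lift ord0 k).
pose box (w1 w2 : 'rV[R]_n) :=
  [set x : 'rV[R]_n | forall i, x ord0 i \in `[w1 ord0 i, w2 ord0 i]].
rewrite /= /lebesgue_rV_step /pushforward big_ord_recl.
have -> : @consrV n @^-1`
      [set x | forall i, x ord0 i \in `[u ord0 i, v ord0 i]] =
    `[u ord0 ord0, v ord0 ord0]%classic `*` box (tl u) (tl v).
  apply/seteqP; split => -[a x] /=.
    move=> H; split; first by have := H ord0; rewrite mxE unlift_none.
    by move=> i; have := H (lift ord0 i); rewrite !mxE liftK.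
  move=> [H1 H2] i; rewrite mxE; case: unliftP => [k|] ->//=.
  by have := H2 k; rewrite !mxE.
have mbox : measurable (box (tl u) (tl v)).
  rewrite (_ : box _ _ = \bigcap_(i in [set: 'I_n])
      (fun x : 'rV[R]_n => x ord0 i) @^-1` `[tl u ord0 i, tl v ord0 i]%classic).
    apply: fin_bigcap_measurable => [|i _]; first exact: finite_finset.
    by rewrite -[X in measurable X]setTI; exact: measurable_coord.
  by apply/seteqP; split => x H i *; exact: H.
have lebE : lebesgue_measure `[u ord0 ord0, v ord0 ord0]%classic =
    (v ord0 ord0 - u ord0 ord0)%:E.
  rewrite lebesgue_measure_itv /= lte_fin; case: ltP => // vu.
  by rewrite (_ : v ord0 ord0 = u ord0 ord0) ?subrr//; apply/le_anti; rewrite vu uv.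
rewrite product_measure1E// [X in X * _]lebE IHn; last by move=> i; rewrite !mxE.
by under eq_bigr do rewrite !mxE; rewrite EFinM.
Qed.

End lebesgue_rV.

Definition closed_cube (R : realType) (d : nat) (a b : R) : set 'rV[R]_d :=
  [set x | forall i, a <= x ord0 i <= b].
Arguments closed_cube {R} d a b.

Definition open_cube (R : realType) (d : nat) (a b : R) : set 'rV[R]_d :=
  [set x | forall i, a < x ord0 i < b].
Arguments open_cube {R} d a b.

(* The coordinates of a parameter vector of a network with h hidden neurons are
   numbered from 0: i * d + j is the weight from input j to neuron i,
   d * h + i the bias of neuron i, d * h + h + i its outgoing weight, and the
   last coordinate d * h + 2 * h the output bias. *)
Definition param_dim (d h : nat) : nat := (d * h + 2 * h).+1.

Section shallow_networks.
Variables d h : nat.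

Definition weight_idx (i : 'I_h) (j : 'I_d) : 'I_(param_dim d h) :=
  inord (i * d + j).
Definition bias_idx (i : 'I_h) : 'I_(param_dim d h) := inord (d * h + i).
Definition out_idx (i : 'I_h) : 'I_(param_dim d h) := inord (d * h + h + i).
Definition out_bias_idx : 'I_(param_dim d h) := inord (d * h + 2 * h).

Definition hidden_idx (k : 'I_(h * d + h)) : 'I_(param_dim d h) := inord k.

Lemma val_weight_idx i j : val (weight_idx i j) = (i * d + j)%N.
Proof.
rewrite /= inordK// ltnS ltnW// (leq_trans _ (leq_addr _ _))//.
rewrite (@leq_trans (i.+1 * d))//; first by rewrite mulSnr ltn_add2l.
by rewrite mulnC leq_mul2l ltn_ord orbT.
Qed.

Lemma val_bias_idx i : val (bias_idx i) = (d * h + i)%N.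
Proof.
by rewrite /= inordK// ltnS leq_add2l ltnW// (leq_trans (ltn_ord i))// leq_pmull.
Qed.

Lemma val_out_idx i : val (out_idx i) = (d * h + h + i)%N.
Proof.
by rewrite /= inordK// ltnS -addnA leq_add2l mul2n -addnn leq_add2l ltnW.
Qed.

Lemma val_out_bias_idx : val out_bias_idx = (d * h + 2 * h)%N.
Proof. by rewrite /= inordK. Qed.

Lemma val_hidden_idx k : val (hidden_idx k) = k.
Proof.
rewrite /= inordK// ltnS ltnW// (leq_trans (ltn_ord k))//.
by rewrite mulnC leq_add2l leq_pmull.
Qed.

Variable R : realType.
Implicit Types theta : 'rV[R]_(param_dim d h).

Definition shallow_net (sigma : R -> R) theta (x : 'rV[R]_d) : R :=
  theta ord0 out_bias_idx +
  \sum_(i < h) theta ord0 (out_idx i) *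
    sigma (theta ord0 (bias_idx i) +
           \sum_(j < d) theta ord0 (weight_idx i j) * x ord0 j).

Definition risk (sigma : R -> R) (a b : R)
    (mu : {measure set 'rV[R]_d -> \bar R}) (f : 'rV[R]_d -> R) theta : \bar R :=
  (\int[mu]_(x in closed_cube d a b)
     ((shallow_net sigma theta x - f x) ^+ 2)%:E)%E.

Definition empirical_risk (sigma : R -> R) (M : nat)
    (x : nat -> 'rV[R]_d) (y : nat -> R) theta : R :=
  M%:R^-1 * \sum_(1 <= m < M.+1) `|shallow_net sigma theta (x m) - y m| ^+ 2.

Definition neuron_idx (i : 'I_h) (k : 'I_(param_dim d h)) : bool :=
  (k == bias_idx i) || [exists j, k == weight_idx i j].

(* The incoming weights of neuron i followed by its bias. *)
Definition neuron_params (i : 'I_h) theta : 'rV[R]_d.+1 :=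
  \row_k if unlift ord_max k is Some j then theta ord0 (weight_idx i j)
         else theta ord0 (bias_idx i).

Definition neuron_subst (i : 'I_h) theta (psi : 'rV[R]_d.+1) :
    'rV[R]_(param_dim d h) :=
  \row_k if k == bias_idx i then psi ord0 ord_max
         else if [pick j | k == weight_idx i j] is Some j
              then psi ord0 (lift ord_max j)
         else theta ord0 k.

End shallow_networks.

Section probability.
Context d (T : measurableType d) (R : realType) (P : probability T R).

Definition mutual_independence (I : finType) (X : I -> T -> R) : Prop :=
  forall (J : {set I}) (B : I -> set R), (forall i, measurable (B i)) ->
    P (\bigcap_(i in [set` J]) X i @^-1` B i) =
    (\prod_(i in J) P (X i @^-1` B i))%E.

(* Z is a version of the conditional expectation of Y given the
   sigma-algebra G. *)
Definition is_cond_exp (G : set (set T)) (Y Z : T -> R) : Prop :=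
  [/\ P.-integrable setT (EFin \o Y),
      P.-integrable setT (EFin \o Z),
      forall B, measurable B -> G (Z @^-1` B) &
      forall A, G A -> (\int[P]_(w in A) (Z w)%:E = \int[P]_(w in A) (Y w)%:E)%E].

(* E[Y | X] = g almost surely. *)
Definition cond_exp_eq d' (S : measurableType d') (Y : T -> R) (X : T -> S)
    (g : T -> R) : Prop :=
  exists2 Z : T -> R,
    is_cond_exp (preimage_set_system setT X measurable) Y Z &
    {ae P, forall w, Z w = g w}.

End probability.

(* Main.v *)
(* A hidden neuron whose preactivation is negative on the whole cube has zero
   gradient, so it never moves.  At initialisation a given neuron is in this
   state with a probability c > 0 that does not depend on h (bias in
   [-eta/2, -eta/4) and small weights, after rescaling by h^kappa), and by
   independence no neuron is dead with probability at most (1 - c)^h.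

   It remains to see that a dead neuron keeps the risk away from its infimum.
   Otherwise there are networks theta_k of width h with one outgoing weight 0
   and risk tending to the infimum.  Using the free neuron as a perturbation,
   the residuals are asymptotically orthogonal to all ReLU ridge functions,
   hence, by density, to all continuous functions of X; so N(theta_k) tends to f
   weakly with respect to the law p(x) dx of X.  After normalising the hidden
   neurons and passing to a cluster point, f is on (a, b)^d a combination of
   affine functions times indicators of finitely many half-spaces; being
   continuous, it is then itself a network (of some other width), and this
   network attains the risk of f, which was excluded. *)

(* The obstacle is that near-minimisers need not be bounded: outgoing weights may diverge while
   their contributions cancel, so there may be no limit in parameter space and only weak convergence
   is available. Hence only the activation patterns, which live in a compact set, are followed, and
   the rest is duality. On finitely many points off the limit hyperplanes, all networks near the
   limit pattern lie in one span of (h+1)(d+1) functions (indicator times coordinate). A combination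
   of point masses annihilating this span annihilates the networks exactly, however large their
   coefficients; weak convergence passes this on to f, so f lies in the span. The width of the
   network obtained for f may exceed h, which is harmless because non-attainment is assumed at every
   width. It represents f on the open cube only, which carries the law of X. The gap to the infimum
   may depend on h: only its positivity enters, and the rate in h comes from the initialisation
   alone. There (1-c)^h <= e^(-ch) <= c^(-1) e^(-ch), so delta = c. *)
Require Import Defs.
From HB Require Import structures.
From mathcomp Require Import all_boot all_order all_algebra.
From mathcomp Require Import all_classical all_reals all_analysis measurable_realfun.
From mathcomp Require Import ring lra.
Set Implicit Arguments.
Unset Strict Implicit.
Unset Printing Implicit Defensive.
Import Order.TTheory GRing.Theory Num.Theory.
Import numFieldNormedType.Exports.
Local Open Scope classical_set_scope.
Local Open Scope ring_scope.

(** * Finite-dimensional duality *)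

Section span.
Variables (R : fieldType) (T : eqType).

(** A formal combination of point masses is encoded as a list of weighted points; [comb s f] is its
    pairing with [f]. *)
Definition comb (s : seq (R * T)) (f : T -> R) : R := \sum_(z <- s) z.1 * f z.2.

Lemma comb_cat s t f : comb (s ++ t) f = comb s f + comb t f.
Proof. by rewrite /comb big_cat. Qed.

Lemma comb_scale k s f : comb [seq (k * z.1, z.2) | z <- s] f = k * comb s f.
Proof.
by rewrite /comb big_map mulr_sumr; apply: eq_bigr => z _ /=; rewrite mulrA.
Qed.

Lemma combD s f g : comb s (fun x => f x + g x) = comb s f + comb s g.
Proof. by rewrite /comb -big_split; apply: eq_bigr => z _ /=; rewrite mulrDr. Qed.

Lemma combZ s k f : comb s (fun x => k * f x) = k * comb s f.
Proof. by rewrite /comb mulr_sumr; apply: eq_bigr => z _; rewrite mulrCA. Qed.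

Lemma comb_sum s (I : Type) (r : seq I) (g : I -> T -> R) :
  comb s (fun x => \sum_(i <- r) g i x) = \sum_(i <- r) comb s (g i).
Proof.
rewrite /comb exchange_big; apply: eq_bigr => z _; exact: mulr_sumr.
Qed.

(** If some combination kills the remaining functions but not [g i], it fixes the coefficient of
    [g i], and any other annihilator can be corrected by a multiple of it so as to kill [g i] too.
    Otherwise [g i] imposes no new condition and gets coefficient 0. In the base case unit point
    masses force [f] to vanish on [U]. *)
Lemma span_of_annihilator (U : set T) (I : eqType) (r : seq I) (g : I -> T -> R)
    (f : T -> R) : uniq r ->
  (forall s, (forall z, z \in s -> U z.2) ->
    (forall i, i \in r -> comb s (g i) = 0) -> comb s f = 0) ->
  exists l : I -> R, forall x, U x -> f x = \sum_(i <- r) l i * g i x.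
Proof.
elim: r f => [|i r IH] f /=.
  move=> _ fK; exists (fun=> 0) => x Ux; rewrite big_nil.
  have := fK [:: (1, x)]; rewrite /comb big_seq1 mul1r; apply => //.
  by move=> z; rewrite inE => /eqP ->.
move=> /andP[ir ur] fK.
have ext (k : R) (l : I -> R) x : \sum_(j <- i :: r) (if j == i then k else l j) * g j x =
    k * g i x + \sum_(j <- r) l j * g j x.
  rewrite big_cons eqxx; congr (_ + _); rewrite big_seq [RHS]big_seq.
  by apply: eq_bigr => j jr; case: eqP => // ji; rewrite -ji jr in ir.
have [[s [sU sr si]]|nos] := pselect (exists s, [/\ (forall z, z \in s -> U z.2),
    (forall j, j \in r -> comb s (g j) = 0) & comb s (g i) <> 0]); last first.
  have [s sU sr|l lE] := IH f ur.
    apply: fK => // j; rewrite inE => /orP[/eqP ->|/sr//].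
    by apply: contrapT => si; apply: nos; exists s.
  exists (fun j => if j == i then 0 else l j) => x Ux.
  by rewrite ext mul0r add0r lE.
pose k := comb s f / comb s (g i).
have [t tU tr|l lE] := IH (fun x => f x + - k * g i x) ur.
  rewrite combD combZ.
  pose m := - (comb t (g i) / comb s (g i)).
  have := fK (t ++ [seq (m * z.1, z.2) | z <- s]).
  have /eqP si0 := si.
  rewrite comb_cat comb_scale => H; rewrite -[RHS]H /m /k.
  - by field.
  - by move=> z; rewrite mem_cat => /orP[/tU//|/mapP[z' /sU ? ->]].
  - move=> j; rewrite inE comb_cat comb_scale => /orP[/eqP ->|jr].
      by rewrite /m; field.
    by rewrite (tr _ jr) (sr _ jr) mulr0 addr0.
exists (fun j => if j == i then k else l j) => x Ux.
by rewrite ext -lE//; ring.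
Qed.

End span.

(** * Piecewise affine functions *)

Section continuous_real.
Variables (R : realType) (T : topologicalType).
Implicit Types f g : T -> R.

Lemma continuous_add f g : continuous f -> continuous g ->
  continuous (fun x => f x + g x).
Proof. by move=> cf cg x; apply: cvgD; [exact: cf|exact: cg]. Qed.

Lemma continuous_mul f g : continuous f -> continuous g ->
  continuous (fun x => f x * g x).
Proof. by move=> cf cg x; apply: cvgM; [exact: cf|exact: cg]. Qed.

Lemma continuous_cst (k : R) : continuous (fun _ : T => k).
Proof. by move=> x; exact: cvg_cst. Qed.

Lemma continuous_sum (I : Type) (r : seq I) (f : I -> T -> R) :
  (forall i, continuous (f i)) -> continuous (fun x => \sum_(i <- r) f i x).
Proof.
move=> cf; elim: r => [|i r IH].
  by under eq_fun do rewrite big_nil; exact: continuous_cst.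
by under eq_fun do rewrite big_cons; exact: continuous_add.
Qed.

Lemma continuous_max_cst f (k : R) : continuous f -> continuous (fun x => Num.max (f x) k).
Proof.
by move=> cf x; apply: (@continuous_max R T f (fun=> k)) => //; [exact: cf|exact: cvg_cst].
Qed.

Lemma continuous_inv f : continuous f -> (forall x, f x != 0) ->
  continuous (fun x => (f x)^-1).
Proof. by move=> cf f0 x; apply: cvgV; [exact: f0|exact: cf]. Qed.

End continuous_real.

(** The quotient u / (u - v) is the parameter at which the affine interpolation from u to v
    vanishes. *)
Lemma sign_crossing (R : realFieldType) (u v : R) : u != 0 -> v != 0 ->
  (0 < u) != (0 < v) -> u - v != 0 /\ 0 <= u / (u - v) <= 1.
Proof.
case: (ltgtP u 0) => // u0 _; case: (ltgtP v 0) => // v0 _ _.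
  have uv : u - v < 0 by lra.
  by rewrite lt_eqF// ler_ndivlMr// ler_ndivrMr// mul0r mul1r; split => //; lra.
have uv : 0 < u - v by lra.
by rewrite gt_eqF// ler_pdivlMr// ler_pdivrMr// mul0r mul1r; split => //; lra.
Qed.

Lemma sign_near (R : realType) (T : topologicalType) (g : T -> R) y :
  {for y, continuous g} -> g y != 0 -> \forall x \near y, (0 < g x) = (0 < g y).
Proof.
move=> cg gy; have [gy0|gy0] := ltP 0 (g y).
  have : \forall x \near y, 0 < g x.
    apply: (cg (fun r => 0 < r)).
    by apply: open_nbhs_nbhs; split => //; exact: open_gt.
  by apply: filterS => x ->.
have : \forall x \near y, g x < 0.
  apply: (cg (fun r => r < 0)).
  by apply: open_nbhs_nbhs; split; [exact: open_lt|rewrite /= lt_neqAle gy].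
by apply: filterS => x gx; apply/negbTE; rewrite -leNgt ltW.
Qed.

Section affine.
Variables (R : realType) (d : nat).
Implicit Types (x y v : 'rV[R]_d) (l B A : 'rV[R]_d * R).

Definition aff l x : R := l.2 + \sum_(j < d) l.1 ord0 j * x ord0 j.

Lemma aff_line l x y t : aff l (x + t *: (y - x)) = aff l x + t * (aff l y - aff l x).
Proof.
rewrite /aff !mulrBr !mulrDr !mulr_sumr.
rewrite [X in _ = _ + X](_ : _ = t * (\sum_j l.1 ord0 j * y ord0 j) - t * (\sum_j l.1 ord0 j * x ord0 j)).
  rewrite -addrA; congr (_ + _); rewrite !mulr_sumr -sumrB -big_split.
  by apply: eq_bigr => j _; rewrite !mxE /=; ring.
by rewrite !mulr_sumr; ring.
Qed.

Lemma affD l B x : aff (l + B) x = aff l x + aff B x.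
Proof.
rewrite /aff /= addrACA -big_split; congr (_ + _).
by apply: eq_bigr => j _; rewrite mxE mulrDl.
Qed.

Lemma affZ k l x : aff (k *: l) x = k * aff l x.
Proof.
rewrite /aff /= mulrDr mulr_sumr; congr (_ + _).
by apply: eq_bigr => j _; rewrite mxE mulrA.
Qed.

Lemma aff0 x : aff 0 x = 0.
Proof. by rewrite /aff big1 ?addr0// => j _; rewrite mxE mul0r. Qed.

Lemma aff_continuous l : continuous (aff l).
Proof.
apply: continuous_add; first exact: continuous_cst.
apply: continuous_sum => j; apply: continuous_mul; first exact: continuous_cst.
move=> x; exact: coord_continuous.
Qed.

(** The directions l_k e_j - l_j e_k are tangent to the hyperplane; vanishing of [B] along them
    makes the weights proportional, and the common zero [y0] settles the constant terms. *)
Lemma aff_hyperplane l B y0 : l.1 != 0 -> aff l y0 = 0 ->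
  (forall y, aff l y = 0 -> aff B y = 0) -> exists c, B = c *: l.
Proof.
move=> /eqP/rowP l0 ly0 lB.
have [j lj] : exists j, l.1 ord0 j != 0.
  apply: contrapT => /forallNP H; apply: l0 => j; rewrite mxE; apply/eqP.
  by apply: contraT => ?; case: (H j).
pose c := B.1 ord0 j / l.1 ord0 j.
have affs C (u : 'rV[R]_d) : aff C (y0 + u) = aff C y0 + \sum_k C.1 ord0 k * u ord0 k.
  rewrite /aff -addrA; congr (_ + _); rewrite -big_split.
  by apply: eq_bigr => k _; rewrite mxE mulrDr.
have B0 : aff B y0 = 0 by exact: lB.
have sumd (C : 'rV[R]_d * R) (k : 'I_d) (t : R) : \sum_i C.1 ord0 i * (t *: delta_mx ord0 k : 'rV[R]_d) ord0 i = t * C.1 ord0 k :> R.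
  rewrite (bigD1 k)//= big1 ?addr0 => [|i ik]; rewrite !mxE ?eqxx/=.
    by rewrite mulr1 mulrC.
  by rewrite (negbTE ik) !mulr0.
have Bk k : B.1 ord0 k = c * l.1 ord0 k.
  have := lB (y0 + (l.1 ord0 k *: delta_mx ord0 j - l.1 ord0 j *: delta_mx ord0 k)).
  have sumd2 (C : 'rV[R]_d * R) : \sum_i C.1 ord0 i * (l.1 ord0 k *: delta_mx ord0 j - l.1 ord0 j *: delta_mx ord0 k : 'rV[R]_d) ord0 i
     = l.1 ord0 k * C.1 ord0 j - l.1 ord0 j * C.1 ord0 k :> R.
    rewrite -(sumd C j (l.1 ord0 k)) -(sumd C k (l.1 ord0 j)) -sumrB.
    by apply: eq_bigr => i _; rewrite !mxE; ring.
  rewrite !affs !sumd2 ly0 B0 !add0r [X in X - _ = 0]mulrC subrr => /(_ erefl)/eqP.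
  by rewrite subr_eq0 => /eqP H; apply: (mulfI lj); rewrite -H /c; field.
exists c; apply/eqP; rewrite -pair_eqE /=; apply/andP; split; apply/eqP.
  by apply/rowP => k; rewrite Bk mxE.
move: B0 ly0; rewrite /aff /=; under eq_bigr do rewrite Bk -mulrA.
rewrite -mulr_sumr => /eqP; rewrite addr_eq0 => /eqP -> /eqP; rewrite addr_eq0 => /eqP ->.
by rewrite /GRing.scale/= mulrN.
Qed.

Lemma near_line (x v : 'rV[R]_d) (A : set 'rV[R]_d) : nbhs x A ->
  \forall t \near (0 : R), A (x + t *: v).
Proof.
have /(_ 0) H : continuous (fun t : R => x + t *: v).
  move=> t; apply: cvgD; first exact: cvg_cst.
  by apply: cvgZr_tmp; exact: cvg_id.
by move=> nA; apply: H; rewrite scale0r addr0.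
Qed.

Lemma near0_pos (A : R -> Prop) : (\forall t \near (0 : R), A t) -> exists2 t, 0 < t & A t.
Proof.
move=> /nbhs_ballP[e /= e0 eA]; exists (e / 2); first by rewrite divr_gt0.
by apply: eA; rewrite /ball/= sub0r normrN gtr0_norm ?divr_gt0// ltr_pdivrMr// ltr_pMr// ltr1n.
Qed.

Lemma aff_neq0_near B x : aff B x != 0 -> \forall y \near x, aff B y != 0.
Proof.
move=> Bx; apply: (@aff_continuous B x (fun r => r != 0)).
by apply: open_nbhs_nbhs; split => //; exact: open_neq.
Qed.

(** A point found for the earlier functions is moved slightly inside the hyperplane towards some y'
    where the new function is nonzero: by linearity the new function becomes nonzero at once, and
    the earlier conditions are open. *)
Lemma generic_point l (r : seq ('rV[R]_d * R)) y0 (O : set 'rV[R]_d) :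
  nbhs y0 O -> aff l y0 = 0 ->
  (forall B, B \in r -> exists2 y, aff l y = 0 & aff B y != 0) ->
  exists y, [/\ nbhs y O, aff l y = 0 & forall B, B \in r -> aff B y != 0].
Proof.
move=> Oy0 ly0; elim: r => [|B r IH] rH; first by exists y0.
have [|y [Oy ly ry]] := IH.
  by move=> B' B'r; apply: rH; rewrite inE B'r orbT.
have [By|By] := eqVneq (aff B y) 0; last first.
  by exists y; split => // B'; rewrite inE => /orP[/eqP ->//|/ry].
have [|y' ly' By'] := rH B; first by rewrite inE eqxx.
have : \forall z \near y, nbhs z O /\ forall B', B' \in r -> aff B' z != 0.
  apply: filterI; first exact: nbhs_interior.
  elim: r ry {IH rH} => [|C r IH] ry; first by near=> z.
  have Cy : aff C y != 0 by apply: ry; rewrite inE eqxx.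
  have /IH : forall B', B' \in r -> aff B' y != 0.
    by move=> B' B'r; apply: ry; rewrite inE B'r orbT.
  apply: filterS2 (aff_neq0_near Cy) => z Cz rz B'.
  by rewrite inE => /orP[/eqP ->//|/rz].
move=> /near_line -/(_ (y' - y))/near0_pos[t t0 [Oz rz]].
exists (y + t *: (y' - y)); split => //.
  by rewrite aff_line ly ly' subrr mulr0 addr0.
move=> B'; rewrite inE => /orP[/eqP ->|/rz//].
by rewrite aff_line By subr0 add0r mulf_neq0// gt_eqF.
Unshelve. all: by end_near. Qed.

Lemma aff_sign_near l y : aff l y != 0 ->
  \forall x \near y, aff l x != 0 /\ (0 < aff l x) = (0 < aff l y).
Proof.
move=> ly; apply: filterS2 (aff_neq0_near ly) (sign_near (@aff_continuous l y) ly).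
by [].
Qed.

(** Only t > 0 is tested, so that the ray can stay on one side of a hyperplane. Two functions
    differing at [y] would differ on a neighbourhood, hence somewhere on the ray. *)
Lemma eq_along_line (F H : 'rV[R]_d -> R) y v :
  {for y, continuous F} -> {for y, continuous H} ->
  (\forall t \near (0 : R), 0 < t -> F (y + t *: v) = H (y + t *: v)) ->
  F y = H y.
Proof.
move=> cF cH FH; apply/eqP; rewrite -subr_eq0; apply: contraT => FHy.
have cFH : {for y, continuous (fun x => F x - H x)} by exact: (continuousB cF cH).
have : \forall x \near y, F x - H x != 0.
  apply: (cFH (fun r => r != 0)).
  by apply: open_nbhs_nbhs; split => //; exact: open_neq.
move=> /(@near_line y v) N; have [t t0 [FHt /(_ t0) E]] := near0_pos (filterI N FH).
by rewrite E subrr eqxx in FHt.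
Qed.

(** Here [y] selects the active half-spaces and [x] is the evaluation point: for fixed [y] the
    function is affine, and off the hyperplanes it is locally constant in [y]. *)
Definition jumps (r : seq (('rV[R]_d * R) * ('rV[R]_d * R))) (y x : 'rV[R]_d) : R :=
  \sum_(z <- r) (0 < aff z.1 y)%R%:R * aff z.2 x.

Lemma jumps_continuous r y : continuous (jumps r y).
Proof.
apply: continuous_sum => z; apply: continuous_mul; first exact: continuous_cst.
exact: aff_continuous.
Qed.

Lemma jumps_near r y : (forall z, z \in r -> aff z.1 y != 0) ->
  \forall x \near y, (forall z, z \in r -> aff z.1 x != 0) /\ jumps r x = jumps r y.
Proof.
rewrite /jumps; elim: r => [|z r IH] rH.
  by near=> x; split => //; apply/funext => w; rewrite !big_nil.
have : \forall x \near y, (forall z, z \in r -> aff z.1 x != 0) /\ jumps r x = jumps r y.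
  by apply: IH => w wr; apply: rH; rewrite inE wr orbT.
have : aff z.1 y != 0 by apply: rH; rewrite inE eqxx.
move=> /aff_sign_near; apply: filterS2 => x [zx zxy] [rx rxy]; split.
  by move=> w; rewrite inE => /orP[/eqP ->//|/rx].
by apply/funext => w; rewrite !big_cons zxy; congr (_ + _); exact: (congr1 (@^~ w) rxy).
Unshelve. all: by end_near. Qed.

Lemma aff_shift l x t : aff l (x + t *: l.1) = aff l x + t * \sum_j l.1 ord0 j ^+ 2.
Proof.
rewrite /aff -addrA mulr_sumr -big_split; congr (_ + _).
by apply: eq_bigr => j _; rewrite !mxE expr2 /=; ring.
Qed.

Lemma sumsq_gt0 (v : 'rV[R]_d) : v != 0 -> 0 < \sum_j v ord0 j ^+ 2.
Proof.
move=> /eqP v0; rewrite lt_neqAle sumr_ge0 ?andbT => [|j _]; last exact: sqr_ge0.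
apply/negP => /eqP/esym/eqP; rewrite psumr_eq0 => [/allP H|j _]; last exact: sqr_ge0.
apply: v0; apply/rowP => j; rewrite mxE; apply/eqP; rewrite -sqrf_eq0.
by have := H j; rewrite mem_index_enum => /(_ isT).
Qed.

(* The hyperplanes are removed one at a time: as f is continuous across
   aff l = 0, the jump B vanishes there, hence B = c *: l and the jump is a
   multiple of a ReLU. *)
Lemma relu_representation (O : set 'rV[R]_d) (f : 'rV[R]_d -> R) r A :
  open O -> (forall x y t, O x -> O y -> 0 <= t <= 1 -> O (x + t *: (y - x))) ->
  (forall x, O x -> {for x, continuous f}) ->
  (forall z, z \in r -> z.1 != 0) ->
  (forall x, O x -> (forall z, z \in r -> aff z.1 x != 0) ->
    f x = aff A x + jumps r x x) ->
  exists A' (s : seq (R * ('rV[R]_d * R))), forall x, O x ->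
    f x = aff A' x + \sum_(z <- s) z.1 * Num.max (aff z.2 x) 0.
Proof.
move=> oO cO; move: {2}(size r) (erefl (size r)) => n.
elim: n r f A => [|n IH] r f A.
  move=> /size0nil -> cf _ fE; exists A, [::] => x Ox; rewrite fE//.
  by rewrite /jumps !big_nil.
case: r => // -[l B] r [sr] cf r0 fE.
have rr0 z : z \in r -> z.1 != 0 by move=> zr; apply: r0; rewrite inE zr orbT.
have fE1 x : O x -> aff l x != 0 -> (forall z, z \in r -> aff z.1 x != 0) ->
    f x = aff A x + ((0 < aff l x)%R%:R * aff B x + jumps r x x).
  move=> Ox lx rx; rewrite fE//; first by rewrite /jumps big_cons.
  by move=> z; rewrite inE => /orP[/eqP ->//|/rx].
(* If the hyperplane misses [O], convexity keeps the sign of [aff l] constant on [O], and the term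
   is absorbed into the affine part. *)
have [[y0 Oy0 ly0]|nol] := pselect (exists2 y, O y & aff l y = 0); last first.
  have [[x0 Ox0]|O0] := pselect (exists x, O x); last first.
    by exists 0, [::] => x Ox; exfalso; apply: O0; exists x.
  have lO x : O x -> aff l x != 0.
    by move=> Ox; apply/eqP => lx; apply: nol; exists x.
  have sgn x : O x -> (0 < aff l x) = (0 < aff l x0).
    move=> Ox; apply: contrapT => /eqP /(sign_crossing (lO _ Ox) (lO _ Ox0))[D0 t01].
    pose t := aff l x / (aff l x - aff l x0).
    apply: nol; exists (x + t *: (x0 - x)); first exact: cO.
    by rewrite aff_line /t; field.
  apply: (IH r f (A + (0 < aff l x0)%R%:R *: B)) => // x Ox rx.
  by rewrite fE1 ?sgn ?affD ?affZ ?addrA//; exact: lO.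
have l10 : l.1 != 0.
  apply: contra_neq (r0 _ (mem_head _ _)) => /= l1; case: l l1 ly0 {r0 fE fE1} => l1 l2 /= ->.
  by rewrite /aff big1 ?addr0 => [/= ->//|j _]; rewrite mxE mul0r.
(* If another term has the same hyperplane, the jump across it is not [B] alone, so the two terms
   are merged before continuity is used. For c < 0 the orientations are opposite: off the hyperplane
   one indicator is 1 minus the other, which moves [B] into the affine part. *)
have [[z zr zl]|zl] := pselect (exists2 z, z \in r & forall y, aff l y = 0 -> aff z.1 y = 0).
  have [c zE] := aff_hyperplane l10 ly0 zl.
  have c0 : c != 0 by apply: contra_neq (rr0 _ zr) => c0; rewrite zE c0 scale0r.
  have zx x : aff z.1 x = c * aff l x by rewrite zE affZ.
  case/splitPr: zr sr rr0 fE1 => r1 r2 sr rr0 fE1.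
  have [c_gt0|c_lt0] : 0 < c \/ c < 0 by case: (ltgtP c 0) c0 => // h _; [right|left].
    apply: (IH (r1 ++ (z.1, z.2 + B) :: r2) f A) => //.
    - by move: sr; rewrite !size_cat.
    - move=> w; rewrite mem_cat inE => H; move: H => /or3P[wr|/eqP ->|wr].
      + by apply: rr0; rewrite mem_cat wr.
      + by apply: (rr0 z); rewrite mem_cat inE eqxx orbT.
      + by apply: rr0; rewrite mem_cat inE wr !orbT.
    move=> x Ox rx; have zx0 : aff z.1 x != 0.
      by apply: (rx (z.1, z.2 + B)); rewrite mem_cat inE eqxx orbT.
    rewrite fE1//.
    + rewrite /jumps !big_cat !big_cons /= affD zx pmulr_rgt0//; ring.
    + by move: zx0; rewrite zx mulf_eq0 negb_or => /andP[].
    + move=> w; rewrite mem_cat inE => H; move: H => /or3P[wr|/eqP ->//|wr].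
      * by apply: rx; rewrite mem_cat wr.
      * by apply: rx; rewrite mem_cat inE wr !orbT.
  apply: (IH (r1 ++ (z.1, z.2 - B) :: r2) f (A + B)) => //.
  - by move: sr; rewrite !size_cat.
  - move=> w; rewrite mem_cat inE => H; move: H => /or3P[wr|/eqP ->|wr].
    + by apply: rr0; rewrite mem_cat wr.
    + by apply: (rr0 z); rewrite mem_cat inE eqxx orbT.
    + by apply: rr0; rewrite mem_cat inE wr !orbT.
  move=> x Ox rx; have zx0 : aff z.1 x != 0.
    by apply: (rx (z.1, z.2 - B)); rewrite mem_cat inE eqxx orbT.
  have lx0 : aff l x != 0 by move: zx0; rewrite zx mulf_eq0 negb_or => /andP[].
  rewrite fE1//.
  + rewrite /jumps !big_cat !big_cons /= -scaleN1r !affD affZ zx nmulr_rgt0//.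
    by case: ltgtP lx0 => //= _ _; ring.
  + move=> w; rewrite mem_cat inE => H; move: H => /or3P[wr|/eqP ->//|wr].
    * by apply: rx; rewrite mem_cat wr.
    * by apply: rx; rewrite mem_cat inE wr !orbT.
have rl z : z \in r -> exists2 y, aff l y = 0 & aff z.1 y != 0.
  move=> zr; apply: contrapT => H; apply: zl; exists z => // y ly.
  by apply/eqP; apply: contraT => zy; exfalso; apply: H; exists y.
have S0 := sumsq_gt0 l10.
pose loc y x := aff A x + jumps r y x.
have cloc y : continuous (loc y).
  by apply: continuous_add; [exact: aff_continuous|exact: jumps_continuous].
have ray y v : O y -> (forall z, z \in r -> aff z.1 y != 0) ->
    \forall t \near (0 : R), [/\ O (y + t *: v),
      forall z, z \in r -> aff z.1 (y + t *: v) != 0 &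
      jumps r (y + t *: v) = jumps r y].
  move=> Oy ry; have NO : nbhs y O by exact: open_nbhs_nbhs.
  apply: filterS2 (near_line v NO) (near_line v (jumps_near ry)).
  by move=> t Ot [rt jt].
(* At a generic point of the hyperplane with [aff B] nonzero no other indicator jumps, and the
   limits of [f] along [l.1] and [- l.1] would differ by the value of [aff B]. *)
have Bl y : aff l y = 0 -> aff B y = 0.
  move=> ly; apply/eqP; apply: contraT => By.
  have [||C|y1 [Oy1 ly1 ry1]] := @generic_point l (B :: [seq z.1 | z <- r]) y0 O.
  - exact: open_nbhs_nbhs.
  - exact: ly0.
  - rewrite inE => /orP[/eqP ->|/mapP[z zr ->]]; first by exists y.
    exact: rl.
  have Oy : O y1 by exact: nbhs_singleton.
  have ry z : z \in r -> aff z.1 y1 != 0.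
    by move=> zr; apply: ry1; rewrite inE map_f ?orbT.
  have E1 : f y1 = loc y1 y1 + aff B y1.
    apply: (@eq_along_line f (fun x => loc y1 x + aff B x) y1 l.1).
    - exact: cf.
    - apply: continuous_add; [exact: cloc|exact: aff_continuous].
    apply: filterS (ray y1 l.1 Oy ry) => t [Ot rt jt] t0.
    have lt0 : 0 < aff l (y1 + t *: l.1) by rewrite aff_shift ly1 add0r mulr_gt0.
    by rewrite fE1// ?gt_eqF// lt0 mul1r /loc jt; ring.
  have E2 : f y1 = loc y1 y1.
    apply: (@eq_along_line f (loc y1) y1 (- l.1)); [exact: cf|exact: cloc|].
    apply: filterS (ray y1 (- l.1) Oy ry) => t [Ot rt jt] t0.
    have lt0 : aff l (y1 + t *: - l.1) < 0.
      by rewrite scalerN -scaleNr aff_shift ly1 add0r mulNr oppr_lt0 mulr_gt0.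
    by rewrite fE1// ?lt_eqF// ltNge ltW // mul0r /loc jt; ring.
  have := ry1 B; rewrite inE eqxx => /(_ isT)/eqP []; move: E1; rewrite E2.
  by move=> E; apply: (addrI (loc y1 y1)); rewrite addr0 -E.
have [c BE] := aff_hyperplane l10 ly0 Bl.
have cm : continuous (fun x => c * Num.max (aff l x) 0).
  apply: continuous_mul; first exact: continuous_cst.
  by apply: continuous_max_cst; exact: aff_continuous.
have [||x Ox rx|A' [s sE]] := IH r (fun x => f x - c * Num.max (aff l x) 0) A sr.
- by move=> x Ox; exact: (continuousB (cf x Ox) (cm x)).
- exact: rr0.
- have main u : O u -> aff l u != 0 -> (forall z, z \in r -> aff z.1 u != 0) ->
    f u - c * Num.max (aff l u) 0 = loc u u.
    move=> Ou lu ru; rewrite fE1// BE affZ.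
    by have [h|h] := ltP 0 (aff l u); [rewrite mul1r|rewrite mul0r]; rewrite /loc; ring.
  (* The induction hypothesis also asks for the formula at points of [aff l = 0], where the
     assumption on [f] is silent; they are reached as limits along the normal. *)
  have [lx|lx] := eqVneq (aff l x) 0; last exact: main.
  apply: (@eq_along_line (fun x => f x - c * Num.max (aff l x) 0) (loc x) x l.1).
  + by exact: (continuousB (cf x Ox) (cm x)).
  + exact: cloc.
  apply: filterS (ray x l.1 Ox rx) => t [Ot rt jt] t0.
  have lt0 : 0 < aff l (x + t *: l.1) by rewrite aff_shift lx add0r mulr_gt0.
  by rewrite main// ?gt_eqF// /loc jt.
exists A', ((c, l) :: s) => x Ox; rewrite big_cons /=.
by have := sE x Ox; move=> /(canRL (subrK _)) ->; ring.
Qed.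

End affine.

(** * Density of ReLU ridge functions *)

Section density.
Variables (R : realType) (d : nat) (a b : R).
Local Notation K := (closed_cube d a b).
Local Notation rV := 'rV[R]_d.
Implicit Types (phi psi : rV -> R) (C : (rV -> R) -> Prop).

Lemma closed_cube_compact : compact K.
Proof.
rewrite (_ : K = [set v : rV | forall i, `[a, b]%classic (v ord0 i)]).
  by apply: (@rV_compact R d (fun=> `[a, b]%classic)) => i; exact: segment_compact.
by apply/seteqP; split => x /= H i; have := H i; rewrite in_itv.
Qed.

Lemma continuous_bounded_on_cube phi : continuous phi ->
  exists2 B, 0 < B & forall x, K x -> `|phi x| <= B.
Proof.
move=> cphi.
have : compact (phi @` K).
  by apply: continuous_compact; [exact: continuous_subspaceT|exact: closed_cube_compact].
move=> /compact_bounded [M [_ HM]]; exists (`|M| + 1); first by rewrite ltr_pwDr.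
move=> x Kx; apply: (HM (`|M| + 1)); last by exists x.
by rewrite (le_lt_trans (ler_norm _))// ltrDl.
Qed.

(** Density statements become inductions over such classes. Approximation is tested on the cube
    only, so for continuous functions membership depends only on the restriction to the cube. *)
Record uniform_class C : Prop := UniformClass {
  uc_cont : forall phi, C phi -> continuous phi ;
  uc_add : forall phi psi, C phi -> C psi -> C (fun x => phi x + psi x) ;
  uc_scale : forall k phi, C phi -> C (fun x => k * phi x) ;
  uc_lim : forall phi, continuous phi ->
    (forall e, 0 < e -> exists2 psi, C psi & forall x, K x -> `|phi x - psi x| <= e) ->
    C phi }.

Lemma uc_sum C (I : Type) (r : seq I) (g : I -> rV -> R) : uniform_class C ->
  C (fun=> 1) -> (forall i, C (g i)) -> C (fun x => \sum_(i <- r) g i x).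
Proof.
move=> uC C1 Cg; elim: r => [|i r IH].
  rewrite (_ : (fun _ => _) = (fun=> 0 * 1)); first exact: uc_scale.
  by apply/funext => x; rewrite big_nil mul0r.
by under eq_fun do rewrite big_cons; exact: uc_add.
Qed.

Definition ramp (c t : R) : R := Num.max (t - c) 0.

(** Piecewise linear interpolation at the nodes t0 + k delta, built from left to right. A difference
    of two ramps adds slope on one cell and is constant afterwards; that [u] keeps its last value to
    the right is the invariant which lets the next cell be added. *)
Lemma ramp_interpolation (S : (R -> R) -> Prop) (g : R -> R) (t0 e delta : R) n :
  (forall c, S (fun=> c)) -> (forall c, S (ramp c)) ->
  (forall u v, S u -> S v -> S (fun t => u t + v t)) ->
  (forall k u, S u -> S (fun t => k * u t)) ->
  0 < delta -> 0 <= e ->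
  (forall s t, t0 <= s -> s <= t -> t <= t0 + n%:R * delta -> t - s <= delta -> `|g t - g s| <= e) ->
  exists2 u, S u & (forall t, t0 <= t <= t0 + n%:R * delta -> `|g t - u t| <= e) /\
    (forall t, t0 + n%:R * delta <= t -> u t = g (t0 + n%:R * delta)).
Proof.
move=> Sc Sr Sa Sm d0 e0; elim: n => [|n IH] gH.
  exists (fun=> g t0); [exact: Sc|split => t]; rewrite mul0r addr0//.
  by move=> tt; rewrite (_ : t = t0) ?subrr ?normr0//; apply/le_anti; rewrite andbC.
have nE : n.+1%:R * delta = n%:R * delta + delta by rewrite -addn1 natrD mulrDl mul1r.
have nd0 : 0 <= n%:R * delta by rewrite mulr_ge0// ltW.
set tn := t0 + n%:R * delta in IH *.
have tE : t0 + n.+1%:R * delta = tn + delta by rewrite nE addrA.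
rewrite tE in gH *.
have t0n : t0 <= tn by rewrite lerDl.
have [u Su [u1 u2]] := IH (fun s t a1 a2 a3 => gH s t a1 a2 (le_trans a3 (ler_wpDr (ltW d0) (lexx _)))).
set k := (g (tn + delta) - g tn) / delta.
exists (fun t => u t + k * (ramp tn t + -1 * ramp (tn + delta) t)).
  by apply: (Sa) => //; apply: (Sm); apply: (Sa) => //; exact: Sm.
have rE t : tn + delta <= t -> u t + k * (ramp tn t + -1 * ramp (tn + delta) t) = g (tn + delta).
  move=> tt; rewrite u2; last by lra.
  rewrite /ramp !max_l; [|by lra|by lra].
  rewrite (_ : t - tn + _ = delta); last by ring.
  by rewrite /k divfK ?gt_eqF//; ring.
split => // t /andP[tt0 tt1].
have r2 : ramp (tn + delta) t = 0 by rewrite /ramp max_r//; lra.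
have [ttn|ttn] := leP t tn.
  have r1 : ramp tn t = 0 by rewrite /ramp max_r//; lra.
  by rewrite r1 r2 mulr0 addr0 mulr0 addr0; apply: u1; rewrite tt0.
have r1 : ramp tn t = t - tn by rewrite /ramp max_l//; lra.
rewrite r1 r2 mulr0 addr0 u2; last exact: ltW.
pose s := (t - tn) / delta.
have s01 : 0 <= s <= 1.
  by rewrite /s ler_pdivlMr// ler_pdivrMr// mul0r mul1r; apply/andP; split; lra.
have kE : k * (t - tn) = s * (g (tn + delta) - g tn).
  by rewrite /k /s; field; rewrite gt_eqF.
rewrite kE (_ : g t - _ = (1 - s) * (g t - g tn) - s * (g (tn + delta) - g t)); last by ring.
have H1 : `|g t - g tn| <= e by apply: gH; lra.
have H2 : `|g (tn + delta) - g t| <= e by apply: gH; lra.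
case/andP: s01 => s0 s1.
have s10 : 0 <= 1 - s by rewrite subr_ge0.
rewrite (le_trans (ler_normB _ _))// (normrM (1 - s)) (normrM s) (ger0_norm s0) (ger0_norm s10).
have -> : e = (1 - s) * e + s * e by ring.
by apply: lerD; apply: ler_wpM2l => //; rewrite subr_ge0.
Qed.

Lemma expR_lipschitz (m s t : R) : s <= t -> t <= m ->
  `|expR t - expR s| <= expR m * (t - s).
Proof.
move=> st tm; rewrite ger0_norm ?subr_ge0 ?ler_expR//.
have -> : expR s = expR t * expR (s - t) by rewrite -expRD addrC subrK.
have H := expR_ge1Dx (s - t); have E := expR_gt0 t.
have Em : expR t <= expR m by rewrite ler_expR.
have : expR t * (t - s) <= expR m * (t - s) by apply: ler_wpM2r => //; rewrite subr_ge0.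
have : expR t * (1 + (s - t)) <= expR t * expR (s - t) by rewrite ler_wpM2l// ltW.
lra.
Qed.

(** A ramp evaluated at u.x is itself a ReLU ridge function, so interpolating [expR] on an interval
    [-m, m] containing all values of u.x on the cube approximates the exponential uniformly. *)
Lemma uc_exp C : uniform_class C -> (forall l, C (fun x => Num.max (aff l x) 0)) ->
  forall u, C (fun x => expR (aff (u, 0) x)).
Proof.
move=> uC Cr u.
have cE : continuous (fun x => expR (aff (u, 0) x)).
  move=> x; apply: continuous_comp; [exact: aff_continuous|exact: continuous_expR].
(* The constant 1 is the ReLU of the affine function with zero weights and bias 1. *)
have C1 : C (fun=> 1).
  have := Cr (0, 1); congr C; apply/funext => x.
  rewrite /aff big1 /= ?addr0 => [|j _]; last by rewrite mxE mul0r.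
  by rewrite max_l.
apply: uc_lim => // e e0.
have [m m0 mH] := continuous_bounded_on_cube (@aff_continuous _ _ (u, 0)).
(* Cells have length 2m/n and [expR m] is a Lipschitz constant on [-m, m], so this [n] bounds the
   oscillation on a cell by [e]. *)
pose n := (Num.truncn (2 * m * expR m / e)).+1.
have n0 : 0 < n%:R :> R by rewrite ltr0n.
pose delta := 2 * m / n%:R.
have d0 : 0 < delta by rewrite /delta !mulr_gt0// invr_gt0.
have ndE : - m + n%:R * delta = m by rewrite /delta; field; rewrite gt_eqF.
pose S (g : R -> R) := C (fun x => g (aff (u, 0) x)).
have [|||||||g Sg [gH _]] := @ramp_interpolation S expR (- m) e delta n.
- by move=> c; rewrite /S; have := uc_scale uC c C1; congr C; apply/funext => x; rewrite mulr1.
- move=> c; rewrite /S /ramp; have := Cr (u, - c); congr C; apply/funext => x.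
  by rewrite /aff /=; congr Num.max; ring.
- by move=> f g; exact: uc_add.
- by move=> k f; exact: uc_scale.
- exact: d0.
- exact: ltW.
- move=> s t _ st; rewrite ndE => tm ts; rewrite (le_trans (expR_lipschitz st tm))//.
  have : expR m * (t - s) <= expR m * delta by rewrite ler_wpM2l// expR_ge0.
  move=> /le_trans; apply; rewrite /delta mulrA ler_pdivrMr// mulrC -ler_pdivrMl//.
  by rewrite [leLHS]mulrC; exact/ltW/truncnS_gt.
exists (fun x => g (aff (u, 0) x)) => // x Kx; apply: gH; rewrite ndE -ler_norml.
exact: mH.
Qed.

(** The smallest uniform class containing the exponential ridge functions, encoded as an
    intersection. Exponentials serve as generators because, unlike ReLUs, they are closed under
    products; products give absolute values and minima, hence a lattice form of
    Stone-Weierstrass. *)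
Definition exp_closure phi := forall C, uniform_class C ->
  (forall u, C (fun x => expR (aff (u, 0) x))) -> C phi.

Lemma exp_closure_exp u : exp_closure (fun x => expR (aff (u, 0) x)).
Proof. by move=> C _; exact. Qed.

Lemma uniform_class_continuous : uniform_class (fun phi => continuous phi).
Proof.
split => //; first by move=> phi psi; exact: continuous_add.
by move=> k phi cphi; apply: continuous_mul => //; exact: continuous_cst.
Qed.

Lemma exp_continuous u : continuous (fun x : rV => expR (aff (u, 0) x)).
Proof. move=> x; apply: continuous_comp; [exact: aff_continuous|exact: continuous_expR]. Qed.

Lemma uniform_class_exp : uniform_class exp_closure.
Proof.
split.
- by move=> phi /(_ _ uniform_class_continuous); apply; exact: exp_continuous.
- by move=> phi psi H1 H2 C uC Cu; apply: uc_add => //; [exact: H1|exact: H2].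
- by move=> k phi H C uC Cu; apply: uc_scale => //; exact: H.
- move=> phi cphi H C uC Cu; apply: uc_lim => // e /H[psi Hpsi ?].
  by exists psi => //; exact: Hpsi.
Qed.

(* The functions preserving a class under multiplication form a class again;
   applied twice, starting from exp(u.x) exp(v.x) = exp((u+v).x), this gives
   closure under products. *)
Lemma multiplier_class psi C : uniform_class C -> continuous psi ->
  uniform_class (fun phi => continuous phi /\ C (fun x => phi x * psi x)).
Proof.
move=> uC cpsi; have [B B0 HB] := continuous_bounded_on_cube cpsi.
split.
- by move=> phi [].
- move=> f g [cf Cf] [cg Cg]; split; first exact: continuous_add.
  by under eq_fun do rewrite mulrDl; exact: uc_add.
- move=> k f [cf Cf]; split.
    by apply: continuous_mul => //; exact: continuous_cst.
  by under eq_fun do rewrite -mulrA; exact: uc_scale.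
- move=> phi cphi H; split => //; apply: uc_lim => //; first exact: continuous_mul.
  move=> e e0; have [|g [cg Cg] gH] := H (e / B); first by rewrite divr_gt0.
  exists (fun x => g x * psi x) => // x Kx; rewrite -mulrBl normrM.
  by rewrite (le_trans (ler_pM _ _ (gH x Kx) (HB x Kx)))// divfK ?gt_eqF.
Qed.

Lemma exp_closure_mul phi psi : exp_closure phi -> exp_closure psi ->
  exp_closure (fun x => phi x * psi x).
Proof.
move=> Hphi Hpsi.
have cpsi : continuous psi by exact: (uc_cont uniform_class_exp).
have [] // : continuous phi /\ exp_closure (fun x => phi x * psi x).
apply: (Hphi _ (multiplier_class uniform_class_exp cpsi)) => u.
split; first exact: exp_continuous.
under eq_fun do rewrite mulrC.
have [] // : continuous psi /\ exp_closure (fun x => psi x * expR (aff (u, 0) x)).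
apply: (Hpsi _ (multiplier_class uniform_class_exp (@exp_continuous u))) => v.
split; first exact: exp_continuous.
have := exp_closure_exp (v + u); congr exp_closure; apply/funext => x.
by rewrite -expRD -affD; congr (expR (aff _ x)); congr pair; rewrite addr0.
Qed.

Lemma exp_closure1 : exp_closure (fun=> 1).
Proof.
have := exp_closure_exp 0; congr exp_closure; apply/funext => x.
by rewrite (_ : (0, 0) = 0)// aff0 expR0.
Qed.

Lemma exp_closure_cst k : exp_closure (fun=> k).
Proof.
by have := uc_scale uniform_class_exp k exp_closure1; under eq_fun do rewrite mulr1.
Qed.

Lemma exp_closure_norm phi : exp_closure phi -> exp_closure (fun x => `|phi x|).
Proof.
move=> Hphi; have cphi := uc_cont uniform_class_exp Hphi.
have [B B0 HB] := continuous_bounded_on_cube cphi.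
pose f x := B^-1 * phi x.
have Hf : exp_closure f by apply: (uc_scale uniform_class_exp).
have fK x : K x -> `|f x| <= 1.
  by move=> Kx; rewrite normrM gtr0_norm ?invr_gt0// mulrC ler_pdivrMr// mul1r HB.
suff : exp_closure (fun x => B * `|f x|).
  congr exp_closure; apply/funext => x; rewrite /f normrM gtr0_norm ?invr_gt0//.
  by rewrite mulVKf// gt_eqF.
apply: (uc_scale uniform_class_exp); apply: (uc_lim uniform_class_exp).
  move=> x; apply: continuous_comp; last exact: norm_continuous.
  by apply: (uc_cont uniform_class_exp) => //.
(* This iteration increases to |f| wherever |f| <= 1. *)
pose p := fix p n x : R := if n is m.+1 then p m x + 2^-1 * (f x * f x + -1 * (p m x * p m x)) else 0.
have Hp n : exp_closure (p n).
  elim: n => [|n IH] /=; first exact: exp_closure_cst.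
  apply: (uc_add uniform_class_exp) => //; apply: (uc_scale uniform_class_exp).
  apply: (uc_add uniform_class_exp); first exact: exp_closure_mul.
  by apply: (uc_scale uniform_class_exp); exact: exp_closure_mul.
(* The last bound is the rate: with s = |f x| it gives s - p_n <= s / (1 + n s / 2) <= 2 / n for n >
   0, uniformly down to s = 0. *)
have pE n x : K x -> [/\ 0 <= p n x, p n x <= `|f x| &
    (`|f x| - p n x) * (1 + n%:R * (`|f x| / 2)) <= `|f x|].
  move=> Kx; elim: n => [|n [p0 pf IH]] /=.
    by rewrite subr0 mul0r addr0 mulr1; split.
  have ff : f x * f x = `|f x| * `|f x| by rewrite -normrM ger0_norm// -expr2 sqr_ge0.
  rewrite ff; set s := `|f x| in pf IH *; set q := p n x in p0 pf IH *.
  have s0 : 0 <= s by exact: normr_ge0.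
  have s1 : s <= 1 by exact: fK.
  have nE : n.+1%:R = n%:R + 1 :> R by rewrite -addn1 natrD.
  have n0 : 0 <= n%:R :> R by [].
  rewrite nE; move: (n%:R : R) n0 IH => N N0 IH.
  split.
  - have : 0 <= (s - q) * (s + q) by apply: mulr_ge0; lra.
    lra.
  - have : 0 <= (s - q) * (2 - (s + q)) by apply: mulr_ge0; lra.
    lra.
  - set E := s - (q + _).
    (* Exactly, E = (s - q)(1 - (s + q)/2). Dropping q leaves the factor 1 - s/2, and (1 - s/2)(1 +
       (N+1)s/2) <= 1 + N s/2 closes the induction. *)
    have E1 : E <= (s - q) * (1 - s / 2).
      have : 0 <= (s - q) * q by apply: mulr_ge0; lra.
      by rewrite /E; lra.
    apply: le_trans IH.
    apply: (@le_trans _ _ ((s - q) * (1 - s / 2) * (1 + (N + 1) * (s / 2)))).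
      by apply: ler_wpM2r => //; rewrite addr_ge0// mulr_ge0//; lra.
    rewrite -mulrA ler_wpM2l ?subr_ge0//.
    have : 0 <= (N + 1) * (s / 2) * (s / 2) by rewrite !mulr_ge0//; lra.
    by lra.
move=> e e0; pose n := (Num.truncn (2 / e)).+1.
exists (p n) => // x Kx; have [p0 pf pN] := pE n x Kx; move: pN.
rewrite [X in _ -> X <= _]ger0_norm ?subr_ge0//; set s := `|f x| in pf *; set q := p n x in p0 pf *.
have s0 : 0 <= s by exact: normr_ge0.
have ne : 2 < e * n%:R.
  by rewrite mulrC -ltr_pdivrMr//; exact: truncnS_gt.
move: (n%:R : R) ne => N Ne pN.
rewrite leNgt; apply/negP => eq1.
have N0 : 0 < N by rewrite -(pmulr_rgt0 _ e0); lra.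
have : (s - q) * N * s > 2 * s.
  have sp : 0 < s by lra.
  rewrite ltr_pM2r//; apply: (lt_trans Ne); rewrite ltr_pM2r//.
by nra.
Qed.

Lemma exp_closure_min phi psi : exp_closure phi -> exp_closure psi ->
  exp_closure (fun x => Num.min (phi x) (psi x)).
Proof.
move=> Hphi Hpsi.
have H : exp_closure (fun x => 2^-1 * ((phi x + psi x) + -1 * `|phi x + -1 * psi x|)).
  apply: (uc_scale uniform_class_exp); apply: (uc_add uniform_class_exp).
    exact: (uc_add uniform_class_exp).
  apply: (uc_scale uniform_class_exp); apply: exp_closure_norm.
  by apply: (uc_add uniform_class_exp) => //; apply: (uc_scale uniform_class_exp).
move: H; congr exp_closure; apply/funext => x.
have [h|h] := leP (phi x) (psi x).
  by rewrite ler0_norm; [field|lra].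
by rewrite ger0_norm; [field|lra].
Qed.

(** On [a, oo) the exponential expands distances by at least the factor exp a, so squared distances
    in the coordinates exp x_j detect separation quantitatively. *)
Lemma expR_expand (s t : R) : a <= s -> a <= t ->
  (expR a * (s - t)) ^+ 2 <= (expR s - expR t) ^+ 2.
Proof.
wlog st : s t / t <= s => [H sa ta|].
  have [/H|/ltW/H] := leP t s; first exact.
  by rewrite -[(expR s - _) ^+ 2]sqrrN -[(_ * (s - t)) ^+ 2]sqrrN -mulrN !opprB; exact.
move=> sa ta.
have H : expR a * (s - t) <= expR s - expR t.
  rewrite -[in expR s](subrK t s) expRD -{2}[expR t]mul1r -mulrBl mulrC.
  have := expR_ge1Dx (s - t) => h.
  by apply: ler_pM; rewrite ?subr_ge0 ?expR_ge0 ?ler_expR//; lra.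
have H0 : 0 <= expR a * (s - t) by rewrite mulr_ge0 ?expR_ge0 ?subr_ge0.
by rewrite ler_sqr// nnegrE// (le_trans H0).
Qed.

(** Minima suffice, without the usual second pass by maxima: the local functions dominate [phi] on
    the whole cube, so their minimum does too. *)
Lemma exp_closure_continuous phi : continuous phi -> exp_closure phi.
Proof.
move=> cphi; apply: (uc_lim uniform_class_exp) => // e e0.
have [B B0 HB] := continuous_bounded_on_cube cphi.
pose e2 := e / 2; have e20 : 0 < e2 by rewrite divr_gt0.
pose pen (y x : rV) := \sum_j (expR (x ord0 j) - expR (y ord0 j)) * (expR (x ord0 j) - expR (y ord0 j)).
have Hpen y : exp_closure (pen y).
  apply: (uc_sum _ uniform_class_exp exp_closure1) => j.
  have Hj : exp_closure (fun x => expR (x ord0 j) - expR (y ord0 j)).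
    apply: (uc_add uniform_class_exp); last exact: exp_closure_cst.
    have := exp_closure_exp (delta_mx ord0 j); congr exp_closure; apply/funext => x.
    rewrite /aff (bigD1 j)//= big1 => [|i ij]; rewrite !mxE ?eqxx/=.
      by rewrite mul1r addr0 add0r.
    by rewrite (negbTE ij) mul0r.
  exact: exp_closure_mul.
(* phi y + e / 2 plus a multiple of the squared distance to y (in the
   coordinates exp x_j) dominates phi and is close to it near y; finitely many
   such functions suffice and their minimum is taken. *)
have ex_h y : K y -> exists h, [/\ exp_closure h, forall x, K x -> phi x <= h x & h y < phi y + e].
  move=> Ky.
  have : \forall x \near y, `|phi y - phi x| < e2.
    by have /cvgrPdist_lt := cphi y; apply.
  move=> /nbhs_ballP[r /= r0 rH].
  (* Outside the ball of radius [r] some coordinate differs by at least [r], so the penalty is at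
     least [m] there. The factor 2B/m then lifts the function above B, since phi y >= -B. *)
  pose m := (expR a * r) ^+ 2.
  have m0 : 0 < m by rewrite exprn_gt0// mulr_gt0// expR_gt0.
  have Hh : exp_closure (fun x => (phi y + e2) + (2 * B / m) * pen y x).
    apply: (uc_add uniform_class_exp); first exact: exp_closure_cst.
    exact: (uc_scale uniform_class_exp).
  eexists; split; first exact: Hh.
    move=> x Kx; have pen0 : 0 <= pen y x by apply: sumr_ge0 => j _; rewrite -expr2 sqr_ge0.
    have L0 : 0 <= 2 * B / m by rewrite !mulr_ge0 ?invr_ge0 ?ltW.
    have [xy|xy] := pselect (ball y r x).
      have := rH _ xy; have := mulr_ge0 L0 pen0.
      by rewrite ltr_norml => ? /andP[? ?]; lra.
    have [j rj] : exists j, r <= `|x ord0 j - y ord0 j|.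
      apply: contrapT => /forallNP H; apply: xy; split => // i j; rewrite (ord1 i).
      by rewrite /ball /= distrC ltNge; exact/negP/H.
    have penm : m <= pen y x.
      rewrite /pen (bigD1 j)//= -[leLHS]addr0; apply: lerD; last first.
        by apply: sumr_ge0 => i _; rewrite -expr2 sqr_ge0.
      rewrite -expr2; apply: (le_trans _ (expR_expand _ _)).
      - rewrite /m !exprMn ler_wpM2l ?sqr_ge0//.
        by rewrite -[leRHS]real_normK ?num_real// ler_sqr// ?nnegrE// ltW.
      - by have /andP[] := Kx j.
      - by have /andP[] := Ky j.
    have : 2 * B <= 2 * B / m * pen y x.
      by rewrite mulrAC ler_pdivlMr// ler_wpM2l// mulr_ge0// ltW.
    by have := HB _ Kx; have := HB _ Ky; rewrite !ler_norml => /andP[? ?] /andP[? ?]; lra.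
  rewrite /pen big1 ?mulr0 ?addr0 => [|j _]; last by rewrite subrr mulr0.
  by rewrite ltrD2l /e2 ltr_pdivrMr// ltr_pMr// ltr1n.
have [h hH] : exists h : rV -> rV -> R, forall y, K y ->
    [/\ exp_closure (h y), forall x, K x -> phi x <= h y x & h y y < phi y + e].
  have ex_h' y : exists h, K y ->
      [/\ exp_closure h, forall x, K x -> phi x <= h x & h y < phi y + e].
    by have [/ex_h[h hP]|nK] := pselect (K y); [exists h|exists phi].
  have [h hH] := choice ex_h'.
  by exists h.
pose U y := [set x | h y x < phi x + e].
have := closed_cube_compact; rewrite compact_cover => /(_ rV K U).
case=> [y Ky|x Kx|D DK KD].
- have [Hh _ _] := hH _ Ky.
  have ch := uc_cont uniform_class_exp Hh.
  have cg : continuous (fun x => h y x - phi x) by move=> x; apply: continuousB; [exact: ch|exact: cphi].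
  rewrite (_ : U y = (fun x => h y x - phi x) @^-1` [set r | r < e]).
    by apply: open_comp => [x _|]; [exact: cg|exact: open_lt].
  by apply/seteqP; split => x; rewrite /U /= ltrBlDl.
- by exists x => //; rewrite /U /=; have [] := hH _ Kx.
have [g [Hg gphi gh]] : exists g, [/\ exp_closure g, forall x, K x -> phi x <= g x &
    forall y x, y \in finmap.enum_fset D -> g x <= h y x].
  have : forall y, y \in finmap.enum_fset D -> K y by move=> y /DK; rewrite inE.
  elim: (finmap.enum_fset D) => [_|y s IH sK].
    exists (fun=> B); split => //; first exact: exp_closure_cst.
    by move=> x /HB; rewrite ler_norml => /andP[].
  have [|g [Hg g1 g2]] := IH; first by move=> z zs; apply: sK; rewrite inE zs orbT.
  have [Hy y1 _] := hH y (sK _ (mem_head _ _)).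
  exists (fun x => Num.min (h y x) (g x)); split.
  - exact: exp_closure_min.
  - by move=> x Kx; rewrite le_min y1// g1.
  - move=> z x; rewrite inE ge_min => /orP[/eqP ->|/g2 ->]; first by rewrite lexx.
    by rewrite orbT.
exists g => // x Kx; have [y /= Dy Uy] := KD _ Kx.
have := gphi _ Kx; have := gh _ x Dy; move: Uy; rewrite /U /= => ? ? ?.
by rewrite ler_norml; apply/andP; split; lra.
Qed.

Lemma relu_dense C : uniform_class C ->
  (forall l, C (fun x => Num.max (aff l x) 0)) ->
  forall phi, continuous phi -> C phi.
Proof. by move=> uC Cl phi /exp_closure_continuous; apply => //; exact: uc_exp. Qed.

End density.

(** * Densities and translations *)

Section transfer.
Import HBNNSimple.
Context d3 (S : measurableType d3) (R : realType).
Local Open Scope ereal_scope.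

(** Splitting along the level sets of [phi] leaves only integrals of the weight over preimages,
    which are what the hypothesis [g12] below compares. *)
Lemma ge0_integral_density_sfun d0 (S0 : measurableType d0)
  (m0 : {measure set S0 -> \bar R}) (X0 : S0 -> S) (g0 : S0 -> R) (phi : {nnsfun S >-> R}) :
  measurable_fun setT X0 -> measurable_fun setT g0 -> (forall x, (0 <= g0 x)%R) ->
  \int[m0]_x ((phi (X0 x))%:E * (g0 x)%:E) =
  \sum_(r \in range phi) (r%:E * \int[m0]_(x in X0 @^-1` (phi @^-1` [set r])) (g0 x)%:E).
Proof.
move=> mX0 mg0 g00.
have mpre r : measurable (X0 @^-1` (phi @^-1` [set r])).
  by rewrite -[X in measurable X]setTI; apply: mX0.
have EFinf y : (phi y)%:E = \sum_(k \in range phi) k%:E * (\1_(phi @^-1` [set k]) y)%:E.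
  by rewrite fsumEFin //= fimfunE.
transitivity (\int[m0]_x (\sum_(r \in range phi)
    (r%:E * (\1_(phi @^-1` [set r]) (X0 x))%:E * (g0 x)%:E))).
  apply: eq_integral => x _; rewrite EFinf ge0_mule_fsuml// => r.
  exact: nnfun_muleindic_ge0.
have mind r : measurable_fun setT (fun x => \1_(phi @^-1` [set r]) (X0 x) : R).
  by apply: (measurableT_comp _ mX0).
rewrite ge0_integral_fsum //; last 2 first.
- move=> r; apply: emeasurable_funM; last exact/measurable_EFinP.
  by apply: measurable_funeM; exact/measurable_EFinP.
- by move=> r x _; rewrite mule_ge0 ?lee_fin//; exact: nnfun_muleindic_ge0.
apply: eq_fsbigr => r; rewrite inE => -[y _ <-].
under eq_integral do rewrite -muleA.
rewrite ge0_integralZl//; last 3 first.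
- by apply: emeasurable_funM; exact/measurable_EFinP.
- by move=> x _; rewrite mule_ge0// lee_fin.
- by rewrite lee_fin.
congr (_ * _); rewrite [RHS]integral_mkcond; apply: eq_integral => x _.
rewrite patchE indicE (_ : (X0 x \in _) = (x \in X0 @^-1` (phi @^-1` [set phi y]))).
  by case: ifPn => _; rewrite ?mul1e ?mul0e.
by apply/idP/idP => /set_mem ?; exact/mem_set.
Qed.

Context d1 d2 (S1 : measurableType d1) (S2 : measurableType d2).
Variables (m1 : {measure set S1 -> \bar R}) (m2 : {measure set S2 -> \bar R}).
Variables (X1 : S1 -> S) (X2 : S2 -> S) (g1 : S1 -> R) (g2 : S2 -> R).
Hypotheses (mX1 : measurable_fun setT X1) (mX2 : measurable_fun setT X2).
Hypotheses (mg1 : measurable_fun setT g1) (mg2 : measurable_fun setT g2).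
Hypotheses (g10 : forall x, (0 <= g1 x)%R) (g20 : forall x, (0 <= g2 x)%R).
Hypothesis g12 : forall B, measurable B ->
  \int[m1]_(x in X1 @^-1` B) (g1 x)%:E = \int[m2]_(x in X2 @^-1` B) (g2 x)%:E.

Let approx_lim d0 (S0 : measurableType d0)
  (m0 : {measure set S0 -> \bar R}) (X0 : S0 -> S) (g0 : S0 -> R)
  (phi : S -> \bar R) (mphi : measurable_fun setT phi) :
  (forall y, 0 <= phi y) ->
  measurable_fun setT X0 -> measurable_fun setT g0 -> (forall x, (0 <= g0 x)%R) ->
  \int[m0]_x (phi (X0 x) * (g0 x)%:E) =
  limn (fun n => \int[m0]_x ((nnsfun_approx measurableT mphi n (X0 x))%:E * (g0 x)%:E)).
Proof.
move=> phi0 mX0 mg0 g00; rewrite -monotone_convergence//.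
- apply: eq_integral => x _; apply/esym/cvg_lim => //.
  apply: cvgeZr; first by [].
  by have := @cvg_nnsfun_approx _ _ _ _ measurableT _ mphi (fun y _ => phi0 y) (X0 x) Logic.I.
- move=> n; apply: emeasurable_funM; last exact/measurable_EFinP.
  by apply/measurable_EFinP; exact: measurableT_comp.
- by move=> n x _; rewrite mule_ge0// lee_fin.
- move=> x _ m n mn; rewrite lee_wpmul2r ?lee_fin//.
  by have /lefP := @nd_nnsfun_approx _ _ _ _ measurableT _ mphi _ _ mn.
Qed.

Lemma ge0_integral_density_transfer (phi : S -> \bar R) :
  measurable_fun setT phi -> (forall y, 0 <= phi y) ->
  \int[m1]_x (phi (X1 x) * (g1 x)%:E) = \int[m2]_x (phi (X2 x) * (g2 x)%:E).
Proof.
move=> mphi phi0; rewrite !(approx_lim _ mphi)//; congr (limn _); apply/funext => n.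
rewrite !ge0_integral_density_sfun//; apply: eq_fsbigr => r _.
by rewrite g12.
Qed.

(** Serves three purposes: the law of X (weights 1 and [p]), conditional expectations (weights the
    positive and negative parts of a difference), and translations (weights 1). Positive and
    negative parts of [phi] are transferred separately, so no integrability is asked for. *)
Lemma integral_density_transfer (phi : S -> R) : measurable_fun setT phi ->
  \int[m1]_x (phi (X1 x) * g1 x)%:E = \int[m2]_x (phi (X2 x) * g2 x)%:E.
Proof.
move=> /measurable_EFinP mphi.
have pn d0 (S0 : measurableType d0) (m0 : {measure set S0 -> \bar R}) (X0 : S0 -> S) (g0 : S0 -> R) :
    (forall x, (0 <= g0 x)%R) -> \int[m0]_x (phi (X0 x) * g0 x)%:E =
    \int[m0]_x ((EFin \o phi)^\+ (X0 x) * (g0 x)%:E) -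
    \int[m0]_x ((EFin \o phi)^\- (X0 x) * (g0 x)%:E).
  move=> g00; rewrite integralE; congr (_ - _); apply: eq_integral => x _.
    by rewrite !funeposE /= EFinM maxeMl ?mul0e// lee_fin.
  by rewrite !funenegE EFinM -mulNe maxeMl ?mul0e// lee_fin.
rewrite !pn// !ge0_integral_density_transfer//.
- exact: measurable_funeneg.
- exact: measurable_funepos.
Qed.

End transfer.

Section translation.
Variable R : realType.
Local Open Scope ereal_scope.

Lemma lebesgue_translation (c : R) (g : R -> \bar R) : (forall x, 0 <= g x) ->
  measurable_fun (setT : set (measurableTypeR R)) g ->
  \int[lebesgue_measure]_x g (c + x)%R = \int[lebesgue_measure]_x g x.
Proof.
move=> g0 mg.
have mt : measurable_fun setT (fun x : measurableTypeR R => (c + x)%R : measurableTypeR R).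
  exact: measurable_funD.
have := @ge0_integral_pushforward _ _ _ _ R _ mt lebesgue_measure setT g measurableT mg.
rewrite preimage_setT => <-; last by move=> y _.
apply: eq_measure_integral => A mA _.
apply: esym; apply: lebesgue_measure_unique => //.
move=> _ [[u v] _ <-]; rewrite /pushforward.
rewrite [X in _ = lebesgue_measure X](_ : _ = `](u - c)%R, (v - c)%R]%classic); last first.
  by apply/seteqP; split => x /=; rewrite !in_itv /= ltrBlDl lerBrDl.
rewrite !lebesgue_measure_itv /= !lte_fin ltrD2r.
by case: ifP => // _; rewrite -!EFinB; congr (_%:E); ring.
Qed.

(** Tonelli splits off one coordinate: the tail is translated by induction for each fixed first
    coordinate, then the first coordinate by the one-dimensional case. *)
Lemma lebesgue_rV_translation n (c : 'rV[R]_n) (g : 'rV[R]_n -> \bar R) :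
  (forall x, 0 <= g x) -> measurable_fun setT g ->
  \int[lebesgue_rV R n]_x g (c + x)%R = \int[lebesgue_rV R n]_x g x.
Proof.
elim: n c g => [|n IHn] c g g0 mg.
  by apply: eq_integral => x _; congr g; apply/rowP => -[].
have step (h : 'rV[R]_n.+1 -> \bar R) : (forall x, 0 <= h x) -> measurable_fun setT h ->
    \int[lebesgue_rV R n.+1]_x h x =
    \int[lebesgue_measure]_t \int[lebesgue_rV R n]_y h (consrV (t, y)).
  move=> h0 mh.
  have mc : measurable_fun setT (@consrV R n : measurableTypeR R * 'rV[R]_n -> 'rV[R]_n.+1).
    exact: measurable_consrV.
  have := @ge0_integral_pushforward _ _ _ _ R _ mc
     (product_measure1 (@lebesgue_measure R) (lebesgue_rV R n)) setT h measurableT mh (fun y _ => h0 y).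
  move=> H; transitivity (\int[pushforward (lebesgue_measure \x lebesgue_rV R n) (@consrV R n)]_x h x).
    by apply: eq_measure_integral => A mA _.
  rewrite H.
  rewrite preimage_setT fubini_tonelli1//.
    exact: measurableT_comp (@measurable_consrV R n).
  by move=> x; exact: h0.
have mc : measurable_fun setT (fun x : 'rV[R]_n.+1 => (c + x)%R : 'rV[R]_n.+1).
  apply: measurable_matrix => i j; under eq_fun do rewrite mxE.
  by apply: measurable_funD => //; exact: measurable_coord.
rewrite (step g g0 mg) (step _ (fun x => g0 (c + x)%R) (measurableT_comp mg mc)).
pose c' : 'rV[R]_n := \row_j c ord0 (lift ord0 j).
have cE t y : (c + consrV (t, y))%R = consrV ((c ord0 ord0 + t)%R, (c' + y)%R).
  apply/rowP => j; rewrite !mxE; case: unliftP => [k ->|->] /=; rewrite ?mxE//.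
transitivity (\int[lebesgue_measure]_t \int[lebesgue_rV R n]_y g (consrV ((c ord0 ord0 + t)%R, y))).
  apply: eq_integral => t _.
  transitivity (\int[lebesgue_rV R n]_y g (consrV ((c ord0 ord0 + t)%R, (c' + y)%R))).
    by apply: eq_integral => y _; rewrite cE.
  apply: (IHn c' (fun y => g (consrV ((c ord0 ord0 + t)%R, y)))) => //.
  apply: measurableT_comp => //; apply: measurableT_comp (@measurable_consrV R n) _.
  exact: measurable_pair1.
apply: (@lebesgue_translation _ (fun t => \int[lebesgue_rV R n]_y g (consrV (t, y)))).
  by move=> t; exact: integral_ge0.
apply: (@measurable_fun_fubini_tonelli_F _ _ _ _ _ (lebesgue_rV R n) (fun z => g (consrV z))) => //.
exact: measurableT_comp (@measurable_consrV R n).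
Qed.

End translation.

(** * Dead neurons *)

Section indices.
Variables d h : nat.
Local Notation D := (param_dim d h).

Lemma weight_idx_inj (i i' : 'I_h) (j j' : 'I_d) :
  (weight_idx i j == weight_idx i' j') = (i == i') && (j == j').
Proof.
apply/eqP/andP => [|[/eqP -> /eqP ->]//].
move=> /(congr1 val); rewrite !val_weight_idx => E.
have d0 : (0 < d)%N by case: (d) j {E j'} => // -[].
have ii : i = i' :> nat.
  by have := congr1 (divn^~ d) E; rewrite !divnMDl// !divn_small// !addn0.
by split; [apply/eqP/val_inj|apply/eqP/val_inj => /=; move: E; rewrite ii => /addnI].
Qed.

Lemma weight_idx_lt (i : 'I_h) (j : 'I_d) : (weight_idx i j < d * h)%N.
Proof.
rewrite [X in (X < _)%N](val_weight_idx i j) (@leq_trans (i.+1 * d))//.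
  by rewrite mulSnr ltn_add2l.
by rewrite mulnC leq_mul2l ltn_ord orbT.
Qed.

Lemma bias_weight_idx (i i' : 'I_h) (j : 'I_d) : (bias_idx d i == weight_idx i' j) = false.
Proof.
apply/eqP => /(congr1 val) /= E; have := weight_idx_lt i' j.
by rewrite -[X in (X < _)%N]E [X in (X < _)%N](val_bias_idx d i) ltnNge leq_addr.
Qed.

Lemma bias_idx_inj (i i' : 'I_h) : (bias_idx d i == bias_idx d i') = (i == i').
Proof.
apply/eqP/eqP => [/(congr1 val)|->//]; rewrite !val_bias_idx => /addnI.
exact: val_inj.
Qed.

Lemma neuron_idx_bias (i k : 'I_h) : neuron_idx i (bias_idx d k) = (i == k).
Proof.
rewrite /neuron_idx bias_idx_inj eq_sym.
by case: existsP => [[j]|]; rewrite ?bias_weight_idx ?orbF.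
Qed.

Lemma neuron_idx_weight (i k : 'I_h) (j : 'I_d) : neuron_idx i (weight_idx k j) = (i == k).
Proof.
rewrite /neuron_idx [weight_idx _ _ == _]eq_sym bias_weight_idx /=.
apply/existsP/eqP => [[j'] | ->]; last by exists j.
by rewrite weight_idx_inj => /andP[/eqP].
Qed.

Lemma neuron_idx_lt (i : 'I_h) (k : 'I_D) : neuron_idx i k -> (k < d * h + h)%N.
Proof.
move=> /orP[/eqP ->|/existsP[j /eqP ->]].
  by rewrite [X in (X < _)%N](val_bias_idx d i) ltn_add2l.
by rewrite (leq_trans (weight_idx_lt i j))// leq_addr.
Qed.

Lemma neuron_idx_out (i k : 'I_h) : neuron_idx i (out_idx d k) = false.
Proof.
apply/negP => /neuron_idx_lt.
by rewrite [X in (X < _)%N](val_out_idx d k) ltnNge leq_addr.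
Qed.

Lemma neuron_idx_out_bias (i : 'I_h) : neuron_idx i (out_bias_idx d h) = false.
Proof.
apply/negP => /neuron_idx_lt.
by rewrite [X in (X < _)%N](val_out_bias_idx d h) ltnNge mul2n -addnn addnA leq_addr.
Qed.

Lemma out_idx_inj (i k : 'I_h) : (out_idx d i == out_idx d k) = (i == k).
Proof.
apply/eqP/eqP => [/(congr1 val)|->//]; rewrite !val_out_idx => /addnI.
exact: val_inj.
Qed.

Lemma out_bias_out_idx (i : 'I_h) : (out_bias_idx d h == out_idx d i) = false.
Proof.
apply/eqP => /(congr1 val); rewrite val_out_bias_idx val_out_idx => /eqP.
by rewrite mul2n -addnn addnA eqn_add2l gtn_eqF.
Qed.

Lemma neuron_idx_uniq (i i' : 'I_h) (k : 'I_D) : neuron_idx i k -> neuron_idx i' k -> i = i'.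
Proof.
move=> /orP[/eqP ->|/existsP[j /eqP ->]].
  by rewrite neuron_idx_bias => /eqP.
by rewrite neuron_idx_weight => /eqP.
Qed.

End indices.

(** * Vanishing gradient of a dead neuron *)

Section dead_neuron.
Variables (R : realType) (d h : nat) (sigma : R -> R).
Hypothesis sigmaE : forall x, sigma x = Num.max x 0.
Local Notation rV := 'rV[R]_d.
Implicit Types theta : 'rV[R]_(param_dim d h).

Definition neuron_aff (i : 'I_h) theta : rV * R :=
  (\row_j theta ord0 (weight_idx i j), theta ord0 (bias_idx d i)).

Lemma shallow_netE theta x : shallow_net sigma theta x =
  theta ord0 (out_bias_idx d h) +
  \sum_(i < h) theta ord0 (out_idx d i) * Num.max (aff (neuron_aff i theta) x) 0.
Proof.
congr (_ + _); apply: eq_bigr => i _; rewrite sigmaE /aff /=; congr (_ * Num.max (_ + _) _).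
by apply: eq_bigr => j _; rewrite mxE.
Qed.

Lemma neuron_aff_continuous i x : continuous (fun theta => aff (neuron_aff i theta) x).
Proof.
rewrite /aff /=; apply: continuous_add; first by move=> ?; exact: coord_continuous.
apply: continuous_sum => j; apply: continuous_mul; last exact: continuous_cst.
by under eq_fun do rewrite mxE; move=> ?; exact: coord_continuous.
Qed.

Lemma shallow_net_dead theta theta' i x :
  (forall k, ~~ neuron_idx i k -> theta' ord0 k = theta ord0 k) ->
  aff (neuron_aff i theta) x <= 0 -> aff (neuron_aff i theta') x <= 0 ->
  shallow_net sigma theta' x = shallow_net sigma theta x.
Proof.
move=> tt' dt dt'; rewrite !shallow_netE tt' ?neuron_idx_out_bias//; congr (_ + _).
apply: eq_bigr => k _; rewrite tt' ?neuron_idx_out//; have [<-|ik] := eqVneq i k.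
  by rewrite !max_r// !mulr0.
congr (_ * Num.max (aff _ _) _); congr pair.
  by apply/rowP => j; rewrite !mxE tt'// neuron_idx_weight.
by rewrite tt'// neuron_idx_bias.
Qed.

Variables (M : nat) (x : nat -> rV) (y : nat -> R) (E : 'rV[R]_(param_dim d h) -> R).
Hypothesis EE : forall theta, E theta = empirical_risk sigma M x y theta.

Lemma empirical_risk_dead theta theta' i :
  (forall k, ~~ neuron_idx i k -> theta' ord0 k = theta ord0 k) ->
  (forall m, aff (neuron_aff i theta) (x m) <= 0) ->
  (forall m, (m < M.+1)%N -> aff (neuron_aff i theta') (x m) <= 0) ->
  E theta' = E theta.
Proof.
move=> tt' dt dt'; rewrite !EE; congr (_ * _); rewrite big_nat [RHS]big_nat.
by apply: eq_bigr => m /andP[_ mM]; rewrite (@shallow_net_dead theta theta' i (x m))// dt'.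
Qed.

(** Strict negativity at finitely many samples is an open condition. The arbitrary [g] serves both
    the substitution map, for differentiability, and the line through [theta] in a coordinate
    direction, for the derivative. *)
Lemma near_dead_along (U : normedModType R) (g : U -> 'rV[R]_(param_dim d h)) (u : U) i :
  {for u, continuous g} -> (forall m, aff (neuron_aff i (g u)) (x m) < 0) ->
  \forall v \near u, forall m, (m < M.+1)%N -> aff (neuron_aff i (g v)) (x m) <= 0.
Proof.
move=> cg dead.
have : \forall v \near u, forall m : 'I_M.+1, aff (neuron_aff i (g v)) (x m) <= 0.
  apply: filter_forall => m.
  have : \forall v \near u, aff (neuron_aff i (g v)) (x m) < 0.
    have cc : {for u, continuous (fun v => aff (neuron_aff i (g v)) (x m))}.
      exact: (continuous_comp cg (@neuron_aff_continuous i (x m) (g u))).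
    apply: (cc (fun r => r < 0)).
    by apply: open_nbhs_nbhs; split; [exact: open_lt|exact: dead].
  by apply: filterS => v; exact: ltW.
by apply: filterS => v H m mM; exact: (H (Ordinal mM)).
Qed.

Lemma neuron_subst_off i theta psi k : ~~ neuron_idx i k ->
  neuron_subst i theta psi ord0 k = theta ord0 k.
Proof.
rewrite /neuron_idx negb_or mxE => /andP[/negbTE -> /existsPn H].
by case: pickP => // j; rewrite (negbTE (H j)).
Qed.

Lemma neuron_subst_params i theta : neuron_subst i theta (neuron_params i theta) = theta.
Proof.
apply/rowP => k; rewrite mxE; case: eqP => [->|kb]; first by rewrite mxE unlift_none.
by case: pickP => // j /eqP ->; rewrite mxE liftK.
Qed.

Lemma neuron_subst_continuous i theta : continuous (@neuron_subst d h R i theta).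
Proof.
move=> psi A /nbhs_ballP[e /= e0 eA]; apply/nbhs_ballP; exists e => // v [_ bv].
apply: eA; split => // p k; rewrite !mxE.
case: ifP => _; first exact: bv.
case: pickP => [j _|_]; first exact: bv.
exact: ballxx.
Qed.

Lemma differentiable_near_cst (U : normedModType R) (f : U -> R) (u : U) :
  (\forall v \near u, f v = f u) -> differentiable f u.
Proof.
move=> fc.
have c0 : continuous (\0 : U -> R) by exact: cst_continuous.
have fc0 : \forall v \near (0 : U), f (v + u) = f u.
  have cs : {for (0 : U), continuous (fun v : U => v + u)}.
    by apply: cvgD; [exact: cvg_id|exact: cvg_cst].
  by apply: (cs (fun v => f v = f u)); rewrite add0r.
have H : f \o shift u = cst (f u) + (\0 : U -> R) +o_ (0 : U) id.
  apply/eqaddoP => _/posnumP[e]; near=> v.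
  rewrite /= !fctE /= addr0 [f _](_ : _ = f u) ?subrr ?normr0 ?mulr_ge0//.
  near: v; exact: fc0.
apply/diff_locallyP; have -> : 'd f u = (\0 : U -> R) :> (U -> R) by exact: diff_unique.
by split.
Unshelve. all: by end_near. Qed.

(** [G] is tied to the derivative only where the empirical risk is differentiable in the parameters
    of the neuron. Near a strictly dead neuron the risk is constant in these parameters, which gives
    both the differentiability and the value 0. *)
Lemma gradient_dead (G : 'rV[R]_(param_dim d h)) theta i k :
  neuron_idx i k ->
  (differentiable (fun psi : 'rV[R]_d.+1 => E (neuron_subst i theta psi))
      (neuron_params i theta) -> G ord0 k = 'D_(delta_mx ord0 k) E theta) ->
  (forall m, aff (neuron_aff i theta) (x m) < 0) ->
  G ord0 k = 0.
Proof.
move=> ik GE dead; rewrite GE; last first.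
  apply: differentiable_near_cst; rewrite neuron_subst_params.
  have := @near_dead_along _ (@neuron_subst d h R i theta) (neuron_params i theta) i
    (@neuron_subst_continuous i theta _).
  rewrite neuron_subst_params => /(_ dead); apply: filterS => psi.
  apply: empirical_risk_dead => [k'|m]; [exact: neuron_subst_off|exact/ltW/dead].
rewrite /derive; apply: lim_near_cst; first exact: Rhausdorff.
have cl : {for 0, continuous (fun t : R => theta + t *: delta_mx ord0 k)}.
  apply: cvgD; first exact: cvg_cst.
  by apply: cvgZr_tmp; exact: cvg_id.
have := @near_dead_along _ (fun t : R => theta + t *: delta_mx ord0 k) 0 i cl.
rewrite scale0r addr0 => /(_ dead) N; apply: cvg_within; move: N; apply: filterS => t dt.
rewrite /= [t *: _ + _]addrC (@empirical_risk_dead theta _ i) ?subrr ?scaler0//.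
  move=> k' ik'; rewrite !mxE [X in _ + _ * X](_ : _ = 0) ?mulr0 ?addr0// eqxx /=.
  by case: eqP => // E'; move: ik'; rewrite E' ik.
by move=> m; exact/ltW/dead.
Qed.

End dead_neuron.

Section dead_forever.
Variables (R : realType) (d h : nat) (a b : R) (sigma : R -> R).
Hypothesis sigmaE : forall x, sigma x = Num.max x 0.
Variables (x : nat -> nat -> 'rV[R]_d) (y : nat -> nat -> R) (M : nat -> nat).
Hypothesis x_cube : forall n m, closed_cube d a b (x n m).
Variables (E : nat -> 'rV[R]_(param_dim d h) -> R) (G : nat -> 'rV[R]_(param_dim d h) -> 'rV[R]_(param_dim d h)).
Hypothesis EE : forall n theta, E n theta = empirical_risk sigma (M n) (x n) (y n) theta.
Hypothesis GE : forall n (i : 'I_h) (k : 'I_(param_dim d h)) theta,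
    neuron_idx i k ->
    differentiable (fun psi : 'rV[R]_d.+1 => E n (neuron_subst i theta psi))
      (neuron_params i theta) ->
    G n theta ord0 k = 'D_(delta_mx ord0 k) (E n) theta.
Variables (Theta : nat -> 'rV[R]_(param_dim d h))
  (Phi : forall n, ('I_n.+1 -> 'rV[R]_(param_dim d h)) -> 'rV[R]_(param_dim d h)).
Hypothesis Phi0 : forall n (g : 'I_n.+1 -> 'rV[R]_(param_dim d h)) k,
    \sum_(i < n.+1) `|g i ord0 k| = 0 -> Phi g ord0 k = 0.
Hypothesis ThetaS : forall n, Theta n.+1 =
    Theta n - Phi (fun i : 'I_n.+1 => G i (Theta i)).

(** Complete induction, since [Phi] sees the whole history: the neuron was dead at all earlier
    steps, so all its gradient coordinates so far are 0 and [Phi0] makes the update vanish there. *)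
Lemma dead_neuron_constant i :
  (forall z, closed_cube d a b z -> aff (neuron_aff i (Theta 0)) z < 0) ->
  forall n k, neuron_idx i k -> Theta n ord0 k = Theta 0 ord0 k.
Proof.
move=> dead n; elim/ltn_ind: n => -[//|n] IH k ik.
have dead_m m z : (m <= n)%N -> closed_cube d a b z -> aff (neuron_aff i (Theta m)) z < 0.
  move=> mn cz; rewrite [neuron_aff _ _](_ : _ = neuron_aff i (Theta 0)); first exact: dead.
  congr pair; last by rewrite IH// neuron_idx_bias.
  by apply/rowP => j; rewrite !mxE IH// neuron_idx_weight.
rewrite ThetaS !mxE Phi0 ?subr0; first by rewrite IH.
apply: big1 => m _; rewrite (@gradient_dead R d h sigma sigmaE (M m) (x m) (y m) (E m) (EE m) _ (Theta m) i k)//.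
- by rewrite normr0.
- by move=> diff; exact: GE diff.
- by move=> m'; apply: dead_m => //; rewrite -ltnS.
Qed.

Lemma dead_neuron_stays i n :
  (forall z, closed_cube d a b z -> aff (neuron_aff i (Theta 0)) z < 0) ->
  forall z, closed_cube d a b z -> aff (neuron_aff i (Theta n)) z < 0.
Proof.
move=> dead z cz; rewrite [neuron_aff _ _](_ : _ = neuron_aff i (Theta 0)); first exact: dead.
congr pair; last by rewrite (dead_neuron_constant dead)// neuron_idx_bias.
by apply/rowP => j; rewrite !mxE (dead_neuron_constant dead)// neuron_idx_weight.
Qed.

End dead_forever.

(** * Probability that no neuron is dead *)

Section independent_blocks.
Context d (T : measurableType d) (R : realType) (P : probability T R).
Local Open Scope ereal_scope.

Lemma prob_fin (A : set T) : measurable A -> (fine (P A))%:E = P A.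
Proof. by move=> mA; rewrite fineK// fin_num_measure. Qed.

Lemma prob_setD (A B : set T) : measurable A -> measurable B ->
  P (A `\` B) = P A - P (A `&` B).
Proof. by move=> mA mB; apply: measureD => //; rewrite ltey_eq fin_num_measure. Qed.

Lemma bigcap_measurable_seq (I : choiceType) (s : seq I) (F : I -> set T) :
  (forall i, measurable (F i)) -> measurable (\bigcap_(i in [set` s]) F i).
Proof. by move=> mF; apply: fin_bigcap_measurable => //; exact: finite_seq. Qed.

Lemma bigcap_cons (I : eqType) (k : I) (s : seq I) (F : I -> set T) :
  \bigcap_(j in [set` k :: s]) F j = F k `&` \bigcap_(j in [set` s]) F j.
Proof.
apply/seteqP; split => [w H|w [Fk H] j /=].
  by split=> [|j js]; apply: H => /=; rewrite inE ?eqxx// js orbT.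
by rewrite inE => /orP[/eqP ->//|js]; exact: H.
Qed.

(* Inclusion-exclusion, one complement at a time. *)
Lemma independent_complements (K : choiceType) (E : K -> set T) (e : K -> R) (s t : seq K) :
  (forall k, measurable (E k)) ->
  (forall s, uniq s -> P (\bigcap_(k in [set` s]) E k) = (\prod_(k <- s) e k)%:E) ->
  uniq (s ++ t) ->
  P (\bigcap_(k in [set` s]) E k `&` \bigcap_(k in [set` t]) ~` E k) =
  ((\prod_(k <- s) e k) * \prod_(k <- t) (1 - e k))%:E.
Proof.
move=> mE Ee; elim: t s => [|k t IH] s.
  rewrite cats0 big_nil mulr1 => us.
  by rewrite set_nil bigcap_set0 setIT Ee.
move=> ust; have mEC j : measurable (~` E j) by exact: measurableC.
have us_t : uniq (s ++ t).
  by apply: subseq_uniq ust; rewrite cat_subseq//; exact: subseq_cons.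
have uks : uniq ((k :: s) ++ t).
  by rewrite (@perm_uniq _ _ (s ++ k :: t))// -cat_rcons perm_cat2r perm_sym perm_rcons.
have IH1 := IH _ us_t; have IH2 := IH _ uks.
set A := \bigcap_(j in [set` s]) E j `&` \bigcap_(j in [set` t]) ~` E j in IH1.
have mA : measurable A by apply: measurableI; exact: bigcap_measurable_seq.
have -> : \bigcap_(j in [set` s]) E j `&` \bigcap_(j in [set` k :: t]) ~` E j = A `\` E k.
  by rewrite bigcap_cons /A setDE -setIA; congr (_ `&` _); rewrite setIC.
have AE : \bigcap_(j in [set` k :: s]) E j `&` \bigcap_(j in [set` t]) ~` E j = A `&` E k.
  by rewrite bigcap_cons /A -setIA setIC.
rewrite AE big_cons in IH2.
rewrite prob_setD//.
rewrite IH1 IH2.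
by rewrite -EFinB big_cons; congr (_%:E); ring.
Qed.

Lemma independent_none (K : finType) (E : K -> set T) (c : R) :
  (0 <= c)%R -> (forall k, measurable (E k)) ->
  (forall s, uniq s -> P (\bigcap_(k in [set` s]) E k) = \prod_(k <- s) P (E k)) ->
  (forall k, c%:E <= P (E k)) ->
  P (\bigcap_k ~` E k) <= ((1 - c) ^+ #|K|)%:E.
Proof.
move=> c0 mE EP cE; pose e k := fine (P (E k)).
have := @independent_complements K E e [::] (enum K) mE.
rewrite set_nil bigcap_set0 setTI big_nil mul1r.
rewrite (_ : [set` enum K] = setT); last by apply/seteqP; split => // k _ /=; rewrite mem_enum.
move=> ->.
- rewrite lee_fin big_enum /= -prodr_const; apply: ler_prod => k _.
  rewrite subr_ge0 lerB// -lee_fin prob_fin//.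
  by rewrite probability_le1.
- move=> s us; rewrite EP// (big_morph EFin EFinM erefl).
  by apply: eq_bigr => k _; rewrite prob_fin.
- exact: enum_uniq.
Qed.

(** The blocks being disjoint, mutual independence applied to a union of blocks factors over the
    blocks. As c0 <= 1, at most [n] factors bounded below by [c0] give [c0 ^+ n]. *)
Lemma independent_blocks (I K : finType) (V : I -> T -> R) (B : I -> set R)
    (J : K -> {set I}) (c0 : R) n :
  mutual_independence P V -> (forall i, measurable_fun setT (V i)) ->
  (forall i, measurable (B i)) -> (0 <= c0 <= 1)%R ->
  (forall i, c0%:E <= P (V i @^-1` B i)) ->
  (forall k k' i, i \in J k -> i \in J k' -> k = k') ->
  (forall k, (#|J k| <= n)%N) ->
  P (\bigcap_k ~` (\bigcap_(i in [set` J k]) V i @^-1` B i)) <= ((1 - c0 ^+ n) ^+ #|K|)%:E.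
Proof.
move=> indep mV mB /andP[c00 c01] cB Jdisj Jn.
have mVB i : measurable (V i @^-1` B i).
  by rewrite -[X in measurable X]setTI; exact: mV.
have mE k : measurable (\bigcap_(i in [set` J k]) V i @^-1` B i).
  by apply: fin_bigcap_measurable => //; exact: finite_finset.
apply: independent_none => //.
- by rewrite exprn_ge0.
- move=> s us.
  have -> : \bigcap_(k in [set` s]) \bigcap_(i in [set` J k]) V i @^-1` B i =
      \bigcap_(i in [set` (\bigcup_(k in [set x in s]) J k)%SET]) V i @^-1` B i.
    apply/seteqP; split => [w H i /= /bigcupP[k]|w H k /= ks i /= iJ].
      by rewrite inE => ks iJ; exact: H ks _ iJ.
    by apply: H => /=; apply/bigcupP; exists k; rewrite ?inE.
  (* Blocks outside [s] are replaced by the empty set, so that the disjoint union runs over the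
     whole type and the product over it splits. *)
  pose Js k := if k \in s then J k else finset.set0.
  have -> : (\bigcup_(k in [set x in s]) J k)%SET = (\bigcup_k Js k)%SET.
    by rewrite big_mkcond; apply: eq_bigr => k _; rewrite inE.
  rewrite (indep _ B mB) partition_disjoint_bigcup; last first.
    move=> k k' kk'; rewrite -setI_eq0; apply/eqP/setP => i; rewrite !inE /Js.
    apply/negbTE/negP => /andP[]; case: ifP => _ ik; last by rewrite inE in ik.
    case: ifP => _ ik'; last by rewrite inE in ik'.
    by move/eqP: kk'; apply; exact: Jdisj ik ik'.
  transitivity (\prod_(k in s) P (\bigcap_(i in [set` J k]) V i @^-1` B i)); last first.
    by rewrite big_uniq.
  rewrite [in RHS]big_mkcond; apply: eq_bigr => k _; rewrite /Js.
  by case: ifP => _; [rewrite (indep _ B mB)|rewrite big_set0].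
move=> k; rewrite (indep _ B mB).
rewrite (_ : \prod_(i in J k) _ = (\prod_(i in J k) fine (P (V i @^-1` B i)))%:E); last first.
  by rewrite (big_morph EFin EFinM erefl); apply: eq_bigr => i _; rewrite prob_fin.
rewrite lee_fin (@le_trans _ _ (c0 ^+ #|J k|)%R)//.
  by rewrite ler_wiXn2l// Jn.
rewrite -prodr_const; apply: ler_prod => i _; rewrite c00 /= -lee_fin prob_fin//.
Qed.

End independent_blocks.

(** * The law of a rescaled initial parameter *)

Section initial_law.
Context d (T : measurableType d) (R : realType) (P : probability T R).
Variables (V : T -> R) (q : R -> R) (s : R).
Hypotheses (mV : measurable_fun setT V) (q0 : forall y, 0 <= q y)
  (mq : measurable_fun setT q).
Hypothesis law : forall x : R, P [set w | s * V w < x] =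
  (\int[lebesgue_measure]_(y in `]-oo, x[) (q y)%:E)%E.
Local Open Scope ereal_scope.

(** The law is given through strict lower tails, whose differences are half-open intervals [u, v);
    the subtraction is legitimate because probabilities are finite. *)
Lemma scaled_law_itv (u v : R) : (u <= v)%R ->
  P [set w | (u <= s * V w < v)%R] = \int[lebesgue_measure]_(y in `[u, v[) (q y)%:E.
Proof.
move=> uv.
have mlt x : measurable [set w | (s * V w < x)%R].
  rewrite (_ : [set w | _] = (fun w => s * V w)%R @^-1` `]-oo, x[%classic).
    rewrite -[X in measurable X]setTI.
    by apply: (measurable_funM (measurable_cst _) mV).
  by apply/seteqP; split => w /=; rewrite in_itv.
have -> : [set w | (u <= s * V w < v)%R] =
    [set w | (s * V w < v)%R] `\` [set w | (s * V w < u)%R].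
  apply/seteqP; split => w /=; first by move=> /andP[h1 h2]; split => //; apply/negP; rewrite -leNgt.
  by move=> [-> /negP]; rewrite -leNgt => ->.
rewrite prob_setD//.
rewrite (_ : _ `&` _ = [set w | (s * V w < u)%R]); last first.
  by apply/seteqP; split => w /= => [[]//|h]; split => //; exact: lt_le_trans h uv.
have Pfin : P [set w | (s * V w < u)%R] \is a fin_num by exact: fin_num_measure.
have E : P [set w | (s * V w < v)%R] = P [set w | (s * V w < u)%R] +
    \int[lebesgue_measure]_(y in `[u, v[) (q y)%:E.
  rewrite !law -ge0_integral_setU//.
  - congr (integral _ _ _); apply/seteqP; split => y /=; rewrite !in_itv /=.
      by move=> yv; have [yu|yu] := ltP (y : R) u; [left|right; apply/andP].
    by case=> [yu|/andP[]//]; exact: lt_le_trans yu uv.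
  - by apply/measurable_EFinP; exact: measurable_funTS.
  - by move=> y _; rewrite lee_fin.
  - apply/disj_setPS => y [] /=; rewrite !in_itv /= => yu /andP[uy _].
    by move: (lt_le_trans yu uy); rewrite ltxx.
by rewrite E addeAC subee// add0e.
Qed.

End initial_law.

Lemma integral_itv_gt0 (R : realType) (q : R -> R) (u v : R) :
  (forall y, 0 <= q y) -> measurable_fun setT q -> u < v ->
  (forall y, u <= y < v -> 0 < q y) ->
  (0 < \int[lebesgue_measure]_(y in `[u, v[) (q y)%:E)%E.
Proof.
move=> q0 mq uv qp; rewrite lt_neqAle integral_ge0 ?andbT; last first.
  by move=> y _; rewrite lee_fin.
apply/negP => /eqP/esym I0.
have mqu : measurable_fun (`[u, v[%classic : set R) (EFin \o q).
  by apply/measurable_EFinP; exact: measurable_funTS.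
have : (\int[lebesgue_measure]_(y in `[u, v[) `|(q y)%:E| = 0)%E.
  by rewrite -[RHS]I0; apply: eq_integral => y _; rewrite gee0_abs// lee_fin.
move/(ae_eq_integral_abs lebesgue_measure (measurable_itv _) mqu) => [N [mN N0 NH]].
have : (lebesgue_measure (`[u, v[%classic : set R) <= lebesgue_measure N)%E.
  apply: le_measure; rewrite ?inE// => y yuv; apply: NH => /= /(_ yuv) /eqP.
  by rewrite eqe gt_eqF//; apply: qp; move: yuv; rewrite /= in_itv.
by rewrite N0 lebesgue_measure_itv /= lte_fin uv -EFinB lee_fin leNgt subr_gt0 uv.
Qed.

Section alive.
Context disp (Omega : measurableType disp) (R : realType) (P : probability Omega R).
Variables (d : nat) (a b : R) (q : R -> R) (eta kappa : R).
Hypotheses (q0 : forall y, 0 <= q y) (mq : measurable_fun setT q) (eta0 : 0 < eta).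
Hypothesis q_supp : `]- eta, eta[%classic `<=` q @^-1` `]0, +oo[%classic.

Lemma alive_probability : exists c : R, 0 < c <= 1 /\
  forall h (Theta : {RV P >-> 'rV[R]_(param_dim d h)}), (0 < h)%N ->
  mutual_independence P (fun (i : 'I_(h * d + h)) w => Theta w ord0 (hidden_idx i)) ->
  (forall (i : 'I_(h * d + h)) (x : R),
    P [set w | h%:R `^ kappa * Theta w ord0 (hidden_idx i) < x] =
    (\int[lebesgue_measure]_(y in `]-oo, x[) (q y)%:E)%E) ->
  exists E : 'I_h -> set Omega, [/\ forall i, measurable (E i),
    forall i w, E i w -> forall z, closed_cube d a b z -> aff (neuron_aff i (Theta w)) z < 0 &
    (P (\bigcap_i ~` E i) <= ((1 - c) ^+ h)%:E)%E].
Proof.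
pose C := `|a| + `|b| + 1.
have C1 : 1 <= C by rewrite /C lerDr addr_ge0.
have C0 : 0 < C by exact: lt_le_trans C1.
pose D : R := d.+1%:R.
have D1 : 1 <= D by rewrite /D ler1n.
have D0 : 0 < D by exact: lt_le_trans D1.
(* [C] bounds every coordinate on the cube, and [rho] makes d + 1 rescaled weights of size [rho]
   contribute at most eta/4, the distance from 0 to the bias interval. As C and D are at least 1,
   also rho <= eta/4, so the weight interval stays where [q] is positive. *)
pose rho := eta / 4 / (D * C).
have rho0 : 0 < rho by rewrite /rho !divr_gt0// mulr_gt0.
have rhoE : D * (rho * C) = eta / 4 by rewrite /rho; field; rewrite !gt_eqF.
have rho_lt : rho <= eta / 4.
  rewrite -rhoE mulrCA -[leLHS]mulr1 ler_pM2l// -[1]mulr1.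
  by apply: ler_pM.
have qp u v : - eta < u -> v <= eta -> forall y, u <= y < v -> 0 < q y.
  move=> eu ve y /andP[uy yv]; have := q_supp (t := y); rewrite /= !in_itv /= andbT; apply.
  by rewrite (lt_le_trans eu)//= (lt_le_trans yv).
pose Iq (u v : R) := (\int[lebesgue_measure]_(y in `[u, v[) (q y)%:E)%E.
pose I1 := Iq (- (eta / 2)) (- (eta / 4)); pose I2 := Iq (- rho) rho.
have I1_gt0 : (0 < I1)%E by apply: integral_itv_gt0 => //; [lra|apply: qp; lra].
have I2_gt0 : (0 < I2)%E by apply: integral_itv_gt0 => //; [lra|apply: qp; lra].
(* The constant is fixed before any [h] is given, when the integrals of [q] are not yet known to be
   probabilities; the minimum with 1 makes it a real number in (0, 1]. *)
pose m := Order.min 1%E (Order.min I1 I2).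
have m0 : (0 < m)%E by rewrite /m !lt_min I1_gt0 I2_gt0 lte01.
have m1 : (m <= 1)%E by rewrite /m ge_min lexx.
have mfin : m \is a fin_num.
  by rewrite ge0_fin_numE ?ltW// (le_lt_trans m1)// ltry.
pose c0 := fine m.
have c0E : (c0%:E = m)%E by rewrite /c0 fineK.
have c0_gt0 : 0 < c0 by rewrite -lte_fin c0E.
have c0_le1 : c0 <= 1 by rewrite -lee_fin c0E.
(* One factor for each of the d weights and one for the bias. *)
exists (c0 ^+ d.+1); split; first by rewrite exprn_gt0//= exprn_ile1// ltW.
move=> h Theta h0 indep law.
set s := h%:R `^ kappa in law.
have s0 : 0 < s by rewrite powR_gt0// ltr0n.
pose V (i : 'I_(h * d + h)) (w : Omega) : R := Theta w ord0 (hidden_idx i).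
have mV i : measurable_fun setT (V i).
  exact: (measurableT_comp (@measurable_coord R _ _ ord0 (hidden_idx i)) (measurable_funPT Theta)).
(* Hidden parameters are numbered with the [h * d] weights in front and the [h] biases after
   them. *)
pose lo (i : nat) := if (i < h * d)%N then - rho else - (eta / 2).
pose hi (i : nat) := if (i < h * d)%N then rho else - (eta / 4).
pose B (i : 'I_(h * d + h)) := [set y : R | lo i <= s * y < hi i].
have mB i : measurable (B i).
  rewrite (_ : B i = (fun y => s * y) @^-1` `[lo i, hi i[%classic).
    by rewrite -[X in measurable X]setTI; apply: measurable_funM.
  by apply/seteqP; split => y; rewrite /B /= in_itv.
pose J (k : 'I_h) := [set i : 'I_(h * d + h) | neuron_idx k (@hidden_idx d h i)]%SET.
pose E k := \bigcap_(i in [set` J k]) V i @^-1` B i.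
exists E; split.
- move=> k; apply: fin_bigcap_measurable => [|i _]; first exact: finite_finset.
  by rewrite -[X in measurable X]setTI; exact: mV.
- move=> k w Ew z cz.
  have hidden kk : neuron_idx k kk -> exists2 i : 'I_(h * d + h), i \in J k & hidden_idx i = kk /\ i = kk :> nat.
    move=> nk; have lt := neuron_idx_lt nk; rewrite [X in (_ < X + _)%N]mulnC in lt.
    have HE : @hidden_idx d h (Ordinal lt) = kk by apply: val_inj; rewrite val_hidden_idx.
    by exists (Ordinal lt) => //; rewrite inE HE.
  have bias : s * Theta w ord0 (bias_idx d k) < - (eta / 4).
    have [|i iJ [iE iv]] := hidden (bias_idx d k); first by rewrite neuron_idx_bias.
    have := Ew i iJ; rewrite /B /V /= /hi iE iv [X in (X < _)%N](val_bias_idx d k).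
    by rewrite mulnC ltnNge leq_addr /= => /andP[].
  have weight j : `|s * Theta w ord0 (weight_idx k j)| <= rho.
    have [|i iJ [iE iv]] := hidden (weight_idx k j); first by rewrite neuron_idx_weight.
    have := Ew i iJ; rewrite /B /V /= /hi /lo iE iv mulnC weight_idx_lt => /andP[l1 l2].
    by rewrite ler_norml l1 ltW.
  (* Multiplying by s > 0 keeps the sign, so the estimate is made for the rescaled parameters, whose
     law is free of [h]. *)
  rewrite -(pmulr_rlt0 _ s0) /aff /= mulrDr mulr_sumr.
  have : \sum_(j < d) s * ((\row_j Theta w ord0 (weight_idx k j)) ord0 j * z ord0 j) <= eta / 4.
    apply: (@le_trans _ _ (\sum_(j < d) rho * C)).
      apply: ler_sum => j _; rewrite mxE mulrA (le_trans (ler_norm _))// normrM.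
      apply: ler_pM => //; have /andP[z1 z2] := cz j.
      rewrite /C ler_norml; have := ler_norm a; have := ler_norm b.
      have := ler_norm (- a); have := ler_norm (- b); rewrite !normrN.
      by have := normr_ge0 a; have := normr_ge0 b; move=> *; apply/andP; split; lra.
    rewrite sumr_const card_ord -[leLHS]mulr_natl -rhoE ler_pM2r; last exact: mulr_gt0.
    by rewrite /D ler_nat.
  by move=> ?; lra.
rewrite -[h in X in (_ <= X)%E]card_ord.
apply: (@independent_blocks _ _ _ P _ _ V B J c0 d.+1 indep mV mB).
- by rewrite ltW.
- move=> i; rewrite c0E.
  have := @scaled_law_itv _ _ _ P (V i) q s (mV i) q0 mq (law i) (lo i) (hi i).
  rewrite (_ : V i @^-1` B i = [set w | lo i <= s * V i w < hi i])//.
  move=> ->; last by rewrite /lo /hi; case: ifP => _; lra.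
  rewrite /m !ge_min /lo /hi; case: ifP => _; first by rewrite [X in _ || (_ || X)]lexx !orbT.
  by rewrite [X in _ || (X || _)]lexx !orbT.
- move=> k k' i; rewrite !inE; exact: neuron_idx_uniq.
move=> k; rewrite -(card_imset _ (f := @hidden_idx d h)); last first.
  by move=> i j /(congr1 val); rewrite !val_hidden_idx => /val_inj.
apply: (@leq_trans #|bias_idx d k |: [set weight_idx k j | j : 'I_d]|%SET).
  apply/subset_leq_card/fintype.subsetP => kk /imsetP[i]; rewrite inE => ni ->.
  rewrite !inE; move: ni => /orP[->//|/existsP[j /eqP ->]].
  by rewrite imset_f ?orbT.
by rewrite cardsU1 (leq_trans (leq_add (leq_b1 _) (leq_imset_card _ _)))// card_ord.
Qed.

End alive.

(** * Weak limits of networks *)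

Lemma continuous_measurable_fun (R : realType) n (phi : 'rV[R]_n -> R) :
  continuous phi -> measurable_fun setT phi.
Proof.
move=> cphi; apply: (measurability _ (RGenOpens.measurableE R)).
move=> _ [_ [a [b ->] <-]]; rewrite setTI; apply: sub_sigma_algebra.
by apply: open_comp; [move=> x _; exact: cphi|exact: interval_open].
Qed.

Section pack.
Variables (R : realType) (d h : nat).
Implicit Types (F : 'I_h -> 'rV[R]_d * R) (o : 'I_h -> R) (c : R).

(** The [pick] tests recover the block to which coordinate [k] belongs; as the blocks are disjoint
    and exhaust the coordinates, the default case is the output bias. *)
Definition pack F o c : 'rV[R]_(param_dim d h) :=
  \row_k if [pick i | k == bias_idx d i] is Some i then (F i).2
    else if [pick ij : 'I_h * 'I_d | k == weight_idx ij.1 ij.2] is Some ij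
         then (F ij.1).1 ord0 ij.2
    else if [pick i | k == out_idx d i] is Some i then o i else c.

Lemma pack_bias F o c i : pack F o c ord0 (bias_idx d i) = (F i).2.
Proof.
rewrite mxE; case: pickP => [j|/(_ i)]; last by rewrite eqxx.
by rewrite bias_idx_inj => /eqP ->.
Qed.

Lemma pack_weight F o c i j : pack F o c ord0 (weight_idx i j) = (F i).1 ord0 j.
Proof.
rewrite mxE; case: pickP => [k|_]; first by rewrite eq_sym bias_weight_idx.
case: pickP => [[k l]|/(_ (i, j))]; last by rewrite eqxx.
by rewrite weight_idx_inj => /andP[/eqP -> /eqP ->].
Qed.

Lemma pack_out F o c i : pack F o c ord0 (out_idx d i) = o i.
Proof.
rewrite mxE; case: pickP => [k /eqP E|_].
  by have := neuron_idx_out d k i; rewrite E neuron_idx_bias eqxx.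
case: pickP => [[k l] /eqP E|_].
  by have := neuron_idx_out d k i; rewrite E neuron_idx_weight eqxx.
by case: pickP => [k|/(_ i)]; rewrite ?eqxx// out_idx_inj => /eqP ->.
Qed.

Lemma pack_out_bias F o c : pack F o c ord0 (out_bias_idx d h) = c.
Proof.
rewrite mxE; case: pickP => [k /eqP E|_].
  by have := neuron_idx_out_bias d k; rewrite E neuron_idx_bias eqxx.
case: pickP => [[k l] /eqP E|_].
  by have := neuron_idx_out_bias d k; rewrite E neuron_idx_weight eqxx.
by case: pickP => [k|//]; rewrite out_bias_out_idx.
Qed.

Lemma neuron_aff_pack F o c i : neuron_aff i (pack F o c) = F i.
Proof.
rewrite /neuron_aff pack_bias; case: (F i) (pack_weight F o c i) => w b H; congr pair.
by apply/rowP => j; rewrite mxE H.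
Qed.

Variable sigma : R -> R.
Hypothesis sigmaE : forall x, sigma x = Num.max x 0.

Lemma shallow_net_pack F o c x :
  shallow_net sigma (pack F o c) x = c + \sum_i o i * Num.max (aff (F i) x) 0.
Proof.
rewrite (shallow_netE sigmaE) pack_out_bias; congr (_ + _).
by apply: eq_bigr => i _; rewrite pack_out neuron_aff_pack.
Qed.

Lemma shallow_net_continuous (theta : 'rV[R]_(param_dim d h)) :
  continuous (shallow_net sigma theta).
Proof.
rewrite (_ : shallow_net _ _ = fun x => theta ord0 (out_bias_idx d h) +
    \sum_(i < h) theta ord0 (out_idx d i) * Num.max (aff (neuron_aff i theta) x) 0); last first.
  by apply/funext => x; exact: shallow_netE.
apply: continuous_add; first exact: continuous_cst.
apply: continuous_sum => i; apply: continuous_mul; first exact: continuous_cst.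
by apply: continuous_max_cst; exact: aff_continuous.
Qed.

End pack.

Section lebesgue_box.
Variables (R : realType) (d : nat).
Local Notation leb := (lebesgue_rV R d).

Lemma closed_cube_measurable (a b : R) : measurable (closed_cube d a b).
Proof.
rewrite (_ : closed_cube d a b = \bigcap_(i in [set: 'I_d])
    (fun x : 'rV[R]_d => x ord0 i) @^-1` `[a, b]%classic).
  apply: fin_bigcap_measurable => [|i _]; first exact: finite_finset.
  by rewrite -[X in measurable X]setTI; exact: measurable_coord.
by apply/seteqP; split => x H i *; have := H i; rewrite /= in_itv//=; apply.
Qed.

Lemma lebesgue_closed_cube (a b : R) : a <= b ->
  leb (closed_cube d a b) = ((b - a) ^+ d)%:E.
Proof.
move=> ab; have := @lebesgue_rV_box R d (const_mx a) (const_mx b).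
under eq_bigr do rewrite !mxE.
rewrite prodr_const card_ord => <- => [|i]; last by rewrite !mxE.
by congr (leb _); apply/seteqP; split => x H i; have := H i; rewrite !mxE in_itv.
Qed.

Lemma lebesgue_closed_cube_fin (a b : R) : (leb (closed_cube d a b) < +oo)%E.
Proof.
have [ab|ba] := leP a b; first by rewrite lebesgue_closed_cube// ltry.
apply: (@le_lt_trans _ _ (leb (closed_cube d b a))); last first.
  by rewrite lebesgue_closed_cube ?ltry// ltW.
apply: le_measure; rewrite ?inE; [exact: closed_cube_measurable|exact: closed_cube_measurable|].
by move=> x H i; have /andP[h1 h2] := H i; move: (le_trans h1 h2); rewrite leNgt ba.
Qed.

Lemma integrable_cube (a b C : R) (g : 'rV[R]_d -> R) : measurable_fun setT g ->
  (forall x, closed_cube d a b x -> `|g x| <= C) ->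
  (forall x, ~ closed_cube d a b x -> g x = 0) ->
  leb.-integrable setT (EFin \o g).
Proof.
move=> mg gC g0.
have mK := closed_cube_measurable a b.
have I : leb.-integrable (closed_cube d a b) (EFin \o g).
  apply: measurable_bounded_integrable => //.
  - exact: lebesgue_closed_cube_fin.
  - exact: measurable_funTS.
  - exists C; split; first exact: num_real.
    by move=> M CM x Kx; apply: le_trans (gC x Kx) (ltW CM).
move: I; rewrite integrable_mkcond//; congr (integrable _ _ _).
apply/funext => x; rewrite patchE; case: ifPn => // /negP xK.
by rewrite /= g0// => Kx; apply: xK; rewrite inE.
Qed.

Lemma Rintegral_translation (c : 'rV[R]_d) (g : 'rV[R]_d -> R) : measurable_fun setT g ->
  \int[leb]_x g (c + x) = \int[leb]_x g x.
Proof.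
move=> mg.
pose tr (x : 'rV[R]_d) : 'rV[R]_d := c + x.
have mt : measurable_fun setT tr.
  apply: measurable_matrix => i j; under eq_fun do rewrite mxE.
  by apply: measurable_funD => //; exact: measurable_coord.
have H (B : set 'rV[R]_d) : measurable B ->
    (\int[leb]_(x in tr @^-1` B) (cst 1%R x)%:E =
     \int[leb]_(x in id @^-1` B) (cst 1%R x)%:E)%E.
  move=> mB; rewrite integral_mkcond [RHS]integral_mkcond.
  have := @lebesgue_rV_translation R d c (EFin \o \1_B).
  have E (S : set 'rV[R]_d) : (EFin \o cst (1 : R)) \_ S = EFin \o \1_S.
    by apply/funext => x; rewrite patchE /= indicE; case: ifPn.
  move=> T; rewrite -[X in integral _ _ X]/((EFin \o cst (1 : R)) \_ _) E.
  rewrite -[X in _ = integral _ _ X]/((EFin \o cst (1 : R)) \_ _) E -T.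
  - by apply: eq_integral => x _.
  - by move=> x; rewrite lee_fin.
  - exact/measurable_EFinP.
have := @integral_density_transfer _ _ R _ _ _ _ leb leb tr id (cst 1) (cst 1)
  mt (@measurable_id _ _ setT) (@measurable_cst _ _ _ _ _ _) (@measurable_cst _ _ _ _ _ _)
  (fun=> ler01) (fun=> ler01) H g mg.
rewrite /Rintegral => E; congr fine; move: E.
by under eq_integral do rewrite mulr1; under [in X in _ = X -> _]eq_integral do rewrite mulr1.
Qed.

End lebesgue_box.

Lemma near_all_seq (T : Type) (I : eqType) (F : set_system T) (s : seq I) (Q : I -> T -> Prop) {FF : Filter F} :
  (forall m, m \in s -> \forall z \near F, Q m z) ->
  \forall z \near F, forall m, m \in s -> Q m z.
Proof.
elim: s => [|m s IH] H; first by apply: filterE.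
have Hs : \forall z \near F, forall m, m \in s -> Q m z.
  by apply: IH => k ks; apply: H; rewrite inE ks orbT.
have Hm : \forall z \near F, Q m z by apply: H; rewrite inE eqxx.
apply: filterS2 Hm Hs => z qm qs k.
by rewrite inE => /orP[/eqP ->//|/qs].
Qed.

Section cube_norm.
Variables (R : realType) (d : nat).
Implicit Types (e : R) (z : 'rV[R]_d).

Lemma norm_lt_cube e z : `|z| < e -> closed_cube d (- e) e z.
Proof.
move=> ze i; rewrite -ler_norml ltW//; apply: le_lt_trans ze.
rewrite [leRHS]/Num.norm /= mx_normrE.
exact: (@le_bigmax _ _ _ 0 (fun ij : 'I_1 * 'I_d => `|z ij.1 ij.2|) (ord0, i)).
Qed.

Lemma cube_norm_le e z : 0 <= e -> closed_cube d (- e) e z -> `|z| <= e.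
Proof.
move=> e0 H; rewrite [leLHS]/Num.norm /= mx_normrE.
by apply/bigmax_leP; split => // -[i j] _ /=; rewrite (ord1 i) ler_norml.
Qed.

End cube_norm.

(** * From weak convergence to identities between point values *)

Section point_identity.
Variables (R : realType) (d : nat) (a b : R).
Local Notation rV := 'rV[R]_d.
Local Notation K := (closed_cube d a b).
Local Notation O := (open_cube d a b).
Local Notation leb := (lebesgue_rV R d).
Variables (f p : rV -> R) (N : nat -> rV -> R).
Hypotheses (mf : measurable_fun setT f) (cf : forall x, O x -> {for x, continuous f}).
Hypothesis f_bounded : exists Cf, forall x, K x -> `|f x| <= Cf.
Hypotheses (cp : continuous p) (pO : forall x, O x -> 0 < p x).
Hypothesis cN : forall k, continuous (N k).
Hypothesis vanish : forall phi : rV -> R, continuous phi -> forall e, 0 < e ->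
  exists k0, forall k, (k0 <= k)%N -> `|\int[leb]_x ((N k x - f x) * phi x * p x)| <= e.

Lemma open_cube_open : open O.
Proof.
rewrite openE => x Ox.
have : nbhs (x : rV) (fun y : rV => forall i, a < y ord0 i < b).
  apply: (@filter_forall _ _ _ _ (nbhs_filter (x : rV))) => i.
  apply: (@coord_continuous R 1 d ord0 i x (fun r => a < r < b)).
  apply: open_nbhs_nbhs; split; last exact: Ox.
  have : open (`]a, b[%classic : set R) by exact: interval_open.
  by congr open; apply/seteqP; split => r; rewrite /= in_itv.
by [].
Qed.

Lemma open_cube_sub : O `<=` K.
Proof. by move=> x H i; have /andP[/ltW -> /ltW ->] := H i. Qed.

Definition tent (e : R) (z : rV) : R := Num.max (e - `|z|) 0.

Lemma tent_continuous e : continuous (tent e).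
Proof.
apply: continuous_max_cst => z.
exact: (continuousB (@cst_continuous _ _ e z) (@norm_continuous R rV z)).
Qed.

Lemma tent_ge0 e z : 0 <= tent e z.
Proof. by rewrite /tent le_max lexx orbT. Qed.

Lemma tent_gt0 e z : 0 < tent e z -> `|z| < e.
Proof. by rewrite /tent lt_max ltxx orbF subr_gt0. Qed.

Lemma tent_le e z : 0 <= e -> tent e z <= e.
Proof. by move=> e0; rewrite /tent ge_max e0 andbT gerBl. Qed.

Lemma tent_integral_gt0 e : 0 < e ->
  leb.-integrable setT (EFin \o tent e) /\ 0 < \int[leb]_z tent e z.
Proof.
move=> e0.
have mt : measurable_fun setT (tent e) by apply: continuous_measurable_fun; exact: tent_continuous.
have I : leb.-integrable setT (EFin \o tent e).
  apply: (@integrable_cube R d (- e) e e) => // z nz.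
    by rewrite ger0_norm ?tent_ge0// tent_le// ltW.
  by apply/eqP; rewrite eq_le tent_ge0 andbT leNgt; apply/negP => /tent_gt0 /norm_lt_cube.
split => //.
pose B := closed_cube d (- (e / 2)) (e / 2) : set rV.
have mB : measurable B by exact: closed_cube_measurable.
have Ic : leb.-integrable setT (EFin \o (fun z => (e / 2) * \1_B z)).
  apply: (@integrable_cube R d (- (e / 2)) (e / 2) (e / 2)) => //.
  - by apply: measurable_funM => //; exact: measurable_indic.
  - move=> z Bz; rewrite indicE mem_set// mulr1 ger0_norm//; lra.
  - by move=> z nB; rewrite indicE memNset// mulr0.
apply: (@lt_le_trans _ _ (\int[leb]_z ((e / 2) * \1_B z))); last first.
  apply: le_Rintegral => // z _; have [Bz|nB] := pselect (B z).
    rewrite indicE mem_set// mulr1 /tent le_max; apply/orP; left.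
    have : `|z| <= e / 2 by apply: cube_norm_le => //; rewrite divr_ge0// ltW.
    by move=> ?; lra.
  by rewrite indicE memNset// mulr0 tent_ge0.
rewrite RintegralZl//; last first.
  apply: (@integrable_cube R d (- (e / 2)) (e / 2) 1) => //.
  - by move=> z Bz; rewrite indicE mem_set// normr1.
  - by move=> z nB; rewrite indicE memNset.
apply: mulr_gt0; first lra.
have -> : \int[leb]_z \1_B z = fine (leb B) by rewrite /Rintegral integral_indic// setIT.
rewrite lebesgue_closed_cube; last by lra.
by rewrite /= exprn_gt0//; lra.
Qed.

(* The combination of tents centred at the points of s, divided by p, is an
   admissible test function; translating the tents to the origin turns the
   integral into one of comb s (N k - f) over a small cube. *)
Lemma point_identity (s : seq (R * rV)) (eps : R) : 0 < eps ->
  (forall m, m \in s -> O m.2) ->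
  (forall k0, exists2 k, (k0 <= k)%N & forall z, `|z| < eps ->
     comb s (fun x => N k (x + z)) = 0) ->
  comb s f = 0.
Proof.
move=> eps0 sO0 sN0; apply: contrapT => S0.
(* Scaling the weights by [comb s f] turns the value at [f] into a square, hence positive, and still
   annihilates the networks. *)
pose t := [seq (comb s f * z.1, z.2) | z <- s].
have tO m : m \in t -> O m.2 by move=> /mapP[m' /sO0 ? ->].
have tN k0 : exists2 k, (k0 <= k)%N & forall z, `|z| < eps ->
     comb t (fun x => N k (x + z)) = 0.
  have [k k0k H] := sN0 k0; exists k => // z /H E.
  by rewrite comb_scale E mulr0.
pose S := comb t f.
have Sgt0 : 0 < S.
  by rewrite /S comb_scale -expr2 lt_neqAle sqr_ge0 andbT eq_sym sqrf_eq0; exact/eqP.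
have [pm pm0 pmt] : exists2 pm, 0 < pm & forall m, m \in t -> pm < p m.2.
  elim: (t) tO => [|m r IH] rO; first by exists 1.
  have [|pm pm0 pmr] := IH; first by move=> k kr; apply: rO; rewrite inE kr orbT.
  have pm1 : 0 < p m.2 by apply/pO/rO; rewrite inE eqxx.
  exists (Num.min pm (p m.2 / 2)); first by rewrite lt_min pm0 divr_gt0.
  move=> k; rewrite inE => /orP[/eqP ->|/pmr kr]; rewrite gt_min.
    by rewrite [X in _ || X](_ : _ = true) ?orbT// ltr_pdivrMr// ltr_pMr// ltr1n.
  by rewrite kr.
have shift_cvg (x : rV) : (fun z : rV => x + z) @ (0 : rV) --> x.
  have H : continuous (fun z : rV => x + z).
    move=> z; have idc : {for z, continuous (fun z : rV => z)} by exact: cvg_id.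
    exact: (continuousD (@cst_continuous _ _ x z) idc).
  by have := H 0; rewrite /continuous_at addr0.
have near0 : \forall z \near (0 : rV), (forall m, m \in t -> O (m.2 + z) /\ pm < p (m.2 + z)) /\
    S / 2 < comb t (fun x => f (x + z)).
  apply: filterI.
    apply: (@near_all_seq _ _ _ t (fun m z => O (m.2 + z) /\ pm < p (m.2 + z)) (nbhs_filter (0 : rV))) => m mt; apply: filterI.
      by apply: (shift_cvg m.2 O); apply: open_nbhs_nbhs; split; [exact: open_cube_open|exact: tO].
    apply: (shift_cvg m.2 (fun x => pm < p x)).
    have cpm : {for m.2, continuous p} by exact: cp.
    apply: (cpm (fun r => pm < r)).
    by apply: open_nbhs_nbhs; split; [exact: open_gt|exact: pmt].
  have cc (u : seq (R * rV)) : (forall m, m \in u -> O m.2) ->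
      {for (0 : rV), continuous (fun z => comb u (fun x => f (x + z)))}.
    elim: u => [|m u IH] uO.
      rewrite (_ : (fun z => _) = fun=> 0); first exact: cst_continuous.
      by apply/funext => z; rewrite /comb big_nil.
    rewrite (_ : (fun z => _) = (fun z => m.1 * f (m.2 + z)) \+ (fun z => comb u (fun x => f (x + z)))).
      have fm : {for (m.2 + 0 : rV), continuous f}.
        by rewrite addr0; apply: cf; apply: uO; exact: mem_head.
      have sm : {for (0 : rV), continuous (fun z : rV => m.2 + z)}.
        by have := shift_cvg m.2; rewrite -[X in _ --> X]addr0.
      have IHu := IH (fun k ku => uO k (mem_behead (s := m :: u) ku)).
      exact: (continuousD (continuousM (@cst_continuous _ _ m.1 _) (continuous_comp sm fm)) IHu).
    by apply/funext => z; rewrite /comb big_cons.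
  apply: (cc t tO (fun r => S / 2 < r)); apply: open_nbhs_nbhs; split; first exact: open_gt.
  rewrite /= (_ : comb t _ = S); last by rewrite /S; congr comb; apply/funext => x; rewrite addr0.
  by rewrite /= ltr_pdivrMr// ltr_pMr// ltr1n.
have [r r0 rH] : exists2 r, 0 < r & forall z : rV, `|z| < r ->
    [/\ `|z| < eps, (forall m, m \in t -> O (m.2 + z) /\ pm < p (m.2 + z)) &
    S / 2 < comb t (fun x => f (x + z))].
  move/nbhs_normP : near0 => [r0 /= r00 r0H]; exists (Num.min eps r0); first by rewrite lt_min eps0.
  move=> z; rewrite lt_min => /andP[ze zr].
  by have [|H1 H2] := r0H z; first by rewrite /= sub0r normrN.
have [It It0] := tent_integral_gt0 r0.
set J := \int[leb]_z tent r z in It0.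
(* The maximum with [pm] makes the quotient continuous everywhere; on the supports of the tents p >
   pm, so [phi * p] is exactly the combination of tents. *)
pose phi (x : rV) : R := comb t (fun y : rV => tent r (x - y)) / Num.max (p x) pm.
have mx0 x : Num.max (p x) pm != 0 by rewrite gt_eqF// lt_max pm0 orbT.
have cphi : continuous phi.
  apply: continuous_mul.
    apply: continuous_sum => m; apply: continuous_mul; first exact: continuous_cst.
    move=> x; have idc : {for x, continuous (fun z : rV => z)} by exact: cvg_id.
    have sm : {for x, continuous (fun z : rV => z - m.2)}.
      exact: (continuousB idc (@cst_continuous _ _ m.2 x)).
    exact: (continuous_comp sm (@tent_continuous r (x - m.2))).
  have cm : continuous (fun x => Num.max (p x) pm) by exact: continuous_max_cst.
  exact: continuous_inv.
(* The integral will turn out to be at most -(S/2) J, so the tolerance (S/4) J yields the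
   contradiction. *)
have [k0 Hk0] := vanish cphi (e := S / 4 * J) (mulr_gt0 (divr_gt0 Sgt0 (ltr0n _ 4)) It0).
have [k k0k HN] := tN k0.
have := Hk0 k k0k.
have near_m m z : m \in t -> 0 < tent r z -> [/\ `|z| < r, O (m.2 + z) & pm < p (m.2 + z)].
  by move=> mt /tent_gt0 zr; have [_ /(_ m mt)[? ?] _] := rH z zr; split.
have phip x : phi x * p x = comb t (fun y => tent r (x - y)).
  have [[m mt xm]|H] := pselect (exists2 m, m \in t & 0 < tent r (x - m.2)).
    have [_ _ ppm] := near_m m (x - m.2) mt xm.
    rewrite /phi; move: (mx0 x); rewrite addrC subrK in ppm.
    by rewrite max_l ?ltW// => ?; rewrite divfK.
  have -> : comb t (fun y => tent r (x - y)) = 0.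
    rewrite /comb big_seq big1// => m mt; apply/eqP; rewrite mulf_eq0; apply/orP; right.
    by rewrite eq_le tent_ge0 andbT leNgt; apply/negP => xm; apply: H; exists m.
  rewrite /phi (_ : comb _ _ = 0) ?mul0r//.
    rewrite /comb big_seq big1// => m mt; apply/eqP; rewrite mulf_eq0; apply/orP; right.
    by rewrite eq_le tent_ge0 andbT leNgt; apply/negP => xm; apply: H; exists m.
have [CN CN0 HCN] := @continuous_bounded_on_cube R d a b (N k) (@cN k).
have [Cf HCf] := f_bounded.
pose g (x : rV) := N k x - f x.
have mg : measurable_fun setT g.
  by apply: measurable_funB => //; exact: continuous_measurable_fun.
have gK x : K x -> `|g x| <= CN + Cf.
  by move=> Kx; rewrite (le_trans (ler_normB _ _))// lerD// ?HCN ?HCf.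
have mtent : measurable_fun setT (tent r).
  by apply: continuous_measurable_fun; exact: tent_continuous.
have mshift (c : rV) : measurable_fun setT (fun x : rV => x + c).
  apply: measurable_matrix => i j; under eq_fun do rewrite mxE.
  by apply: measurable_funD => //; exact: measurable_coord.
have bound m x : m \in t -> `|g x * tent r (x - m.2)| <= (CN + Cf) * r.
  move=> mt; have [xm|xm] := ltP 0 (tent r (x - m.2)).
    have [_ Ox _] := near_m m _ mt xm; rewrite addrC subrK in Ox.
    rewrite normrM ler_pM//; first exact/gK/open_cube_sub.
    by rewrite ger0_norm ?tent_ge0// tent_le// ltW.
  rewrite (_ : tent r _ = 0); last by apply/eqP; rewrite eq_le xm tent_ge0.
  have Cf0 : 0 <= Cf by apply: le_trans (HCf _ (open_cube_sub (tO m mt))).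
  rewrite mulr0 normr0; apply: mulr_ge0; last exact: ltW.
  by apply: addr_ge0 => //; exact: ltW.
have mH m : measurable_fun setT (fun x => m.1 * (g x * tent r (x - m.2)) : R).
  apply: measurable_funM => //; apply: measurable_funM => //.
  by apply: measurableT_comp => //; exact: mshift.
have intH m : m \in t -> leb.-integrable setT (EFin \o (fun x => m.1 * (g x * tent r (x - m.2)))).
  move=> mt; apply: (@integrable_cube R d a b (`|m.1| * ((CN + Cf) * r))) => // x Kx.
    by rewrite normrM ler_wpM2l// bound.
  rewrite (_ : tent r _ = 0) ?mulr0//; apply/eqP; rewrite eq_le tent_ge0 andbT leNgt.
  apply/negP => xm; have [_ Ox _] := near_m m _ mt xm; rewrite addrC subrK in Ox.
  by apply: Kx; exact: open_cube_sub.
have Rsum (h : R * rV -> rV -> R) : (forall m, m \in t -> leb.-integrable setT (EFin \o h m)) ->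
    \int[leb]_x (\sum_(m <- t) h m x) = \sum_(m <- t) \int[leb]_x h m x.
  elim: (t) => [|m u IH] uh.
    rewrite big_nil; under eq_Rintegral do rewrite big_nil.
    by rewrite /Rintegral integral0.
  rewrite big_cons; under eq_Rintegral do rewrite big_cons.
  rewrite RintegralD//; last 2 first.
  - by apply: uh; exact: mem_head.
  - have := @integrable_sum _ _ R leb setT measurableT _ u (fun i => i \in u) (fun i => EFin \o h i)
      (fun i iu => uh i (mem_behead (s := m :: u) iu)).
    congr (integrable _ _ _); apply/funext => x.
    by rewrite /= -sumEFin [in RHS]big_seq.
  by rewrite IH// => m' mu; apply: uh; rewrite inE mu orbT.
have -> : \int[leb]_x ((N k x - f x) * phi x * p x) =
    \int[leb]_z (comb t (fun y => g (y + z)) * tent r z).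
  transitivity (\int[leb]_x (\sum_(m <- t) m.1 * (g x * tent r (x - m.2)))).
    apply: eq_Rintegral => x _; rewrite -mulrA phip /comb mulr_sumr.
    by apply: eq_bigr => m _; rewrite /g; ring.
  rewrite Rsum//.
  transitivity (\sum_(m <- t) \int[leb]_z (m.1 * (g (m.2 + z) * tent r z))).
    apply: eq_bigr => m _; rewrite -(@Rintegral_translation R d m.2 _ (mH m)).
    by apply: eq_Rintegral => z _; rewrite [m.2 + z - _]addrAC subrr add0r.
  rewrite -Rsum.
    apply: eq_Rintegral => z _; rewrite /comb mulr_suml.
    by apply: eq_bigr => m _; rewrite mulrA.
  move=> m mt; apply: (@integrable_cube R d (- r) r (`|m.1| * ((CN + Cf) * r))).
  - have := mH m; move=> /measurableT_comp /(_ (mshift m.2)).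
    by apply: eq_measurable_fun => z _ /=; rewrite addrK addrC.
  - move=> z _; rewrite normrM ler_wpM2l//.
    by have := bound m (m.2 + z) mt; rewrite [m.2 + z - _]addrAC subrr add0r.
  - move=> z nz; rewrite (_ : tent r z = 0) ?mulr0//; apply/eqP; rewrite eq_le tent_ge0 andbT leNgt.
    by apply/negP => /tent_gt0 /norm_lt_cube.
pose F z := comb t (fun y => f (y + z)) * tent r z.
have iF : leb.-integrable setT (EFin \o F).
  apply: (@integrable_cube R d (- r) r ((\sum_(m <- t) `|m.1| * `|Cf|) * r)).
  - apply: measurable_funM => //; apply: measurable_sum => m.
    apply: measurable_funM => //; apply: measurableT_comp => //.
    by have := mshift m.2; congr (measurable_fun _ _); apply/funext => z; exact: addrC.
  - move=> z _; have W0 : 0 <= \sum_(m <- t) `|m.1| * `|Cf|.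
      by apply: sumr_ge0 => m _; rewrite mulr_ge0.
    have [z0|z0] := ltP 0 (tent r z); last first.
      have tz : tent r z = 0 by apply/eqP; rewrite eq_le z0 tent_ge0.
      by rewrite /F tz mulr0 normr0; apply: mulr_ge0 => //; exact: ltW.
    rewrite /F normrM ler_pM//; last by rewrite ger0_norm ?tent_ge0// tent_le// ltW.
    rewrite /comb (le_trans (ler_norm_sum _ _ _))// big_seq [leRHS]big_seq.
    apply: ler_sum => m mt; rewrite normrM ler_wpM2l//.
    have [_ Oz _] := near_m m z mt z0.
    by apply: le_trans (ler_norm _); apply: HCf; exact: open_cube_sub.
  - move=> z nz; rewrite /F (_ : tent r z = 0) ?mulr0//; apply/eqP.
    by rewrite eq_le tent_ge0 andbT leNgt; apply/negP => /tent_gt0 /norm_lt_cube.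
have lower : S / 2 * J <= \int[leb]_z F z.
  rewrite /J -RintegralZl//; apply: le_Rintegral => //.
    exact: (integrableZl measurableT (S / 2) It).
  move=> z _; have [z0|z0] := ltP 0 (tent r z).
    by rewrite ler_pM2r//; have [_ _ /ltW] := rH z (tent_gt0 z0).
  by rewrite /F (_ : tent r z = 0) ?mulr0//; apply/eqP; rewrite eq_le z0 tent_ge0.
(* The tent is supported in |z| < eps, where the network part is annihilated exactly, so only the
   part with -f remains. *)
have -> : \int[leb]_z (comb t (fun y => g (y + z)) * tent r z) = -1 * \int[leb]_z F z.
  rewrite -RintegralZl//; apply: eq_Rintegral => z _.
  have [z0|z0] := ltP 0 (tent r z); last first.
    by rewrite /F (_ : tent r z = 0) ?mulr0//; apply/eqP; rewrite eq_le z0 tent_ge0.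
  have [zeps _ _] := rH z (tent_gt0 z0).
  rewrite /F mulrA; congr (_ * _); rewrite /g.
  rewrite -combZ -[RHS]add0r -(HN z zeps) -combD; congr comb; apply/funext => y.
  by rewrite mulN1r.
have SJ : 0 < S * J by rewrite mulr_gt0.
rewrite mulN1r normrN ger0_norm; last by lra.
by move=> ?; lra.
Qed.

End point_identity.

Section normalisation.
Variables (R : realType) (d : nat).
Implicit Types l : 'rV[R]_d * R.

Definition aff_size l : R := `|l.2| + \sum_j `|l.1 ord0 j|.

(* Only the sign of a hidden neuron matters for its activation pattern, and the
   neurons of size 1 form a compact set; a zero neuron may become any neuron. *)
Definition aff_normalise l : 'rV[R]_d * R :=
  if aff_size l == 0 then (0, 1) else (aff_size l)^-1 *: l.

Lemma aff_size_ge0 l : 0 <= aff_size l.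
Proof. by rewrite addr_ge0// sumr_ge0. Qed.

Lemma aff_size0 : aff_size 0 = 0.
Proof. by rewrite /aff_size /= normr0 big1 ?addr0// => j _; rewrite mxE normr0. Qed.

Lemma aff_sizeZ k l : aff_size (k *: l) = `|k| * aff_size l.
Proof.
rewrite /aff_size /= normrM mulrDr mulr_sumr; congr (_ + _).
by apply: eq_bigr => j _; rewrite mxE normrM.
Qed.

Lemma aff_size_coord l j : `|l.1 ord0 j| <= aff_size l.
Proof.
rewrite /aff_size (bigD1 j)//= addrCA lerDl addr_ge0//.
by rewrite sumr_ge0.
Qed.

Lemma aff_size_cst l : `|l.2| <= aff_size l.
Proof. by rewrite lerDl sumr_ge0. Qed.

Lemma aff_size_eq0 l x : aff_size l = 0 -> aff l x = 0.
Proof.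
move=> l0; rewrite /aff big1 => [|j _].
  by apply/eqP; rewrite addr0 -normr_le0 -l0 aff_size_cst.
by apply/eqP; rewrite mulf_eq0 -normr_le0 -l0 aff_size_coord.
Qed.

Lemma aff_size_normalise l : aff_size (aff_normalise l) = 1.
Proof.
rewrite /aff_normalise; case: eqP => [_|/eqP l0].
  by rewrite /aff_size /= normr1 big1 ?addr0// => j _; rewrite mxE normr0.
by rewrite aff_sizeZ ger0_norm ?invr_ge0 ?aff_size_ge0// mulVf.
Qed.

(** Normalising a nonzero neuron keeps its sign; for a zero neuron the replacement (0, 1) is
    harmless because the factor [aff l x] is 0. *)
Lemma relu_normalise l x :
  Num.max (aff l x) 0 = (0 < aff (aff_normalise l) x)%R%:R * aff l x.
Proof.
rewrite /aff_normalise; case: eqP => [l0|/eqP l0].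
  by rewrite aff_size_eq0// mulr0 max_l.
have lp : 0 < (aff_size l)^-1 by rewrite invr_gt0 lt_neqAle eq_sym l0 aff_size_ge0.
rewrite affZ pmulr_rgt0//.
by have [h|h] := ltP 0 (aff l x); rewrite ?mul1r ?mul0r.
Qed.

End normalisation.

(** * Weak limits of networks of fixed width are networks *)

Section relu_limit.
Variables (R : realType) (d h : nat) (a b : R) (sigma : R -> R).
Hypothesis sigmaE : forall x, sigma x = Num.max x 0.
Local Notation rV := 'rV[R]_d.
Local Notation K := (closed_cube d a b).
Local Notation O := (open_cube d a b).
Local Notation leb := (lebesgue_rV R d).
Variables (f p : rV -> R) (theta : nat -> 'rV[R]_(param_dim d h)).
Hypotheses (mf : measurable_fun setT f) (cf : forall x, O x -> {for x, continuous f}).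
Hypothesis f_bounded : exists Cf, forall x, K x -> `|f x| <= Cf.
Hypotheses (cp : continuous p) (pO : forall x, O x -> 0 < p x).
Hypothesis vanish : forall phi : rV -> R, continuous phi -> forall e, 0 < e ->
  exists k0, forall k, (k0 <= k)%N ->
  `|\int[leb]_x ((shallow_net sigma (theta k) x - f x) * phi x * p x)| <= e.

Lemma open_cube_convex x y t : O x -> O y -> 0 <= t <= 1 -> O (x + t *: (y - x)).
Proof.
move=> Ox Oy /andP[t0 t1] i; rewrite !mxE.
have /andP[x1 x2] := Ox i; have /andP[y1 y2] := Oy i.
move: (x ord0 i) (y ord0 i) x1 x2 y1 y2 => u v u1 u2 v1 v2.
have [->|tn0] := eqVneq t 0; first by rewrite mul0r addr0 u1.
have tp : 0 < t by rewrite lt_neqAle eq_sym tn0.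
have s0 : 0 <= 1 - t by lra.
have h1 := mulr_ge0 s0 (ltW (_ : 0 < u - a)); have h2 := mulr_ge0 s0 (ltW (_ : 0 < b - u)).
have h3 : 0 < t * (v - a) by apply: mulr_gt0; lra.
have h4 : 0 < t * (b - v) by apply: mulr_gt0; lra.
have {}h1 : 0 <= (1 - t) * (u - a) by apply: h1; lra.
have {}h2 : 0 <= (1 - t) * (b - u) by apply: h2; lra.
by apply/andP; split; lra.
Qed.

(** Outgoing weights and output bias are replaced by 0: they may diverge along the sequence, and
    only the activation patterns are asked to cluster. *)
Let nparams k := pack (fun i => aff_normalise (neuron_aff i (theta k))) (fun=> 0) 0.

Lemma relu_size_continuous i : continuous (fun t : 'rV[R]_(param_dim d h) => aff_size (neuron_aff i t)).
Proof.
rewrite /aff_size /=; apply: continuous_add.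
  by move=> t; apply: continuous_comp; [exact: coord_continuous|exact: norm_continuous].
apply: continuous_sum => j; under eq_fun do rewrite mxE.
by move=> t; apply: continuous_comp; [exact: coord_continuous|exact: norm_continuous].
Qed.

(** Size 1 is a closed condition inside the cube [-1, 1], so the limit neurons have size 1 as well
    and define genuine patterns. Being approached at arbitrarily late indices replaces the
    extraction of a subsequence. *)
Lemma nparams_cluster : exists v : 'rV[R]_(param_dim d h),
  (forall i, aff_size (neuron_aff i v) = 1) /\
  forall B k0, nbhs v B -> exists2 k, (k0 <= k)%N & B (nparams k).
Proof.
pose A := closed_cube (param_dim d h) (-1) 1 `&`
  [set t : 'rV[R]_(param_dim d h) | forall i : 'I_h, aff_size (neuron_aff i t) = 1].
have cA : compact A.
  apply: compact_closedI; first exact: closed_cube_compact.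
  rewrite (_ : [set t | _] = \bigcap_(i in [set: 'I_h]) (fun t => aff_size (neuron_aff i t)) @^-1` [set 1]).
    apply: closed_bigI => i _; apply: closed_comp; last exact: closed_eq.
    by move=> t _; exact: relu_size_continuous.
  by apply/seteqP; split => t H i *; exact: H.
have VA k : A (nparams k).
  split => [i|i]; last by rewrite /nparams neuron_aff_pack aff_size_normalise.
  rewrite -ler_norml /nparams mxE.
  case: pickP => [j _|_]; first by rewrite -(aff_size_normalise (neuron_aff j (theta k))) aff_size_cst.
  case: pickP => [[j l] _|_] /=; first by rewrite -(aff_size_normalise (neuron_aff j (theta k))) aff_size_coord.
  by case: pickP => *; rewrite normr0.
have FA : (nparams @ \oo) A by exists 0%N => // k _; exact: VA.
have [v [Av cv]] := cA _ _ FA.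
exists v; split; first by case: Av.
move=> B k0 nB.
have [|t [[k k0k <-] Bk]] := cv [set nparams k | k in [set k | (k0 <= k)%N]] B _ nB.
  by exists k0 => // k /= kk; exists k.
by exists k.
Qed.

Lemma eq_comb (T : eqType) (s : seq (R * T)) (g1 g2 : T -> R) :
  (forall z, z \in s -> g1 z.2 = g2 z.2) -> comb s g1 = comb s g2.
Proof. by move=> H; rewrite /comb big_seq [RHS]big_seq; apply: eq_bigr => z /H ->. Qed.

(* By duality: point masses off the limit hyperplanes that annihilate all the
   functions 1_(aff l_i > 0) x_j annihilate small translates of the networks
   near the limit, hence also f. *)
Lemma relu_limit : exists (v : 'rV[R]_(param_dim d h)) (A : rV * R) (B : 'I_h -> rV * R),
  (forall i, neuron_aff i v != 0) /\
  forall x, O x -> (forall i, aff (neuron_aff i v) x != 0) ->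
    f x = aff A x + \sum_(i < h) (0 < aff (neuron_aff i v) x)%R%:R * aff (B i) x.
Proof.
have [v [v1 vB]] := nparams_cluster.
(* The index [ord0] stands for the constant 1 in both families, so the products [ind i * co j] span
   the affine functions and their products with the [h] indicators. *)
pose ind (i : 'I_h.+1) (x : rV) : R :=
  if unlift ord0 i is Some i' then (0 < aff (neuron_aff i' v) x)%R%:R else 1.
pose co (j : 'I_d.+1) (x : rV) : R := if unlift ord0 j is Some j' then x ord0 j' else 1.
have ind0 x : ind ord0 x = 1 by rewrite /ind unlift_none.
have indS i x : ind (lift ord0 i) x = (0 < aff (neuron_aff i v) x)%R%:R by rewrite /ind liftK.
have co0 x : co ord0 x = 1 by rewrite /co unlift_none.
have coS j x : co (lift ord0 j) x = x ord0 j by rewrite /co liftK.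
pose I := ('I_h.+1 * 'I_d.+1)%type.
pose U : set rV := [set x | O x /\ forall i, aff (neuron_aff i v) x != 0].
have [||l lE] := @span_of_annihilator R rV U I (enum {: I}) (fun ij x => ind ij.1 x * co ij.2 x) f.
- exact: enum_uniq.
- move=> s sU s0.
  have s1 i j : comb s (fun x => ind i x * co j x) = 0.
    by apply: (s0 (i, j)); rewrite mem_enum.
  (* The neighbourhood is joint in parameters and translation because the limit pattern must persist
     at all small translates of the points of [s]. *)
  have : nbhs (v, 0 : rV) [set q : 'rV[R]_(param_dim d h) * rV | forall m, m \in s -> forall i,
      (0 < aff (neuron_aff i q.1) (m.2 + q.2)) = (0 < aff (neuron_aff i v) m.2)].
    apply: (@near_all_seq _ _ _ s (fun m q => forall i,
      (0 < aff (neuron_aff i q.1) (m.2 + q.2)) = (0 < aff (neuron_aff i v) m.2))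
      (nbhs_filter (v, 0 : rV))) => m ms.
    apply: (@filter_forall _ _ _ _ (nbhs_filter (v, 0 : rV))) => i.
    have cg : continuous (fun q : 'rV[R]_(param_dim d h) * rV => aff (neuron_aff i q.1) (m.2 + q.2)).
      have c1 (q : 'rV[R]_(param_dim d h) * rV) : {for q, continuous (fun q : 'rV[R]_(param_dim d h) * rV => q.1)}.
        exact: cvg_fst.
      have c2 (q : 'rV[R]_(param_dim d h) * rV) : {for q, continuous (fun q : 'rV[R]_(param_dim d h) * rV => q.2)}.
        exact: cvg_snd.
      rewrite /aff /=; apply: continuous_add.
        by move=> q; exact: (continuous_comp (c1 q) (@coord_continuous R _ _ ord0 _ q.1)).
      apply: continuous_sum => j; under eq_fun do rewrite !mxE.
      apply: continuous_mul.
        by move=> q; exact: (continuous_comp (c1 q) (@coord_continuous R _ _ ord0 _ q.1)).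
      apply: continuous_add; first exact: continuous_cst.
      by move=> q; exact: (continuous_comp (c2 q) (@coord_continuous R _ _ ord0 _ q.2)).
    have := @sign_near R _ _ (v, 0 : rV) (cg _); rewrite /= addr0 => /(_ _).
    by apply; have [_ H] := sU m ms; exact: H.
  move=> [[B C] /= [nB nC] BC].
  move/nbhs_normP : nC => [eps /= eps0 epsC].
  apply: (@point_identity R d a b f p (fun k => shallow_net sigma (theta k)) mf cf f_bounded cp pO _ vanish s eps eps0).
  + by move=> k; exact: shallow_net_continuous.
  + by move=> m /sU[].
  + move=> k0; have [k k0k Bk] := vB B k0 nB; exists k => // z zeps.
    have sgn m i : m \in s -> (0 < aff (aff_normalise (neuron_aff i (theta k))) (m.2 + z)) =
        (0 < aff (neuron_aff i v) m.2).
      have Cz : C z by apply: epsC; rewrite /= sub0r normrN.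
      move=> ms; have := BC (nparams k, z) (conj Bk Cz) m ms i.
      by rewrite /= /nparams neuron_aff_pack.
    pose th := theta k; pose na i := neuron_aff i th.
    (* With the pattern frozen, the translated network agrees on the points of [s] with a
       combination of the products above; [z] enters only the coefficients, and each term is
       annihilated whatever its coefficient. *)
    rewrite (@eq_comb _ _ _ (fun x => th ord0 (out_bias_idx d h) * (ind ord0 x * co ord0 x) +
      \sum_(i < h) (th ord0 (out_idx d i) * aff (na i) z) * (ind (lift ord0 i) x * co ord0 x) +
      \sum_(i < h) \sum_(j < d) (th ord0 (out_idx d i) * (na i).1 ord0 j) *
         (ind (lift ord0 i) x * co (lift ord0 j) x))).
      rewrite !combD !combZ s1 mulr0 add0r !comb_sum !big1 ?addr0// => [i _|i _].
        by rewrite comb_sum big1// => j _; rewrite combZ s1 mulr0.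
      by rewrite combZ s1 mulr0.
    move=> m ms; rewrite (shallow_netE sigmaE) ind0 co0 !mulr1 -addrA; congr (_ + _).
    rewrite -big_split; apply: eq_bigr => i _ /=.
    rewrite relu_normalise sgn// indS mulr1.
    rewrite (_ : aff _ (m.2 + z) = aff (na i) z + \sum_j (na i).1 ord0 j * m.2 ord0 j).
      rewrite -/th mulrA mulrDr [X in X + _ = _]mulrAC; congr (_ + _).
      rewrite mulr_sumr; apply: eq_bigr => j _; rewrite coS /na /= !mxE; ring.
    rewrite /aff -addrA -big_split; congr (_ + _); apply: eq_bigr => j _ /=.
    by rewrite !mxE; ring.
exists v, (\row_j l (ord0, lift ord0 j), l (ord0, ord0)),
  (fun i => (\row_j l (lift ord0 i, lift ord0 j), l (lift ord0 i, ord0))); split.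
  by move=> i; apply/eqP => vi; have := v1 i; rewrite vi aff_size0 => /eqP; rewrite eq_sym oner_eq0.
move=> x Ox xv; rewrite (lE x)//= big_enum /=.
transitivity (\sum_i \sum_j l (i, j) * (ind i x * co j x)).
  by rewrite pair_bigA /=; apply: eq_big => // -[i j] _.
rewrite big_ord_recl /=.
have inner i : \sum_j l (i, j) * (ind i x * co j x) =
    ind i x * aff (\row_j l (i, lift ord0 j), l (i, ord0)) x.
  rewrite big_ord_recl /aff /= mulrDr co0 mulr1 [X in X + _]mulrC; congr (_ + _).
  by rewrite mulr_sumr; apply: eq_bigr => j _; rewrite coS mxE; ring.
rewrite inner ind0 mul1r; congr (_ + _).
by apply: eq_bigr => i _; rewrite inner indS.
Qed.

Lemma relu_limit_network : exists n (theta' : 'rV[R]_(param_dim d n)), (0 < n)%N /\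
  forall x, O x -> f x = shallow_net sigma theta' x.
Proof.
have [v [A [B [v0 fE]]]] := relu_limit.
pose r := [seq (neuron_aff i v, B i) | i <- enum 'I_h].
have [||z|x Ox rx|A' [s sE]] := @relu_representation R d O f r A _ _ cf.
- exact: open_cube_open.
- exact: open_cube_convex.
- by move=> /mapP[i _ ->] /=.
- rewrite fE//; last by move=> i; apply: (rx (neuron_aff i v, B i)); rewrite map_f// mem_enum.
  by rewrite /jumps big_map big_enum.
(* An affine function is the ReLU of itself minus the ReLU of its negative; the two extra neurons
   also make the width positive. *)
pose t := (1, A') :: (-1, - A') :: s.
exists (size t), (pack (fun i => (tnth (in_tuple t) i).2) (fun i => (tnth (in_tuple t) i).1) 0).
split => // x Ox; rewrite (shallow_net_pack sigmaE) add0r sE//.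
rewrite -(big_tnth _ _ t xpredT (fun z => z.1 * Num.max (aff z.2 x) 0)) !big_cons /= addrA; congr (_ + _).
have -> : aff (- A') x = - aff A' x.
  have -> : - A' = (-1 : R) *: A' by rewrite scaleN1r.
  by rewrite affZ mulN1r.
rewrite !mulN1r mul1r.
have [h0|h0] := leP 0 (aff A' x).
  by rewrite max_r ?oppr_le0// subr0.
by rewrite max_l ?oppr_ge0 ?ltW// sub0r opprK.
Qed.

End relu_limit.

(** * The risk of networks with a superfluous neuron *)

Section integrable_real.
Context disp (T : measurableType disp) (R : realType) (mu : {measure set T -> \bar R}).
Implicit Types g k : T -> R.

Lemma integrable_dominated g k : measurable_fun setT g ->
  (forall w, `|g w| <= `|k w|) -> mu.-integrable setT (EFin \o k) ->
  mu.-integrable setT (EFin \o g).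
Proof.
move=> mg gk; apply: le_integrable => //; first exact/measurable_EFinP.
by move=> w _; rewrite lee_fin.
Qed.

Lemma integrable_add g k : mu.-integrable setT (EFin \o g) ->
  mu.-integrable setT (EFin \o k) -> mu.-integrable setT (EFin \o (fun w => g w + k w)).
Proof. by move=> ig ik; exact: (integrableD measurableT ig ik). Qed.

Lemma integrable_scale c g : mu.-integrable setT (EFin \o g) ->
  mu.-integrable setT (EFin \o (fun w => c * g w)).
Proof. by move=> ig; exact: (integrableZl measurableT c ig). Qed.

Lemma integrable_measurable g : mu.-integrable setT (EFin \o g) -> measurable_fun setT g.
Proof. by move=> /integrableP[/measurable_EFinP]. Qed.

End integrable_real.

Section risk_gap.
Context disp (Omega : measurableType disp) (R : realType) (P : probability Omega R).
Variables (d : nat) (a b : R) (sigma : R -> R).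
Hypothesis sigmaE : forall x, sigma x = Num.max x 0.
Local Notation rV := 'rV[R]_d.
Local Notation K := (closed_cube d a b).
Local Notation O := (open_cube d a b).
Local Notation leb := (lebesgue_rV R d).
Variables (X : {RV P >-> rV}) (Y : {RV P >-> R}).
Hypothesis X_cube : forall w, K (X w).
Variables (f p : rV -> R).
Hypotheses (f_bounded : [bounded f x | x in K]) (f_measurable : measurable_fun K f)
  (f_cont : {within K, continuous f}).
Hypotheses (p_ge0 : forall x, 0 <= p x) (p_cont : continuous p)
  (p_supp : p @^-1` `]0, +oo[%classic = O).
Hypothesis X_law : forall B : set rV, measurable B -> B `<=` K ->
  P (X @^-1` B) = (\int[leb]_(x in B) (p x)%:E)%E.
Hypothesis EYX : cond_exp_eq P Y X (fun w => f (X w)).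
Variables (h : nat) (LL : 'rV[R]_(param_dim d h) -> R).
Hypothesis LLE : forall theta, (LL theta)%:E =
  ('E_P[fun w => (`|shallow_net sigma theta (X w) - Y w| ^+ 2)%R])%E.
Hypothesis not_attained : forall n (theta : 'rV[R]_(param_dim d n)), (0 < n)%N ->
  ('E_P[fun w => (`|shallow_net sigma theta (X w) - Y w| ^+ 2)%R] <>
   'E_P[fun w => (`|f (X w) - Y w| ^+ 2)%R])%E.

(** Extension by 0 turns measurability on the cube into measurability on the whole space, while
    continuity survives at the points of the open cube. *)
Let ft : rV -> R := f \_ K.

Let ftE x : K x -> ft x = f x.
Proof. by move=> Kx; rewrite /ft patchE mem_set. Qed.

Let mft : measurable_fun setT ft.
Proof.
have mK : measurable K by exact: closed_cube_measurable.
by have := (measurable_restrictT f mK).1 f_measurable.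
Qed.

Let ft_bounded : exists Cf, forall x, K x -> `|ft x| <= Cf.
Proof.
have [M [_ HM]] := f_bounded; exists (`|M| + 1) => x Kx.
rewrite ftE//; apply: HM => //.
by rewrite (le_lt_trans (ler_norm _))// ltrDl.
Qed.

Let cft x : O x -> {for x, continuous ft}.
Proof.
move=> Ox; have Kx : K x by exact: open_cube_sub Ox.
have fx : f @ within K (nbhs x) --> f x.
  by have /subspace_continuousP := f_cont; apply.
move=> A; rewrite /= ftE// => /fx nA.
have nO : nbhs x O by apply: open_nbhs_nbhs; split => //; exact: open_cube_open.
have H : \forall y \near x, A (ft y).
  apply: filterS2 nO nA => y Oy Ay; have Ky : K y by exact: open_cube_sub Oy.
  by rewrite ftE//; exact: Ay.
exact: H.
Qed.

Let pO x : O x -> 0 < p x.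
Proof. by rewrite -p_supp /= in_itv /= andbT. Qed.

Let p_off x : ~ O x -> p x = 0.
Proof.
move=> nO; apply/eqP; rewrite eq_le p_ge0 andbT leNgt; apply/negP => px; apply: nO.
by rewrite -p_supp /= in_itv /= px.
Qed.

Let mX : measurable_fun setT X. Proof. exact: measurable_funPT. Qed.
Let mY : measurable_fun setT Y. Proof. exact: measurable_funPT. Qed.
Let mp : measurable_fun setT p. Proof. exact: continuous_measurable_fun. Qed.

(** [X] takes its values in the cube and [p] vanishes off the open cube, so the density formula
    extends from Borel subsets of the cube to all Borel sets. *)
Let law B : measurable B -> P (X @^-1` B) = (\int[leb]_(x in B) (p x)%:E)%E.
Proof.
move=> mB; rewrite (_ : X @^-1` B = X @^-1` (B `&` K)); last first.
  by apply/seteqP; split => w /= => [Bw|[]//]; split.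
rewrite X_law; last 2 first.
- by apply: measurableI => //; exact: closed_cube_measurable.
- by move=> x [].
rewrite integral_mkcond [RHS]integral_mkcond; apply: eq_integral => x _.
rewrite !patchE; case: ifPn => [/set_mem[Bx Kx]|/negP nBK]; first by rewrite mem_set.
case: ifPn => // /set_mem Bx; rewrite p_off// => /open_cube_sub Kx; apply: nBK.
by rewrite inE.
Qed.

Let X_open : {ae P, forall w, O (X w)}.
Proof.
have mO : measurable O by apply: sub_sigma_algebra; exact: open_cube_open.
exists (X @^-1` (~` O)); split.
- by rewrite -[X in measurable X]setTI; apply: mX => //; exact: measurableC.
- rewrite law; last exact: measurableC.
  by apply: integral0_eq => x Ox; rewrite p_off.
- by move=> w /=.
Qed.

Let r (theta : 'rV[R]_(param_dim d h)) w := shallow_net sigma theta (X w) - Y w.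

Let mphi (phi : rV -> R) : continuous phi -> measurable_fun setT (fun w => phi (X w)).
Proof. by move=> cphi; apply: measurableT_comp => //; exact: continuous_measurable_fun. Qed.

Let mr theta : measurable_fun setT (r theta).
Proof.
by apply: measurable_funB => //; apply: mphi; exact: shallow_net_continuous.
Qed.

Let LLr2 theta : (LL theta)%:E = (\int[P]_w ((r theta w) ^+ 2)%:E)%E.
Proof.
rewrite LLE unlock; apply: eq_integral => w _; congr EFin.
by rewrite /= real_normK// num_real.
Qed.

(** Finiteness of the second moment is contained in [LLE], which equates it with a real number. *)
Let ir2 theta : P.-integrable setT (EFin \o (fun w => r theta w ^+ 2)).
Proof.
apply/integrableP; split; first by apply/measurable_EFinP; exact: measurable_funX.
under eq_integral do rewrite gee0_abs ?lee_fin ?sqr_ge0//.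
by rewrite -LLr2 ltry.
Qed.

Let LLr theta : LL theta = \int[P]_w (r theta w ^+ 2).
Proof. by rewrite /Rintegral -LLr2. Qed.

Let icst (c : R) : P.-integrable setT (EFin \o (fun _ : Omega => c)).
Proof. exact: finite_measure_integrable_cst. Qed.

Let ir theta : P.-integrable setT (EFin \o r theta).
Proof.
apply: (integrable_dominated _ _ (integrable_add (icst 1) (ir2 theta))) => // w.
rewrite [leRHS]ger0_norm; last by rewrite addr_ge0// sqr_ge0.
have := sqr_ge0 (`|r theta w| - 1); rewrite -(real_normK (num_real (r theta w))) => H.
have := normr_ge0 (r theta w); move: H; rewrite sqrrB1; nra.
Qed.

Let iphi (g : Omega -> R) (phi : rV -> R) : P.-integrable setT (EFin \o g) ->
  continuous phi -> P.-integrable setT (EFin \o (fun w => g w * phi (X w))).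
Proof.
move=> ig cphi; have [B B0 HB] := @continuous_bounded_on_cube R d a b phi cphi.
apply: (integrable_dominated _ _ (integrable_scale B ig)).
  by apply: measurable_funM; [exact: integrable_measurable ig|exact: mphi].
by move=> w; rewrite !normrM mulrC ler_wpM2r// (le_trans (HB _ (X_cube w)))// ler_norm.
Qed.

Let norm1_bound theta : \int[P]_w `|r theta w| <= 1 + LL theta.
Proof.
have I1 : \int[P]_w (1 : R) = 1.
  rewrite /Rintegral (_ : (\int[P]_w 1%:E)%E = 1%E)//.
  by rewrite integral_cst//= mul1e; exact: probability_setT.
rewrite LLr -[X in X + _]I1 -(RintegralD measurableT (icst 1) (ir2 theta)).
apply: le_Rintegral => //.
- by apply: (integrable_dominated _ _ (ir theta)) => [|w]; [exact: measurableT_comp|rewrite normr_id].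
- exact: (integrable_add (icst 1) (ir2 theta)).
move=> w _; rewrite -(real_normK (num_real (r theta w))).
have := sqr_ge0 (`|r theta w| - 1); have := normr_ge0 (r theta w); rewrite sqrrB1; nra.
Qed.

Section perturbation.
Variable i : 'I_h.

Let LL_ge0 theta : 0 <= LL theta.
Proof. by rewrite LLr; apply: Rintegral_ge0 => w _; exact: sqr_ge0. Qed.

Let infLL := inf (range LL).

Let inf_le theta : infLL <= LL theta.
Proof.
apply: ge_inf; last by exists theta.
by exists 0 => _ [t _ <-]; exact: LL_ge0.
Qed.

Let set_neuron theta l t : 'rV[R]_(param_dim d h) :=
  pack (fun k => if k == i then l else neuron_aff k theta)
    (fun k => if k == i then t else theta ord0 (out_idx d k)) (theta ord0 (out_bias_idx d h)).

Let set_neuronE (theta : 'rV[R]_(param_dim d h)) l t x : theta ord0 (out_idx d i) = 0 ->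
  shallow_net sigma (set_neuron theta l t) x =
  shallow_net sigma theta x + t * Num.max (aff l x) 0.
Proof.
move=> t0; rewrite (shallow_net_pack sigmaE) (shallow_netE sigmaE) -addrA; congr (_ + _).
rewrite (bigD1 i)//= [in RHS](bigD1 i)//= eqxx t0 mul0r add0r addrC; congr (_ + _).
by apply: eq_bigr => k /negbTE ->.
Qed.

Let perturbed (theta : 'rV[R]_(param_dim d h)) l t : theta ord0 (out_idx d i) = 0 ->
  let s w := Num.max (aff l (X w)) 0 in
  LL (set_neuron theta l t) = LL theta + (2 * t) * \int[P]_w (r theta w * s w) +
    t ^+ 2 * \int[P]_w (s w * s w).
Proof.
move=> t0 s.
have cs : continuous (fun x : rV => Num.max (aff l x) 0).
  by apply: continuous_max_cst; exact: aff_continuous.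
have is_ : P.-integrable setT (EFin \o s).
  have := iphi (icst 1) cs; congr (integrable _ _ _); apply/funext => w.
  by rewrite /= mul1r.
have irs : P.-integrable setT (EFin \o (fun w => r theta w * s w)) := iphi (ir theta) cs.
have iss : P.-integrable setT (EFin \o (fun w => s w * s w)) := iphi is_ cs.
rewrite !LLr -RintegralZl// -[X in _ + X]RintegralZl// -RintegralD//; last first.
  exact: integrable_scale.
rewrite -RintegralD//; last 2 first.
- by apply: (integrable_add (ir2 theta)); exact: integrable_scale.
- exact: integrable_scale.
apply: eq_Rintegral => w _; rewrite /r set_neuronE//.
by rewrite -/(s w); ring.
Qed.

(* A neuron with outgoing weight 0 can be replaced for free; perturbing its
   outgoing weight then shows that the residual of a near-minimiser is almost
   orthogonal to every ReLU ridge function. *)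
Let small (phi : rV -> R) := continuous phi /\ forall e, 0 < e -> exists2 e', 0 < e' &
  forall theta : 'rV[R]_(param_dim d h), theta ord0 (out_idx d i) = 0 -> LL theta < infLL + e' ->
    `|\int[P]_w (r theta w * phi (X w))| <= e.

Let small_relu l : small (fun x => Num.max (aff l x) 0).
Proof.
have cs : continuous (fun x : rV => Num.max (aff l x) 0).
  by apply: continuous_max_cst; exact: aff_continuous.
split => // e e0; pose s w := Num.max (aff l (X w)) 0.
(* With c the correlation of residual and ReLU, the risk at outgoing weight t is at most LL + 2tc +
   t^2 V, which is LL - c^2/V at t = -c/V. It cannot fall below the infimum, so being within e^2/V
   of it forces |c| <= e. Adding 1 keeps V positive. *)
pose V := \int[P]_w (s w * s w) + 1.
have V1 : 1 <= V.
  by rewrite lerDr; apply: Rintegral_ge0 => w _; rewrite -expr2 sqr_ge0.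
have V0 : 0 < V by exact: lt_le_trans V1.
exists (e ^+ 2 / V); first by rewrite divr_gt0// exprn_gt0.
move=> theta t0 LLt; set c := \int[P]_w _.
have := inf_le (set_neuron theta l (- c / V)); rewrite perturbed// -/s -/c.
have : (- c / V) ^+ 2 * \int[P]_w (s w * s w) <= (- c / V) ^+ 2 * V.
  by rewrite ler_wpM2l ?sqr_ge0// /V lerDl.
have -> : (- c / V) ^+ 2 * V = c ^+ 2 / V by field; rewrite gt_eqF.
have -> : 2 * (- c / V) * c = - 2 * (c ^+ 2 / V) by ring.
move=> h1 h2; have : c ^+ 2 / V < e ^+ 2 / V by lra.
rewrite ltr_pM2r ?invr_gt0// => ce.
by rewrite -ler_sqr ?nnegrE// ?ltW// real_normK ?num_real// ltW.
Qed.

Let small_class : uniform_class a b small.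
Proof.
split.
- by move=> phi [].
- move=> phi psi [cphi Hphi] [cpsi Hpsi]; split; first exact: continuous_add.
  move=> e e0; have [|e1 e10 H1] := Hphi (e / 2); first by rewrite divr_gt0.
  have [|e2' e20 H2] := Hpsi (e / 2); first by rewrite divr_gt0.
  exists (Num.min e1 e2'); first by rewrite lt_min e10.
  move=> theta t0 LLt; have := H1 theta t0; have := H2 theta t0.
  rewrite (lt_le_trans LLt) ?lerD2l ?ge_min ?lexx ?orbT// => /(_ isT) h2.
  rewrite (lt_le_trans LLt) ?lerD2l ?ge_min ?lexx ?orbT// => /(_ isT) h1.
  have -> : \int[P]_w (r theta w * (phi (X w) + psi (X w))) =
      \int[P]_w (r theta w * phi (X w)) + \int[P]_w (r theta w * psi (X w)).
    rewrite -RintegralD//; [|exact: iphi|exact: iphi].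
    by apply: eq_Rintegral => w _; rewrite mulrDr.
  by rewrite (le_trans (ler_normD _ _))//; lra.
- move=> k phi [cphi Hphi]; split.
    by apply: continuous_mul => //; exact: continuous_cst.
  move=> e e0; have [|e1 e10 H1] := Hphi (e / (`|k| + 1)).
    by rewrite divr_gt0// ltr_pwDr.
  exists e1 => // theta t0 /(H1 theta t0) h1.
  have -> : \int[P]_w (r theta w * (k * phi (X w))) = k * \int[P]_w (r theta w * phi (X w)).
    by rewrite -RintegralZl//; [apply: eq_Rintegral => w _; ring|exact: iphi].
  rewrite normrM (@le_trans _ _ (`|k| * (e / (`|k| + 1))))//; first by rewrite ler_wpM2l.
  have k1 : 0 < `|k| + 1 by rewrite ltr_pwDr.
  rewrite mulrA ler_pdivrMr// mulrC; apply: ler_wpM2l; first exact: ltW.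
  by rewrite lerDl.
- move=> phi cphi H; split => // e e0.
  (* Within 1 of the infimum, E|r| <= 1 + LL < C, which turns uniform closeness of test functions
     into closeness of the integrals. *)
  pose C := 2 + infLL.
  have C0 : 0 < C.
    rewrite /C ltr_pwDl//; apply: lb_le_inf; first by exists (LL 0), 0.
    by move=> _ [t _ <-]; exact: LL_ge0.
  have [|psi [cpsi Hpsi] close] := H (e / 2 / C); first by rewrite !divr_gt0.
  have [|e1 e10 H1] := Hpsi (e / 2); first by rewrite divr_gt0.
  exists (Num.min 1 e1); first by rewrite lt_min ltr01.
  move=> theta t0 LLt; have := H1 theta t0.
  rewrite (lt_le_trans LLt) ?lerD2l ?ge_min ?lexx ?orbT// => /(_ isT) h1.
  have LL1 : LL theta < infLL + 1.
    by rewrite (lt_le_trans LLt)// lerD2l ge_min lexx.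
  have cd : continuous (fun x => phi x + -1 * psi x).
    by apply: continuous_add => //; apply: continuous_mul => //; exact: continuous_cst.
  have -> : \int[P]_w (r theta w * phi (X w)) = \int[P]_w (r theta w * psi (X w)) +
     \int[P]_w (r theta w * (phi (X w) + -1 * psi (X w))).
    rewrite -RintegralD//; [|exact: iphi|exact: (iphi (ir theta) cd)].
    by apply: eq_Rintegral => w _; ring.
  rewrite (le_trans (ler_normD _ _))//.
  suff : `|\int[P]_w (r theta w * (phi (X w) + -1 * psi (X w)))| <= e / 2 by lra.
  rewrite (le_trans (le_normr_Rintegral _ _))//; first exact: (iphi (ir theta) cd).
  have iabs : P.-integrable setT (EFin \o (fun w => `|r theta w|)).
    by apply: (integrable_dominated _ _ (ir theta)) => [|w]; [exact: measurableT_comp|rewrite normr_id].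
  apply: (@le_trans _ _ (\int[P]_w (e / 2 / C * `|r theta w|))).
    apply: le_Rintegral => //.
    + apply: (integrable_dominated _ _ (iphi (ir theta) cd)) => [|w]; last by rewrite normr_id.
      by apply: measurableT_comp => //; exact: (integrable_measurable (iphi (ir theta) cd)).
    + exact: integrable_scale.
    move=> w _; rewrite normrM mulrC ler_wpM2r// mulN1r.
    exact: close.
  rewrite RintegralZl// -[leRHS](divfK (lt0r_neq0 C0)) ler_wpM2l//.
    by rewrite !divr_ge0// ltW.
  by rewrite (le_trans (norm1_bound theta))// /C; lra.
Qed.

Let small_continuous phi : continuous phi -> small phi.
Proof. exact: (relu_dense small_class small_relu). Qed.

(** The difference D = Y - Z integrates to 0 over every event that X lies in B, so its positive and
    negative parts induce the same measure under X; transfer gives E[D phi(X)] = 0, and Z is almost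
    surely f(X). *)
Let cond_exp_continuous phi : continuous phi ->
  P.-integrable setT (EFin \o Y) /\
  \int[P]_w (Y w * phi (X w)) = \int[P]_w (ft (X w) * phi (X w)) /\
  P.-integrable setT (EFin \o (fun w => ft (X w))).
Proof.
move=> cphi; have [Z [iY iZ _ ZY] Zf] := EYX.
pose D w := Y w - Z w.
have mZ : measurable_fun setT Z by exact: integrable_measurable iZ.
have mD : measurable_fun setT D by exact: measurable_funB.
have iD : P.-integrable setT (EFin \o D).
  have := integrable_add iY (integrable_scale (-1) iZ); congr (integrable _ _ _).
  by apply/funext => w; rewrite /= /D mulN1r.
pose Dp w := Num.max (D w) 0; pose Dn w := Num.max (- D w) 0.
have mDp : measurable_fun setT Dp by apply: measurable_maxr.
have mDn : measurable_fun setT Dn.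
  by apply: measurable_maxr => //; exact: measurableT_comp.
have Dp0 w : 0 <= Dp w by rewrite /Dp le_max lexx orbT.
have Dn0 w : 0 <= Dn w by rewrite /Dn le_max lexx orbT.
have DE w : D w = Dp w - Dn w.
  rewrite /Dp /Dn; have [h0|h0] := leP 0 (D w).
    by rewrite [X in _ = _ - X]max_r ?oppr_le0// subr0.
  by rewrite max_l ?oppr_ge0 ?ltW// sub0r opprK.
have iDp : P.-integrable setT (EFin \o Dp).
  apply: (integrable_dominated _ _ iD) => // w; rewrite /Dp.
  by have [h0|h0] := leP 0 (D w); rewrite ?normr0.
have iDn : P.-integrable setT (EFin \o Dn).
  apply: (integrable_dominated _ _ iD) => // w; rewrite /Dn.
  by have [h0|h0] := leP 0 (- D w); rewrite ?normr0 ?normrN.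
have pn B : measurable B -> (\int[P]_(w in X @^-1` B) (Dp w)%:E = \int[P]_(w in X @^-1` B) (Dn w)%:E)%E.
  move=> mB; have mA : measurable (X @^-1` B) by rewrite -[A in measurable A]setTI; exact: mX.
  have sub g : P.-integrable setT (EFin \o g) -> P.-integrable (X @^-1` B) (EFin \o g).
    by move=> ig; apply: (integrableS measurableT mA (@subsetT _ _) ig).
  have YZ0 : (\int[P]_(w in X @^-1` B) (D w)%:E = 0)%E.
    under eq_integral do rewrite EFinB.
    rewrite integralB_EFin//; [|exact: sub|exact: sub].
    rewrite ZY; last by exists B => //; rewrite setTI.
    by rewrite subee//; apply: integrable_fin_num => //; exact: sub.
  have : (\int[P]_(w in X @^-1` B) (D w)%:E =
     \int[P]_(w in X @^-1` B) (Dp w)%:E - \int[P]_(w in X @^-1` B) (Dn w)%:E)%E.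
    rewrite -integralB_EFin//; [|exact: sub|exact: sub].
    by apply: eq_integral => w _; rewrite -EFinB -DE.
  rewrite YZ0 => /esym/eqP; rewrite sube_eq ?add0e; first by move=> /eqP.
    by apply: integrable_fin_num => //; exact: sub.
  by rewrite fin_num_adde_defr.
have mphi0 : measurable_fun setT phi by exact: continuous_measurable_fun.
have E1 := @integral_density_transfer _ _ R _ _ _ _ P P X X Dp Dn mX mX mDp mDn Dp0 Dn0 pn phi mphi0.
have E2 : \int[P]_w (D w * phi (X w)) = 0.
  transitivity (\int[P]_w (Dp w * phi (X w)) + -1 * \int[P]_w (Dn w * phi (X w))).
    rewrite -RintegralZl//; last exact: iphi.
    rewrite -RintegralD//; last 2 first.
    - exact: iphi.
    - exact: (integrable_scale (-1) (iphi iDn cphi)).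
    by apply: eq_Rintegral => w _; rewrite DE; ring.
  rewrite (_ : \int[P]_w (Dp w * phi (X w)) = \int[P]_w (Dn w * phi (X w))); first by ring.
  rewrite /Rintegral; congr fine; move: E1.
  by under eq_integral do rewrite mulrC; under [in X in _ = X -> _]eq_integral do rewrite mulrC.
have mfX : measurable_fun setT (fun w => ft (X w)) by exact: measurableT_comp.
have Zft : ae_eq P setT (EFin \o Z) (EFin \o (fun w => ft (X w))).
  by apply: filterS Zf => w Zw _; rewrite /= ftE// Zw.
split; first exact: iY; split.
  have -> : \int[P]_w (Y w * phi (X w)) = \int[P]_w (D w * phi (X w)) + \int[P]_w (Z w * phi (X w)).
    rewrite -RintegralD//; [|exact: iphi|exact: iphi].
    by apply: eq_Rintegral => w _; rewrite /D; ring.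
  rewrite E2 add0r /Rintegral; congr fine; apply: ae_eq_integral => //.
  - by apply/measurable_EFinP; apply: measurable_funM => //; exact: mphi.
  - by apply/measurable_EFinP; apply: measurable_funM => //; exact: mphi.
  by apply: filterS Zft => w Zw /Zw [/= ->].
have [Cf HCf] := ft_bounded.
apply: (integrable_dominated _ _ (icst Cf)) => // w.
by rewrite (le_trans (HCf _ (X_cube w)))// ler_norm.
Qed.

(** Turns near-orthogonality of the residual into a weak statement about N - f: Y is replaced by
    f(X) through the conditional expectation, then the law of X by its density. *)
Let residual_law theta phi : continuous phi ->
  \int[P]_w (r theta w * phi (X w)) =
  \int[leb]_x ((shallow_net sigma theta x - ft x) * phi x * p x).
Proof.
move=> cphi; have [iY [YE iF]] := cond_exp_continuous cphi.
have cN : continuous (shallow_net sigma theta) by exact: shallow_net_continuous.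
have iN : P.-integrable setT (EFin \o (fun w => shallow_net sigma theta (X w))).
  have := iphi (icst 1) cN; congr (integrable _ _ _); apply/funext => w.
  by rewrite /= mul1r.
transitivity (\int[P]_w (shallow_net sigma theta (X w) * phi (X w)) + -1 * \int[P]_w (Y w * phi (X w))).
  rewrite -RintegralZl//; last exact: iphi.
  rewrite -RintegralD//; [|exact: iphi|exact: (integrable_scale (-1) (iphi iY cphi))].
  by apply: eq_Rintegral => w _; rewrite /r; ring.
rewrite YE -RintegralZl//; last exact: (iphi iF cphi).
rewrite -RintegralD//; [|exact: iphi|exact: (integrable_scale (-1) (iphi iF cphi))].
have mg : measurable_fun setT (fun x => (shallow_net sigma theta x - ft x) * phi x).
  apply: measurable_funM; last exact: continuous_measurable_fun.
  by apply: measurable_funB => //; exact: continuous_measurable_fun.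
have mass B : measurable B -> (\int[P]_(w in X @^-1` B) (cst 1%R w)%:E = \int[leb]_(x in id @^-1` B) (p x)%:E)%E.
  move=> mB; have mA : measurable (X @^-1` B) by rewrite -[A in measurable A]setTI; exact: mX.
  transitivity (\int[P]_(w in X @^-1` B) cst 1%E w)%E; first by [].
  by rewrite integral_cst// mul1e; exact: law.
have := @integral_density_transfer _ _ R _ _ _ _ P leb X id (cst 1) p mX
  (@measurable_id _ _ setT) (@measurable_cst _ _ _ _ _ _) mp (fun=> ler01) p_ge0 mass _ mg.
move=> E; rewrite /Rintegral; congr fine; rewrite -[RHS]E; apply: eq_integral => w _.
by congr EFin; rewrite /=; ring.
Qed.

Lemma risk_gap : exists2 e, 0 < e &
  forall theta : 'rV[R]_(param_dim d h), theta ord0 (out_idx d i) = 0 -> infLL + e <= LL theta.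
Proof.
apply: contrapT => nogap.
have ex k : exists theta : 'rV[R]_(param_dim d h), theta ord0 (out_idx d i) = 0 /\ LL theta < infLL + k.+1%:R^-1.
  apply: contrapT => H; apply: nogap; exists k.+1%:R^-1; first by rewrite invr_gt0.
  move=> theta t0; rewrite leNgt; apply/negP => Lt; apply: H; exists theta.
  by split.
have [theta thetaP] := choice ex.
have vanish (phi : rV -> R) : continuous phi -> forall e, 0 < e -> exists k0, forall k, (k0 <= k)%N ->
    `|\int[leb]_x ((shallow_net sigma (theta k) x - ft x) * phi x * p x)| <= e.
  move=> cphi e e0; have [_ /(_ e e0)[e' e'0 H]] := small_continuous cphi.
  have [k0 _ k0H] := near_infty_natSinv_lt (PosNum e'0).
  exists k0 => k k0k; have [t0 Lt] := thetaP k.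
  rewrite -residual_law//; apply: H => //.
  by rewrite (lt_trans Lt)// ltrD2l; exact: k0H.
have [n [theta' [n0 netE]]] := @relu_limit_network R d h a b sigma sigmaE ft p theta mft cft ft_bounded p_cont pO vanish.
apply: (@not_attained n theta' n0); rewrite unlock; apply: ae_eq_integral => //.
- apply/measurable_EFinP; apply: measurable_funX; apply: measurableT_comp => //.
  by apply: measurable_funB => //; apply: mphi; exact: shallow_net_continuous.
- apply/measurable_EFinP; apply: measurable_funX; apply: measurableT_comp => //.
  apply: measurable_funB => //; rewrite (_ : (fun w => f (X w)) = (fun w => ft (X w))).
    exact: measurableT_comp.
  by apply/funext => w; rewrite ftE.
(* The network and [f] are known to agree on the open cube, where X lies almost surely. *)
apply: filterS X_open => w Ow _; rewrite -netE// ftE//.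
Qed.

End perturbation.

End risk_gap.

Lemma limn_einf_ge (R : realType) (u : (\bar R)^nat) l : (forall n, (l <= u n)%E) ->
  (l <= limn_einf u)%E.
Proof.
move=> lu; rewrite limn_einf_lim; apply: lime_ge; first exact: is_cvg_einfs.
by apply: nearW => n; apply: le_ereal_inf_tmp => _ [k _ <-]; exact: lu.
Qed.

(** * Measurability of the risk, and its value at a dead neuron *)

Section population_risk.
Context disp (Omega : measurableType disp) (R : realType) (P : probability Omega R).
Variables (d h : nat) (a b : R) (sigma : R -> R).
Hypothesis sigmaE : forall x, sigma x = Num.max x 0.
Variables (X : {RV P >-> 'rV[R]_d}) (Y : {RV P >-> R}).
Variable LL : 'rV[R]_(param_dim d h) -> R.
Hypothesis LLE : forall theta, (LL theta)%:E =
  ('E_P[fun w => (`|shallow_net sigma theta (X w) - Y w| ^+ 2)%R])%E.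

(** Tonelli on parameters times [Omega]: the risk is a partial integral of a jointly measurable
    nonnegative function. The event of the theorem is measurable through this. *)
Lemma measurable_population_risk : measurable_fun setT LL.
Proof.
have mX : measurable_fun setT X by exact: measurable_funPT.
have mY : measurable_fun setT Y by exact: measurable_funPT.
have msigma : measurable_fun setT sigma.
  by rewrite (_ : sigma = fun x => Num.max x 0); [exact: measurable_maxr|exact/funext].
apply/measurable_EFinP.
have mth k : measurable_fun setT (fun z : 'rV[R]_(param_dim d h) * Omega => z.1 ord0 k).
  exact: measurableT_comp (@measurable_coord R _ _ ord0 k) (@measurable_fst _ _ _ _).
have mXj j : measurable_fun setT (fun z : 'rV[R]_(param_dim d h) * Omega => X z.2 ord0 j).
  apply: (measurableT_comp (@measurable_coord R _ _ ord0 j)).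
  exact: measurableT_comp.
have mF : measurable_fun setT (fun z : 'rV[R]_(param_dim d h) * Omega =>
    (`|shallow_net sigma z.1 (X z.2) - Y z.2| ^+ 2)%:E).
  apply/measurable_EFinP; apply: measurable_funX; apply: measurableT_comp => //.
  apply: measurable_funB; last exact: measurableT_comp.
  apply: measurable_funD => //; apply: measurable_sum => i; apply: measurable_funM => //.
  apply: measurableT_comp => //; apply: measurable_funD => //.
  by apply: measurable_sum => j; exact: measurable_funM.
have mI := @measurable_fun_fubini_tonelli_F _ _ _ _ _ P _ mF.
rewrite (_ : EFin \o LL = fubini_F P (fun z : 'rV[R]_(param_dim d h) * Omega =>
    (`|shallow_net sigma z.1 (X z.2) - Y z.2| ^+ 2)%:E)).
  by apply: mI => z; rewrite lee_fin sqr_ge0.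
by apply/funext => theta; rewrite /= LLE unlock.
Qed.

Hypothesis X_cube : forall w, closed_cube d a b (X w).

(** A dead neuron outputs 0 on the cube, so its outgoing weight can be set to 0 at no cost. The risk
    gap then applies although the actual outgoing weight may keep moving during training. *)
Lemma population_risk_dead (i : 'I_h) (theta : 'rV[R]_(param_dim d h)) :
  (forall z, closed_cube d a b z -> aff (neuron_aff i theta) z < 0) ->
  exists2 theta' : 'rV[R]_(param_dim d h), theta' ord0 (out_idx d i) = 0 & LL theta = LL theta'.
Proof.
move=> dead; exists (pack (fun k => neuron_aff k theta)
    (fun k => if k == i then 0 else theta ord0 (out_idx d k)) (theta ord0 (out_bias_idx d h))).
  by rewrite pack_out eqxx.
apply/eqP; rewrite -eqe !LLE; apply/eqP; congr expectation; apply/funext => w.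
rewrite (shallow_net_pack sigmaE) (shallow_netE sigmaE); congr (`|_ + _ - _| ^+ 2).
apply: eq_bigr => k _; case: eqP => // ->.
by rewrite max_r ?mulr0// ltW//; exact: dead.
Qed.

End population_risk.
(* A measure on the Borel sets of the cube [a, b]^d is given as a measure on
   the Borel sets of R^d of which only the restriction to the cube is used; in
   the same way only the values of f on the cube are used. *)
Theorem corollary4p6 (R : realType)
  (d : nat) (d_gt0 : (0 < d)%N)
  (a b : R) (ab : a <= b)
  (mu : {measure set 'rV[R]_d -> \bar R})
  (f : 'rV[R]_d -> R)
  (f_bounded : [bounded f x | x in closed_cube d a b])
  (f_measurable : measurable_fun (closed_cube d a b) f)
  (sigma : R -> R) (sigmaE : forall x, sigma x = Num.max x 0)
  (risk_real : forall h (theta : 'rV[R]_(param_dim d h)),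
    risk sigma a b mu f theta \is a fin_num)
  (disp : measure_display) (Omega : measurableType disp)
  (P : probability Omega R)
  (X : forall n m : nat, {RV P >-> 'rV[R]_d})
  (X_cube : forall n m w, closed_cube d a b (X n m w))
  (Y : forall n m : nat, {RV P >-> R})
  (M : forall n h : nat, nat) (M_gt0 : forall n h, (0 < M n h)%N)
  (EL : forall n h : nat, 'rV[R]_(param_dim d h) -> Omega -> R)
  (ELE : forall n h theta w, EL n h theta w =
    empirical_risk sigma (M n h) (fun m => X n m w) (fun m => Y n m w) theta)
  (G : forall n h : nat,
    'rV[R]_(param_dim d h) -> Omega -> 'rV[R]_(param_dim d h))
  (GE : forall n h (i : 'I_h) (k : 'I_(param_dim d h)) theta w,
    neuron_idx i k ->
    differentiable (fun psi : 'rV[R]_d.+1 => EL n h (neuron_subst i theta psi) w)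
      (neuron_params i theta) ->
    G n h theta w ord0 k = 'D_(delta_mx ord0 k) (EL n h ^~ w) theta)
  (Theta : forall n h : nat, {RV P >-> 'rV[R]_(param_dim d h)})
  (Phi : forall n h : nat,
    ('I_n.+1 -> 'rV[R]_(param_dim d h)) -> 'rV[R]_(param_dim d h))
  (Phi0 : forall n h (g : 'I_n.+1 -> 'rV[R]_(param_dim d h)) k,
    \sum_(i < n.+1) `|g i ord0 k| = 0 -> Phi n h g ord0 k = 0)
  (ThetaS : forall n h w, Theta n.+1 h w =
    Theta n h w - Phi n h (fun i : 'I_n.+1 => G i h (Theta i h w) w))
  (LL : forall h : nat, 'rV[R]_(param_dim d h) -> R)
  (LLE : forall h (theta : 'rV[R]_(param_dim d h)), (0 < h)%N ->
    (LL h theta)%:E =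
    ('E_P[fun w =>
      (`|shallow_net sigma theta (X 0%N 0%N w) - Y 0%N 0%N w| ^+ 2)%R])%E)
  (f_cont : {within closed_cube d a b, continuous f})
  (EYX : cond_exp_eq P (Y 0%N 0%N) (X 0%N 0%N) (fun w => f (X 0%N 0%N w)))
  (p : 'rV[R]_d -> R) (p_ge0 : forall x, 0 <= p x) (p_cont : continuous p)
  (p_supp : p @^-1` `]0, +oo[%classic = open_cube d a b)
  (X_law : forall B : set 'rV[R]_d, measurable B -> B `<=` closed_cube d a b ->
    P (X 0%N 0%N @^-1` B) = mu B /\
    mu B = (\int[lebesgue_rV R d]_(x in B) (p x)%:E)%E)
  (Theta0_indep : forall h, (0 < h)%N ->
    mutual_independence P
      (fun (i : 'I_(h * d + h)) w => Theta 0%N h w ord0 (hidden_idx i)))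
  (q : R -> R) (q_ge0 : forall y, 0 <= q y) (q_measurable : measurable_fun setT q)
  (eta : R) (eta_gt0 : 0 < eta)
  (q_supp : `]- eta, eta[%classic `<=` q @^-1` `]0, +oo[%classic)
  (kappa : R)
  (Theta0_law : forall h (i : 'I_(h * d + h)) (x : R), (0 < h)%N ->
    P [set w | h%:R `^ kappa * Theta 0%N h w ord0 (hidden_idx i) < x] =
    (\int[lebesgue_measure]_(y in `]-oo, x[) (q y)%:E)%E)
  (not_attained : forall h, (0 < h)%N ->
    ~ range (fun theta => (LL h theta)%:E)
        ('E_P[fun w => (`|f (X 0%N 0%N w) - Y 0%N 0%N w| ^+ 2)%R])%E) :
  exists delta : R, 0 < delta /\
    forall h, (0 < h)%N ->
      (P [set w | limn_einf (fun n => (LL h (Theta n h w))%:E) =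
                  (inf (range (LL h)))%:E]
       <= (delta^-1 * expR (- delta * h%:R))%:E)%E.
Proof.
have [c [/andP[c0 c1] alive]] := alive_probability P d a b kappa q_ge0 q_measurable eta_gt0 q_supp.
exists c; split => // h h0.
have [E [mE dead PE]] := alive h (Theta 0%N h) h0 (Theta0_indep h h0)
  (fun i x => Theta0_law h i x h0).
have gap := @risk_gap _ Omega R P d a b sigma sigmaE (X 0 0)%N (Y 0 0)%N (X_cube 0 0)%N f p
  f_bounded f_measurable f_cont p_ge0 p_cont p_supp
  (fun B mB BK => etrans (X_law B mB BK).1 (X_law B mB BK).2) EYX h (LL h) (fun theta => LLE h theta h0).
have {}gap : forall i : 'I_h, exists2 e, 0 < e &
    forall theta : 'rV[R]_(param_dim d h), theta ord0 (out_idx d i) = 0 ->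
    inf (range (LL h)) + e <= LL h theta.
  apply: gap => n theta n0 E0; apply: (not_attained n n0); exists theta => //.
  by rewrite LLE.
have sub : [set w | limn_einf (fun n => (LL h (Theta n h w))%:E) =
    (inf (range (LL h)))%:E] `<=` \bigcap_i ~` E i.
  (* The gap [e] is independent of the training step, so it survives the limit inferior. *)
  move=> w lim i _ Ei; have [e e0 He] := gap i.
  have : ((inf (range (LL h)) + e)%:E <= limn_einf (fun n => (LL h (Theta n h w))%:E))%E.
    apply: limn_einf_ge => n; rewrite lee_fin.
    have dn := @dead_neuron_stays R d h a b sigma sigmaE (fun n m => X n m w) (fun n m => Y n m w)
      (fun n => M n h) (fun n m => X_cube n m w) (fun n theta => EL n h theta w)
      (fun n theta => G n h theta w) (fun n theta => ELE n h theta w)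
      (fun n i k theta => GE n h i k theta w) (fun n => Theta n h w) (fun n => Phi n h)
      (fun n => Phi0 n h) (fun n => ThetaS n h w) i n (dead i w Ei).
    have [theta' t0 ->] := population_risk_dead sigmaE (fun theta => LLE h theta h0) (X_cube 0 0)%N dn.
    exact: He.
  by rewrite lim lee_fin gerDl leNgt e0.
have mS : measurable [set w | limn_einf (fun n => (LL h (Theta n h w))%:E) =
    (inf (range (LL h)))%:E].
  have mL : measurable_fun setT (fun w => limn_einf (fun n => (LL h (Theta n h w))%:E)).
    rewrite /limn_einf; apply: measurableT_comp => //.
    apply: measurable_fun_limn_esup => n; apply: measurableT_comp => //; apply/measurable_EFinP.
    apply: measurableT_comp; last exact: measurable_funPT.
    exact: (measurable_population_risk sigmaE (fun theta => LLE h theta h0)).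
  rewrite -[X in measurable X]setTI.
  exact: (mL measurableT [set (inf (range (LL h)))%:E] (emeasurable_set1 _)).
apply: (@le_trans _ _ (P (\bigcap_i ~` E i))).
  apply: le_measure => //; rewrite inE//.
  by apply: fin_bigcap_measurable => [|i _]; [exact: finite_finset|exact: measurableC].
apply: (le_trans PE); rewrite lee_fin.
have ec : 1 - c <= expR (- c) by exact: expR_ge1Dx.
apply: (@le_trans _ _ (expR (- c) ^+ h)).
  by rewrite lerXn2r ?nnegrE ?subr_ge0 ?expR_ge0.
by rewrite -expRM_natr ler_peMl ?expR_ge0// invr_ge1 ?unitf_gt0 // c0.
Qed.
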